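(* Let $G=(V,E)$ be a finite connected graph with at least one cycle and let $\mathcal T$ be its universal cover. Assume that every vertex in $G$ has at least $d_{\min}$ distinct neighbors. Leaving $V$ and $E$ fixed, let $\mathcal P\subset\mathbb R^{|E|+|V|}$ be the set of Hermitian edge weights $a$ and real potentials $b$ for which $\operatorname{Spec}_pA_{\mathcal T}\ne\emptyset$. Then $\mathcal P$ is a closed semialgebraic set of codimension at least $\max\{d_{\min}-1,1\}$.
   Context: Graphs. A graph $G=(V,E)$ (self-loops and multi-edges allowed) has a vertex set $V$, a set $E$ of directed edges with a fixed-point-free direction-reversing involution $e\mapsto\check e$, and source and terminal maps $\sigma,\tau:E\to V$ with $\sigma(e)=\tau(\check e)$. For a vertex $u$, $\tau(u)$ also denotes the set of directed edges with terminal $u$. Hermitian edge weights are functions $a:E\to\mathbb C$ with $\overline{a_e}=a_{\check e}$ for all $e$; a potential is a function $b:V\to\mathbb R$. Choosing one edge from each pair $\{e,\check e\}$, the space of all pairs $(a,b)$ is identified with $\mathbb C^{|E|/2}\oplus\mathbb R^{|V|}\cong\mathbb R^{|E|+|V|}$. A non-backtracking walk is a sequence of edges $e_1,\dots,e_\ell$ with $\tau(e_s)=\sigma(e_{s+1})$ and $e_s\ne\check e_{s+1}$ for $1\le s\le \ell-1$; $G$ has a cycle if it contains a closed non-backtracking walk. Universal cover. The universal cover $\mathcal T=(\mathcal V,\mathcal E)$ of a connected $G$ is the tree whose vertices are the non-backtracking walks in $G$ starting at a fixed root (including the empty walk), two walks being joined by an edge (in both directions) when one extends the other by one edge; $\Xi:\mathcal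 T\to G$ is the covering map. Given $(a,b)$ on $G$, put $\mathscr a_{\tilde e}=a_{\Xi(\tilde e)}$, $\mathscr b_{\tilde v}=b_{\Xi(\tilde v)}$, and let $A_{\mathcal T}$ be the bounded self-adjoint operator on $\ell^2(\mathcal V)$ with $(A_{\mathcal T}\eta)(u)=\mathscr b_u\eta(u)+\sum_{e\in\tau(u)}\mathscr a_e\,\eta(\sigma(e))$. Its point spectrum is $\operatorname{Spec}_pA_{\mathcal T}=\{\lambda\in\mathbb R:\operatorname{Ker}(\lambda-A_{\mathcal T})\ne\{0\}\}$. The dimension of a semialgebraic set $\mathcal S\subset\mathbb R^N$ is the largest $d$ such that an open cube $(0,1)^{d}$ appears in a decomposition of $\mathcal S$ into finitely many disjoint semialgebraic subsets, each diffeomorphic to some open cube $(0,1)^{d_i}$ (equivalently its Hausdorff dimension); its codimension is $N-\dim\mathcal S$. *)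

(* Defs.v *)
From HB Require Import structures.
From mathcomp Require Import all_boot all_order all_algebra.
From mathcomp Require Import all_classical all_reals all_analysis.
From mathcomp.real_closed Require Import complex.
From mathcomp Require mpoly.

Set Implicit Arguments.
Unset Strict Implicit.
Unset Printing Implicit Defensive.

Import Order.TTheory GRing.Theory Num.Theory.
Import numFieldNormedType.Exports.

Local Open Scope classical_set_scope.
Local Open Scope ring_scope.

(* [V] and [E] may be infinite, so that a universal cover is again a [graph];
   [E] is the type of directed edges, loops and multiple edges are allowed. *)
Record graph (V E : choiceType) := Graph {
  src : E -> V;
  tgt : E -> V;
  rev : E -> E;
  revK : involutive rev;
  rev_neq : forall e, rev e != e;
  tgt_rev : forall e, tgt (rev e) = src e }.

Definition tau (V E : choiceType) (G : graph V E) (u : V) : set E :=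
  [set e | tgt G e = u].

Section FiniteGraph.
Variables (V E : finType) (G : graph V E).

Definition adjacent : rel V :=
  [rel u v | [exists e, (src G e == u) && (tgt G e == v)]].

Definition connected_graph := forall u v : V, connect adjacent u v.

Definition neighbors (v : V) : {set V} := [set u | adjacent u v]%SET.

Definition non_backtracking (w : seq E) : bool :=
  sorted [rel e f | (tgt G e == src G f) && (e != rev G f)] w.

Definition has_cycle := exists (e : E) (w : seq E),
  non_backtracking (e :: w) /\ tgt G (last e w) = src G e.

Definition walk_from (r : V) (w : seq E) : bool :=
  non_backtracking w && (if w is e :: _ then src G e == r else true).

Definition cover_vertex (r : V) : choiceType := {w : seq E | walk_from r w}.

(* [(w, w', e)] is the tree edge from [w] to [w'] lying over [e]: either [w']
   extends [w] by [e], or [w] extends [w'] by the reverse of [e].  The last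
   component is determined by the first two. *)
Definition is_cover_edge (r : V)
    (t : cover_vertex r * cover_vertex r * E) : bool :=
  let: (w, w', e) := t in
  (val w' == rcons (val w) e) || (val w == rcons (val w') (rev G e)).

Definition cover_edge (r : V) : choiceType :=
  {t : cover_vertex r * cover_vertex r * E | is_cover_edge t}.

Section Cover.
Variable r : V.

Definition cover_src (t : cover_edge r) : cover_vertex r := (val t).1.1.

Definition cover_tgt (t : cover_edge r) : cover_vertex r := (val t).1.2.

Lemma cover_rev_subproof (t : cover_edge r) :
  is_cover_edge ((val t).1.2, (val t).1.1, rev G (val t).2).
Proof. by case: t => -[[w w'] e] /= h; rewrite revK orbC. Qed.

Definition cover_rev (t : cover_edge r) : cover_edge r :=
  exist (fun t => is_cover_edge t) _ (cover_rev_subproof t).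

Lemma cover_revK : involutive cover_rev.
Proof. by case=> -[[w w'] e] h; apply: val_inj; rewrite /= revK. Qed.

Lemma cover_rev_neq t : cover_rev t != t.
Proof.
apply/eqP => /(congr1 (fun t : cover_edge r => (val t).2)) /= /eqP.
exact/negP/rev_neq.
Qed.

Definition universal_cover : graph (cover_vertex r) (cover_edge r) :=
  @Graph _ _ cover_src cover_tgt cover_rev cover_revK cover_rev_neq
    (fun=> erefl).

Definition cover_mapV (w : cover_vertex r) : V := last r (map (tgt G) (val w)).

Definition cover_mapE (t : cover_edge r) : E := (val t).2.

End Cover.
End FiniteGraph.

Definition hermitian_weights (R : realType) (V E : choiceType)
    (G : graph V E) (a : E -> R[i]) :=
  forall e, conjc (a e) = a (rev G e).

Definition ell2 (R : realType) (T : choiceType) : set (T -> R[i]) :=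
  [set eta | (\esum_(v in [set: T]) (ComplexField.Normc.normc (eta v) ^+ 2)%:E < +oo)%E].

(* The sum is over a classical set and is the usual finite sum as soon as
   [tau G u] is finite, as is the case for covers of finite graphs. *)
Definition adj_op (R : realType) (V E : choiceType) (G : graph V E)
    (a : E -> R[i]) (b : V -> R) (eta : V -> R[i]) : V -> R[i] :=
  fun u => (b u)%:C%C * eta u + \sum_(e \in tau G u) a e * eta (src G e).

Definition point_spectrum (R : realType) (V E : choiceType) (G : graph V E)
    (a : E -> R[i]) (b : V -> R) : set R :=
  [set lambda | exists2 eta : V -> R[i], ell2 eta /\ (exists v, eta v != 0)
     & forall u, lambda%:C%C * eta u - adj_op G a b eta u = 0].

(* One edge out of each pair of opposite edges. *)
Definition orientation (V E : finType) (G : graph V E) (O : {set E}) :=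
  forall e, (rev G e \in O) = (e \notin O).

(* The identification of pairs (a, b) with points of R^(|E| + |V|): the
   coordinate of an edge of [O] is the real part of its weight, and that of an
   edge outside [O] is the imaginary part of the weight of its reverse. *)
Definition param_point (R : realType) (V E : finType) (G : graph V E)
    (O : {set E}) (a : E -> R[i]) (b : V -> R) : 'rV[R]_(#|E| + #|V|) :=
  row_mx (\row_(k < #|E|) (let e := enum_val k in
            if e \in O then complex.Re (a e) else complex.Im (a (rev G e))))
         (\row_(k < #|V|) b (enum_val k)).

Definition point_spectrum_params (R : realType) (V E : finType)
    (G : graph V E) (O : {set E}) (r : V) : set 'rV[R]_(#|E| + #|V|) :=
  [set x | exists (a : E -> R[i]) (b : V -> R),
    [/\ hermitian_weights G a,
        point_spectrum (universal_cover G r)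
          (a \o @cover_mapE V E G r) (b \o @cover_mapV V E G r) !=set0
      & x = param_point G O a b]].

(* Qualified names: the notations of [mpoly] are incompatible with those of
   the analysis library. *)
Definition peval (R : realType) (N : nat) (x : 'rV[R]_N)
    (p : mpoly.mpoly N R) : R :=
  mpoly.meval (fun i => x 0 i) p.

Definition basic_semialgebraic (R : realType) (N : nat)
    (c : seq (mpoly.mpoly N R) * seq (mpoly.mpoly N R)) : set 'rV[R]_N :=
  [set x | all (fun p => peval x p == 0) c.1 &&
           all (fun p => 0 < peval x p) c.2].

Definition semialgebraic (R : realType) (N : nat) (S : set 'rV[R]_N) :=
  exists (l : nat)
    (c : 'I_l -> seq (mpoly.mpoly N R) * seq (mpoly.mpoly N R)),
    S = \bigcup_i basic_semialgebraic (c i).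

(* For open [U]: all iterated partial derivatives of order at most [k] exist
   and are continuous on [U]. *)
Fixpoint Ck (R : realType) (m n k : nat) (U : set 'rV[R]_m)
    (f : 'rV[R]_m -> 'rV[R]_n) : Prop :=
  (forall x, U x -> {for x, continuous f}) /\
  (if k is k'.+1 then
     forall i : 'I_m,
       (forall x, U x -> derivable f x (delta_mx 0 i)) /\
       Ck k' U (fun x => 'D_(delta_mx 0 i) f x)
   else True).

(* Smoothness on a set that need not be open: local extendability to smooth
   maps on open sets. *)
Definition smooth_on (R : realType) (m n : nat) (A : set 'rV[R]_m)
    (f : 'rV[R]_m -> 'rV[R]_n) :=
  forall x, A x -> exists (U : set 'rV[R]_m) (F : 'rV[R]_m -> 'rV[R]_n),
    [/\ open U, U x, forall k, Ck k U F & forall y, U y -> A y -> F y = f y].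

Definition diffeomorphic (R : realType) (m n : nat)
    (A : set 'rV[R]_m) (B : set 'rV[R]_n) :=
  exists (f : 'rV[R]_m -> 'rV[R]_n) (g : 'rV[R]_n -> 'rV[R]_m),
    [/\ smooth_on A f /\ smooth_on B g,
        forall x, A x -> B (f x) /\ g (f x) = x
      & forall y, B y -> A (g y) /\ f (g y) = y].

Definition open_cube (R : realType) (d : nat) : set 'rV[R]_d :=
  [set x : 'rV[R]_d | forall i : 'I_d, 0 < x 0 i < 1].

Definition cube_decomposition (R : realType) (N : nat) (S : set 'rV[R]_N)
    (l : nat) (C : 'I_l -> set 'rV[R]_N) (d : 'I_l -> nat) :=
  [/\ S = \bigcup_i C i,
      trivIset [set: 'I_l] C
    & forall i, semialgebraic (C i) /\ diffeomorphic (C i) (@open_cube R (d i))].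

(* The supremum of the finite set of dimensions that occur, hence a maximum,
   except that the empty set has dimension -oo and thus codimension +oo. *)
Definition semialg_dim (R : realType) (N : nat) (S : set 'rV[R]_N) : \bar R :=
  ereal_sup [set x : \bar R | exists (l : nat) (C : 'I_l -> set 'rV[R]_N)
    (d : 'I_l -> nat), cube_decomposition S C d /\
      exists i, x = (d i)%:R%:E].

Definition semialg_codim (R : realType) (N : nat) (S : set 'rV[R]_N) : \bar R :=
  (N%:R%:E - semialg_dim S)%E.

(* Main.v *)
(* An eigenfunction of the universal cover is carried by finite pieces: let [X]
   be the set of vertices at which some eigenfunction on the branch behind a
   vertex does not vanish, and let [F] support the weights.  The Wronskian of two
   eigenfunctions vanishes, so that along an edge inside [X] they are all
   multiplied by the same ratio, and square summability forces the edges inside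
   [X] to form a forest.  A variational comparison with the Green function of a
   bipartite graph (vertices of [X] against boundary vertices and inner edges),
   given by cavity equations with a regularization [eps] tending to 0, yields
     rank (lam - A_X) + #(boundary of X) < #X,
   where [A_X] is the finite matrix of the subgraph [X].  Conversely, under this
   inequality the limits of these Green functions are eigenfunctions.  For
   Hermitian [A_X] the existence of such a [lam] is a multiplicity condition,
   that is, the vanishing of a polynomial in the parameters, so that the
   parameter set is a finite union of real algebraic sets.

   For the codimension, a parameter satisfying the inequality is determined, in
   a locally Lipschitz way, by [lam], the weights on [F] and all but more than
   #(boundary of X) of the potentials, because a Hermitian matrix is determined
   by its rows through a nonsingular principal minor of maximal size.  A leaf
   of the forest has all but one of its neighbors behind missing edges or on the
   boundary, so that at least [dmin - 1] coordinates are lost; at least one is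
   lost since otherwise [G] would be a tree.  A packing argument and Baire's
   theorem then bound the dimension of a smooth cube in the parameter set. *)

From HB Require Import structures.
Require Import Defs.
From mathcomp Require Import all_boot all_order all_algebra.
From mathcomp Require Import all_classical all_reals all_analysis.
From mathcomp.real_closed Require Import complex.
From mathcomp Require Import ring lra finmap zify perm.
From mathcomp Require mpoly.

Set Implicit Arguments.
Unset Strict Implicit.
Unset Printing Implicit Defensive.

Import Order.TTheory GRing.Theory Num.Theory.
Import numFieldNormedType.Exports.
Import (canonicals) mpoly.

Local Open Scope classical_set_scope.
Local Open Scope ring_scope.

Local Notation rev := Defs.rev.
Local Notation src := Defs.src.
Local Notation tgt := Defs.tgt.

(** The inequality comes from an index identity. In the bipartite graph, [eps] times the Green
    function at a node tends to the mass of the kernel there, and counting edge contributions from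
    both ends gives, before any limit, #white - white mass = #black - black mass. An eigenfunction
    serves as a test function: it keeps the white mass away from 0 and forces the black mass to 0.
    Read backwards, #black < #white leaves some white mass, and the rescaled Green functions rooted
    there have norms bounded independently of [eps]. The ratios along inner edges depend on unknown
    eigenfunctions, but on a forest each inner edge is one independent condition, so that the ratios
    can be traded for the rank of [lam - A_X]. The support of the weights jumps under limits;
    allowing any symmetric [F] that contains it makes the condition closed for each pair [(F, X)].
    As the dimension ranges over all cube decompositions, every smooth cube inside the parameter set
    has to be bounded: countably many bounded pieces of small packing dimension cover the set, and
    the strictness of the inequality pays for the extra coordinate [lam]. *)

Section SquaredModulus.
Variable R : realType.
Implicit Types (x y z : R[i]).

Definition sqn z : R := complex.Re z ^+ 2 + complex.Im z ^+ 2.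

Lemma sqnE z : ComplexField.Normc.normc z ^+ 2 = sqn z.
Proof. by case: z => x y; rewrite /sqn /= sqr_sqrtr // addr_ge0 ?sqr_ge0. Qed.

Lemma sqn_ge0 z : 0 <= sqn z.
Proof. by rewrite addr_ge0 ?sqr_ge0. Qed.

Lemma sqnM x y : sqn (x * y) = sqn x * sqn y.
Proof. by case: x => a b; case: y => c d; rewrite /sqn /=; ring. Qed.

Lemma sqn_conj z : sqn (conjc z) = sqn z.
Proof. by case: z => a b; rewrite /sqn /= sqrrN. Qed.

Lemma sqnN z : sqn (- z) = sqn z.
Proof. by case: z => a b; rewrite /sqn /= !sqrrN. Qed.

Lemma sqn0 : sqn 0 = 0.
Proof. by rewrite /sqn /= expr0n addr0. Qed.

Lemma sqn1 : sqn 1 = 1.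
Proof. by rewrite /sqn /= expr1n expr0n addr0. Qed.

Lemma sqnR (r : R) : sqn r%:C%C = r ^+ 2.
Proof. by rewrite /sqn /= expr0n addr0. Qed.

Lemma sqn_eq0 z : (sqn z == 0) = (z == 0).
Proof.
case: z => a b; rewrite /sqn /= paddr_eq0 ?sqr_ge0 // !sqrf_eq0.
by rewrite eq_complex.
Qed.

Lemma sqn_gt0 z : (0 < sqn z) = (z != 0).
Proof. by rewrite lt0r sqn_eq0 sqn_ge0 andbT. Qed.

Lemma sqnC z : (sqn z)%:C%C = z * conjc z.
Proof.
case: z => a b; rewrite /sqn; apply/eqP; rewrite eq_complex /=.
by apply/andP; split; apply/eqP; ring.
Qed.

Lemma Re_mul_le x y : (complex.Re (x * y)) ^+ 2 <= sqn x * sqn y.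
Proof.
case: x => a b; case: y => c d; rewrite /sqn /= -subr_ge0.
have -> : (a ^+ 2 + b ^+ 2) * (c ^+ 2 + d ^+ 2) - (a * c - b * d) ^+ 2 =
  (a * d + b * c) ^+ 2 by ring.
exact: sqr_ge0.
Qed.

(** Cauchy-Schwarz with weights; the [Y i] will be cavity values, and the lemma bounds from below
    the energy of values with a prescribed linear combination. The inductive step absorbs the cross
    term by comparing arithmetic and geometric means. *)
Lemma sqn_sum_le (I : finType) (P : pred I) (c z : I -> R[i]) (Y : I -> R) :
  (forall i, P i -> 0 < Y i) ->
  sqn (\sum_(i | P i) c i * z i) <=
  (\sum_(i | P i) sqn (c i) / Y i) * \sum_(i | P i) Y i * sqn (z i).
Proof.
move=> Y0.
pose K (u : R[i]) (t v : R) := [/\ sqn u <= t * v, 0 <= t & 0 <= v].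
suff: K (\sum_(i | P i) c i * z i) (\sum_(i | P i) sqn (c i) / Y i)
        (\sum_(i | P i) Y i * sqn (z i)) by case.
apply: (big_rec3 K); first by rewrite /K sqn0 mulr0.
move=> i u t v Pi [h t0 v0]; have y0 := Y0 _ Pi.
have q1 := sqn_ge0 (c i); have q2 := sqn_ge0 (z i).
split; last 2 first.
- by rewrite addr_ge0 // divr_ge0 // ltW.
- by rewrite addr_ge0 // mulr_ge0 // ltW.
set T := sqn (c i) / Y i; set S := Y i * sqn (z i).
have T0 : 0 <= T by rewrite divr_ge0 // ltW.
have S0 : 0 <= S by rewrite mulr_ge0 // ltW.
have e1 : sqn (c i * z i) = T * S.
  by rewrite sqnM /T /S; field; rewrite gt_eqF.
have cross : sqn (c i * z i + u) =
    T * S + sqn u + 2 * complex.Re (conjc (c i * z i) * u).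
  rewrite -e1; case: (c i * z i) => a b; case: u {h} => a' b'.
  by rewrite /sqn /=; ring.
rewrite cross.
have hre : (complex.Re (conjc (c i * z i) * u)) ^+ 2 <= (T * v) * (t * S).
  apply: le_trans (Re_mul_le _ _) _; rewrite sqn_conj e1.
  have -> : T * v * (t * S) = (T * S) * (t * v) by ring.
  by rewrite ler_wpM2l // mulr_ge0.
have tv0 : 0 <= T * v by rewrite mulr_ge0.
have ts0 : 0 <= t * S by rewrite mulr_ge0.
have : 2 * complex.Re (conjc (c i * z i) * u) <= T * v + t * S.
  set A := complex.Re _ in hre *.
  have : (2 * A) ^+ 2 <= (T * v + t * S) ^+ 2.
    have := sqr_ge0 (T * v - t * S); nra.
  have p0 : 0 <= T * v + t * S by rewrite addr_ge0.
  move=> h2; have [A0|A0] := leP 0 A; last by apply: le_trans p0; nra.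
  by rewrite -(ler_pXn2r (n := 2)) ?nnegrE // mulr_ge0.
move=> hh; rewrite mulrDl !mulrDr; lra.
Qed.

End SquaredModulus.
Arguments sqn {R} z.

(** * Walks in the universal cover *)

Section Walks.
Variables (R : realType) (V E : finType) (G : graph V E).

Definition wend (r : V) (w : seq E) := last r (map (tgt G) w).

Definition ext (r : V) (w : seq E) (e : E) :=
  (src G e == wend r w) &&
  (if w is x :: w' then last x w' != rev G e else true).

(* The edge [e], issued from the end of [w], is appended to [w] and the result
   is reduced. *)
Definition wact (w : seq E) (e : E) : seq E :=
  if w is x :: w' then
    (if last x w' == rev G e then belast x w' else rcons w e)
  else [:: e].

(** Left multiplication by [e] with reduction: it moves the root of the tree across [e], while
    [wact] moves the end of the walk. *)
Definition lact (e : E) (w : seq E) : seq E :=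
  if w is f :: w' then (if f == rev G e then w' else e :: w) else [:: e].

Lemma tgt_revE e : tgt G (rev G e) = src G e. Proof. exact: tgt_rev. Qed.

Lemma src_revE e : src G (rev G e) = tgt G e.
Proof. by rewrite -tgt_rev Defs.revK. Qed.

Lemma rev_eq e f : (rev G e == f) = (e == rev G f).
Proof. by apply/eqP/eqP => [<-|->]; rewrite Defs.revK. Qed.

Lemma wend_rcons r w e : wend r (rcons w e) = tgt G e.
Proof. by rewrite /wend map_rcons last_rcons. Qed.

Lemma wend_cons r w e : wend r (e :: w) = wend (tgt G e) w.
Proof. by []. Qed.

Lemma walk_nil r : walk_from G r [::]. Proof. by []. Qed.

Lemma walk_rcons r w e :
  walk_from G r (rcons w e) = walk_from G r w && ext r w e.
Proof.
rewrite /walk_from /non_backtracking /ext; case: w => [|x w] /=.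
  by rewrite andbT.
rewrite rcons_path /wend /= last_map [src G e == _]eq_sym.
by do !case: (_ == _); rewrite ?andbT ?andbF //; case: (path _ _ _).
Qed.

Lemma ext_rcons r w f e :
  ext r (rcons w f) e = (src G e == tgt G f) && (f != rev G e).
Proof.
by rewrite /ext wend_rcons; case: w => [|x w] //=; rewrite last_rcons.
Qed.

Lemma walk_cons r w e :
  walk_from G r (e :: w) = [&& src G e == r, walk_from G (tgt G e) w
    & (if w is f :: _ then e != rev G f else true)].
Proof.
rewrite /walk_from /non_backtracking; case: w => [|f w] /=.
  by rewrite !andbT.
rewrite [src G f == _]eq_sym.
by do !case: (_ == _); rewrite ?andbT ?andbF //=; case: (path _ _ _).
Qed.

Lemma wact_rcons w f e :
  wact (rcons w f) e = if f == rev G e then w else rcons (rcons w f) e.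
Proof.
by case: w => [|x w] /=; [case: ifP | rewrite last_rcons belast_rcons].
Qed.

Lemma wact_ext r w e : ext r w e -> wact w e = rcons w e.
Proof. by case: w => [|x w] //= /andP[_ /negbTE ->]. Qed.

Lemma wact_walk r w e :
  walk_from G r w -> src G e = wend r w -> walk_from G r (wact w e).
Proof.
case/lastP: w => [|w f] hw he; first by rewrite /= walk_cons /= he eqxx.
rewrite wact_rcons; case: eqP => [_|ne].
  by move: hw; rewrite walk_rcons => /andP[].
rewrite walk_rcons hw /= ext_rcons -(wend_rcons r w) he eqxx /=.
exact/eqP.
Qed.

Lemma wend_wact r w e :
  walk_from G r w -> src G e = wend r w -> wend r (wact w e) = tgt G e.
Proof.
case/lastP: w => [|w f] hw he //.
rewrite wact_rcons; case: eqP => [ef|ne]; last by rewrite wend_rcons.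
move: hw; rewrite walk_rcons => /andP[_ /andP[/eqP <- _]].
by rewrite ef src_revE.
Qed.

(** The alternative concerns words that begin with a backtracking, where both multiplications cancel
    an edge; [lactK_walk] discards it. *)
Lemma lactK e w : lact (rev G e) (lact e w) = w \/ (exists w', w = [:: rev G e, e & w']).
Proof.
case: w => [|f w] /=; first by rewrite Defs.revK eqxx; left.
case: eqP => [->|ne] /=; last by rewrite Defs.revK eqxx; left.
case: w => [|g w] /=; first by left.
by rewrite Defs.revK; case: eqP => [->|_]; [right; exists w | left].
Qed.

Lemma lactK_walk r e w : walk_from G r w -> lact (rev G e) (lact e w) = w.
Proof.
move=> hw; case: (lactK e w) => // -[w' ew]; move: hw; rewrite ew.
by rewrite !walk_cons eqxx !andbF.
Qed.

Lemma lact_walk e w : walk_from G (tgt G e) w -> walk_from G (src G e) (lact e w).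
Proof.
case: w => [|f w]; first by rewrite /= walk_cons /= eqxx.
rewrite /=; case: eqP => [->|ne].
  by rewrite walk_cons tgt_revE => /and3P[].
rewrite [walk_from _ _ (e :: _)]walk_cons eqxx => -> /=.
by rewrite eq_sym rev_eq; apply/eqP.
Qed.

Lemma wend_lact e w :
  walk_from G (tgt G e) w -> wend (src G e) (lact e w) = wend (tgt G e) w.
Proof.
case: w => [|f w] //=; case: eqP => [->|] // _.
by rewrite wend_cons tgt_revE.
Qed.

(** The reductions at the two ends interfere only on words of length at most one. This commutation
    is why moving the root preserves the eigenvalue equation. *)
Lemma wact_lact e w f :
  walk_from G (tgt G e) w -> wact (lact e w) f = lact e (wact w f).
Proof.
case/lastP: w => [|w g].
  by rewrite /= -rev_eq eq_sym; case: eqP.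
rewrite wact_rcons.
case: w => [|h w].
  rewrite /= => _; case: (g =P rev G e) => [->|ne] /=.
    by rewrite (inj_eq (can_inj (@Defs.revK _ _ G))) [e == f]eq_sym; case: eqP => [->|] /=; rewrite ?eqxx.
  case: ifP => //= _; case: eqP => [|//]. by move=> /ne.
rewrite /= => hw; case: (h =P rev G e) => [eh|ne] /=.
  rewrite wact_rcons; case: ifP => //= _; rewrite ?eh ?eqxx //.
rewrite last_rcons belast_rcons; case: ifP => //= _.
  by case: eqP => // /ne.
by case: eqP => // /ne.
Qed.

Fixpoint level (r : V) (n : nat) : seq (seq E) :=
  if n is m.+1 then
    [seq rcons w e | w <- level r m, e <- [seq e <- enum E | ext r w e]]
  else [:: [::]].

Lemma big_levelS r n (T : nmodType) (f : seq E -> T) :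
  \sum_(w <- level r n.+1) f w =
  \sum_(w <- level r n) \sum_(e | ext r w e) f (rcons w e).
Proof.
rewrite /= big_allpairs_dep; apply: eq_bigr => w _.
by rewrite big_filter big_enum_cond.
Qed.

Lemma mem_level r n w : (w \in level r n) = walk_from G r w && (size w == n).
Proof.
elim: n w => [|n IH] w; first by rewrite inE; case: w => [|x w]//=; rewrite andbF.
apply/idP/idP => [/allpairsPdep[u [e [hu]]]|].
  rewrite mem_filter => /andP[he _] ->; rewrite walk_rcons size_rcons.
  by move: hu; rewrite IH => /andP[-> /eqP ->]; rewrite he /=.
case/lastP: w => [|w e]; first by rewrite andbF.
rewrite walk_rcons size_rcons eqSS => /andP[/andP[h1 h2] h3].
apply/allpairsPdep; exists w, e; split => //; first by rewrite IH h1.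
by rewrite mem_filter h2 mem_enum.
Qed.

Lemma uniq_level r n : uniq (level r n).
Proof.
elim: n => //= n IH; apply: allpairs_uniq_dep => //.
  by move=> w _; rewrite filter_uniq // enum_uniq.
move=> [w e] [w' e'] _ _ /= /rcons_inj [-> ->] //.
Qed.

Definition walk_ball r n := flatten [seq level r k | k <- iota 0 n].

Lemma big_walk_ball r n (T : nmodType) (f : seq E -> T) :
  \sum_(w <- walk_ball r n) f w = \sum_(0 <= k < n) \sum_(w <- level r k) f w.
Proof. by rewrite big_flatten /= big_map /index_iota subn0. Qed.

Lemma mem_walk_ball r n w : (w \in walk_ball r n) = walk_from G r w && (size w < n)%N.
Proof.
apply/flattenP/idP => [[s /mapP[k]]|/andP[h1 h2]].
  by rewrite mem_iota /= add0n => hk ->; rewrite mem_level => /andP[-> /eqP ->].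
exists (level r (size w)); last by rewrite mem_level h1 eqxx.
by apply/mapP; exists (size w) => //; rewrite mem_iota.
Qed.

Lemma uniq_walk_ball r n : uniq (walk_ball r n).
Proof.
elim: n => // n IH; rewrite /walk_ball -addn1 iotaD map_cat flatten_cat cat_uniq IH /=.
rewrite add0n cats0 uniq_level andbT; apply/hasPn => w.
by rewrite mem_level mem_walk_ball => /andP[-> /eqP ->]; rewrite ltnn.
Qed.

Lemma sum_uniq_sub (T : eqType) (f : T -> R) (s s' : seq T) :
  (forall w, 0 <= f w) -> uniq s -> uniq s' -> {subset s <= s'} ->
  \sum_(w <- s) f w <= \sum_(w <- s') f w.
Proof.
move=> f0 us us' ss'; rewrite [leRHS](bigID (mem s)) /=.
have pe : perm_eq s [seq x <- s' | mem s x].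
  apply: uniq_perm => //; first exact: filter_uniq.
  by move=> w; rewrite mem_filter /=; case: (boolP (w \in s)) => // /ss' ->.
by rewrite -[X in _ <= X + _]big_filter -(perm_big _ pe) lerDl sumr_ge0.
Qed.

Definition sums_below (r : V) (h : seq E -> R) (K : R) :=
  forall s : seq (seq E), uniq s -> all (walk_from G r) s ->
    \sum_(w <- s) h w <= K.

Definition square_summable (r : V) (eta : seq E -> R[i]) :=
  exists K : R, sums_below r (sqn \o eta) K.

Lemma sums_below_ball r h K : (forall w, 0 <= h w) ->
  (forall n, \sum_(w <- walk_ball r n) h w <= K) -> sums_below r h K.
Proof.
move=> h0 H s us hs.
apply: le_trans (H (\max_(w <- s) (size w).+1)%N).
apply: sum_uniq_sub; rewrite ?uniq_walk_ball // => w ws; rewrite mem_walk_ball.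
by rewrite (allP hs) //= (big_rem w ws) /= leq_max leqnn.
Qed.

Lemma ball_below r h K n : sums_below r h K -> \sum_(w <- walk_ball r n) h w <= K.
Proof.
move=> H; apply: H; first exact: uniq_walk_ball.
by apply/allP => w; rewrite mem_walk_ball => /andP[].
Qed.

Lemma level_ge0 r h n : (forall w, 0 <= h w) -> 0 <= \sum_(w <- level r n) h w :> R.
Proof. by move=> h0; apply: sumr_ge0. Qed.

(** In the sum over the first [n] pairs of consecutive levels each level occurs at most twice,
    whence the bound [2 * K]; pairs of mass at least [d] would make it grow like [n * d]. *)
Lemma level_tail r h K (d : R) : (forall w, 0 <= h w) -> sums_below r h K ->
  0 < d -> exists n, \sum_(w <- level r n) h w + \sum_(w <- level r n.+1) h w < d.
Proof.
move=> h0 hK d0; apply: contrapT => /forallNP H.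
have H2 n : n%:R * d <= 2 * K.
  have : \sum_(0 <= k < n) (\sum_(w <- level r k) h w
            + \sum_(w <- level r k.+1) h w) <= 2 * K.
    rewrite big_split /= -big_walk_ball mulr_natl mulr2n lerD //.
      exact: ball_below.
    apply: le_trans (ball_below n.+1 hK).
    by rewrite big_walk_ball [leRHS]big_nat_recl // lerDr level_ge0.
  apply: le_trans.
  have -> : n%:R * d = \sum_(0 <= k < n) d by rewrite sumr_const_nat subn0 mulr_natl.
  by apply: ler_sum => k _; rewrite leNgt; apply/negP/H.
have [n hn] : exists n : nat, 2 * K / d < n%:R.
  by exists (Num.trunc (2 * K / d)).+1; rewrite Num.Theory.truncnS_gt.
by have := H2 n; rewrite leNgt -ltr_pdivrMr // hn.
Qed.

Lemma level_children_le r n (h : seq E -> R) : (forall w, 0 <= h w) ->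
  \sum_(w <- level r n) \sum_(e | ext r w e) h w <=
  #|E|%:R * \sum_(w <- level r n) h w.
Proof.
move=> h0; rewrite mulr_sumr; apply: ler_sum => w _.
rewrite sumr_const -[_ *+ _]mulr_natl ler_wpM2r // ler_nat.
exact: max_card.
Qed.

(* Iterating the inequality pushes the mass of [Psi] to infinity, where the
   summability of [h] kills it; only the sources [eps * h] remain. *)
Lemma sub_flux r (h Psi : seq E -> R) (eps c K : R) :
  (forall w, 0 <= h w) -> sums_below r h K -> 0 <= eps -> 0 <= c ->
  (forall w, walk_from G r w -> w != [::] ->
    Psi w <= eps * h w + \sum_(e | ext r w e) Psi (rcons w e)) ->
  (forall w e, walk_from G r w -> ext r w e ->
    Psi (rcons w e) <= c * (h w + h (rcons w e))) ->
  \sum_(w <- level r 1) Psi w <= eps * (K - h [::]).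
Proof.
move=> h0 hK e0 c0 sub bd.
have step n : \sum_(w <- level r 1) Psi w <=
    eps * (\sum_(w <- walk_ball r n.+1) h w - h [::]) + \sum_(w <- level r n.+1) Psi w.
  elim: n => [|n IH].
    by rewrite big_walk_ball big_nat1 /= big_seq1 subrr mulr0 add0r.
  apply: le_trans IH _.
  rewrite [in X in _ <= X](big_walk_ball r n.+2) big_nat_recr //= -big_walk_ball.
  have : \sum_(w <- level r n.+1) Psi w <= eps * \sum_(w <- level r n.+1) h w +
     \sum_(w <- level r n.+2) Psi w.
    rewrite [X in _ <= _ + X]big_levelS mulr_sumr -big_split big_seq [leRHS]big_seq.
    apply: ler_sum => w; rewrite mem_level => /andP[hw /eqP sw].
    by apply: sub => //; rewrite -size_eq0 sw.
  by rewrite -/(level r n.+1) => hh; rewrite !mulrBr mulrDr; lra.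
apply/ler_addgt0Pr => d d0.
(* A walk has at most [#|E|] extensions, so the last level of [Psi] is at most [c'] times the mass
   of [h] on two consecutive levels; the final 1 makes [c'] positive. *)
pose c' := c * (#|E|%:R + 1) + 1.
have c'0 : 0 < c' by rewrite ltr_wpDl // mulr_ge0 // addr_ge0.
have [n hn] := level_tail h0 hK (divr_gt0 d0 c'0).
apply: le_trans (step n) _; apply: lerD.
  by rewrite ler_wpM2l // lerB // ball_below.
have : \sum_(w <- level r n.+1) Psi w <= c' *
   (\sum_(w <- level r n) h w + \sum_(w <- level r n.+1) h w).
  apply: (@le_trans _ _ (c * (#|E|%:R * \sum_(w <- level r n) h w
       + \sum_(w <- level r n.+1) h w))).
    rewrite big_levelS [X in c * (_ + X)]big_levelS.
    apply: (@le_trans _ _ (c * (\sum_(w <- level r n) \sum_(e | ext r w e) h w +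
      \sum_(w <- level r n) \sum_(e | ext r w e) h (rcons w e)))).
      rewrite -big_split mulr_sumr big_seq [leRHS]big_seq.
      apply: ler_sum => w; rewrite mem_level => /andP[hw _].
      by rewrite -big_split mulr_sumr; apply: ler_sum => e he; apply: bd.
    by rewrite ler_wpM2l // lerD2r level_children_le.
  have := level_ge0 r n h0; have := level_ge0 r n.+1 h0.
  have : 0 <= #|E|%:R :> R by [].
  rewrite /c'; set x := \sum_(w <- _) _; set y := \sum_(w <- _) _; set m := #|E|%:R.
  move=> m0 x0 y0; have h1 : 0 <= c * x * m by rewrite !mulr_ge0.
  by nra.
by move/le_trans; apply; rewrite -ler_pdivlMl // mulrC ltW.
Qed.

Lemma level1 r (T : nmodType) (f : seq E -> T) :
  \sum_(w <- level r 1) f w = \sum_(e | src G e == r) f [:: e].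
Proof.
rewrite big_levelS big_seq1; apply: eq_bigl => e.
by rewrite /ext /= andbT.
Qed.

Variables (a : E -> R[i]) (b : V -> R) (lam : R).

(** The neighbor of [w] behind [e] is [wact w e], and the tree edge coming from it lies over the
    reverse of [e], whose weight is the conjugate of [a e]. Functions are defined on all words, but
    only their values at walks count. *)
Definition eigen_eq (r : V) (eta : seq E -> R[i]) :=
  forall w, walk_from G r w ->
    (lam - b (wend r w))%:C%C * eta w =
    \sum_(e | src G e == wend r w) conjc (a e) * eta (wact w e).

Definition eigenfun r eta := square_summable r eta /\ eigen_eq r eta.

Definition recenter e (eta : seq E -> R[i]) := eta \o lact e.

Lemma recenter_eigen e eta : eigenfun (src G e) eta -> eigenfun (tgt G e) (recenter e eta).
Proof.
case=> -[K hK] he; split.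
  exists K => s us /allP hs.
  have := hK [seq lact e w | w <- s]; rewrite big_map; apply.
    rewrite map_inj_in_uniq // => w w' hw hw' eq.
    by rewrite -(lactK_walk e (hs _ hw)) eq (lactK_walk e (hs _ hw')).
  by apply/allP => _ /mapP[w hw ->]; apply/lact_walk/hs.
move=> w hw; rewrite /recenter /= -(wend_lact hw) he; last exact: lact_walk.
by apply: eq_bigr => f _; rewrite wact_lact.
Qed.

Lemma eigen_reroot e eta w : eigenfun (src G e) eta ->
  walk_from G (src G e) w -> eta w != 0 -> exists eta' w',
  [/\ eigenfun (tgt G e) eta', walk_from G (tgt G e) w' & eta' w' != 0].
Proof.
move=> he hw nz; exists (recenter e eta), (lact (rev G e) w); split.
- exact: recenter_eigen.
- by rewrite -src_revE; apply: lact_walk; rewrite tgt_revE.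
- by rewrite /recenter /= -{1}(Defs.revK G e) (lactK_walk _ hw).
Qed.

Lemma eigen_connected r r' : connected_graph G ->
  (exists eta w, [/\ eigenfun r eta, walk_from G r w & eta w != 0]) ->
  (exists eta w, [/\ eigenfun r' eta, walk_from G r' w & eta w != 0]).
Proof.
move=> /(_ r r') /connectP[p]; elim: p r => [|v p IH] r /=; first by move=> _ ->.
move=> /andP[/existsP[e /andP[/eqP <- /eqP <-]]] hp hr [eta [w [h1 h2 h3]]].
by apply: IH hp hr _; apply: eigen_reroot h1 h2 h3.
Qed.

End Walks.

(** * Point spectrum of the universal cover in terms of words *)

Section CoverSpectrum.
Variables (R : realType) (V E : finType) (G : graph V E).

Lemma ell2P (T : choiceType) (eta : T -> R[i]) : ell2 eta <->
  exists K : R, forall s : seq T, uniq s -> \sum_(v <- s) sqn (eta v) <= K.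
Proof.
have E0 A : finite_set A -> (\sum_(v \in A) (ComplexField.Normc.normc (eta v) ^+ 2)%:E =
   (\sum_(v <- fset_set A) sqn (eta v))%:E)%E.
  move=> fA; rewrite fsbig_finite //= sumEFin; congr EFin.
  by apply: eq_bigr => v _; rewrite sqnE.
rewrite /ell2 /=; split => [hf|[K hK]].
  set S := (\esum_(v in _) _)%E in hf.
  have S0 : (0 <= S)%E by apply: esum_ge0 => v _; rewrite lee_fin sqnE sqn_ge0.
  exists (fine S) => s us.
  have fS : S \is a fin_num by rewrite ge0_fin_numE.
  rewrite -lee_fin (fineK fS) /S; apply: esum_ge; exists [set` s].
    by split => //; exact: finite_seq.
  rewrite -fsbig_seq // -sumEFin le_eqVlt; apply/orP; left; apply/eqP.
  by apply: eq_bigr => v _; rewrite sqnE.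
apply: (@le_lt_trans _ _ K%:E); last exact: ltry.
apply: ge_ereal_sup => _ [A [fA _] <-].
by rewrite E0 // lee_fin; apply: hK.
Qed.

Variables (a : E -> R[i]) (b : V -> R) (r : V).
Hypothesis ha : hermitian_weights G a.

Lemma cover_adj_op (eta : seq E -> R[i]) (u : cover_vertex G r) :
  adj_op (universal_cover G r) (a \o @cover_mapE V E G r)
    (b \o @cover_mapV V E G r) (eta \o val) u =
  (b (wend G r (val u)))%:C%C * eta (val u) +
  \sum_(e | src G e == wend G r (val u)) conjc (a e) * eta (wact G (val u) e).
Proof.
rewrite /adj_op; congr (_ + _).
pose A := [set e | src G e == wend G r (val u)]%SET.
have hA e : e \in A -> src G e = wend G r (val u) by rewrite inE => /eqP.
(* Tree edges into [u] are enumerated by the edges of [G] issued from its end. *)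
pose W (x : {e | e \in A}) : cover_vertex G r :=
  exist _ (wact G (val u) (val x)) (wact_walk (valP u) (hA _ (valP x))).
have hW (x : {e | e \in A}) : is_cover_edge (W x, u, rev G (val x)).
  rewrite /= Defs.revK; case: (lastP (val u)) => [|w f]; first by rewrite /= eqxx ?orbT.
  rewrite wact_rcons; case: (f =P rev G (sval x)) => [->|_]; by rewrite eqxx ?orbT.
pose t (x : {e | e \in A}) : cover_edge G r :=
  exist (fun z => is_cover_edge z) _ (hW x).
have tinj : injective t.
  move=> x y /(congr1 (fun z => rev G (val z).2)) /=; rewrite !Defs.revK.
  exact: val_inj.
suff -> : tau (universal_cover G r) u =
    [set` [seq t x | x <- enum {: {e | e \in A}}]].
  rewrite -fsbig_seq; last by rewrite map_inj_uniq // enum_uniq.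
  rewrite big_map big_enum /=.
  rewrite [RHS](eq_bigl (fun e => e \in A)); last by move=> e; rewrite inE.
  rewrite [RHS]big_sub; apply: eq_bigr => x _ /=.
  by rewrite -ha.
apply/seteqP; split => [[[[w w'] e] h]|z /mapP[x _ ->]] //=.

rewrite /tau /= /cover_tgt /= => ew; rewrite {w'}ew in h *.
have hx : src G (rev G e) = wend G r (val u) /\ wact G (val u) (rev G e) = val w.
  move: (h) => /= /orP[/eqP ew|/eqP ew].
    by rewrite src_revE ew wend_rcons wact_rcons Defs.revK eqxx.
  have := valP w; rewrite /= ew walk_rcons => /andP[_ he].
  by rewrite (wact_ext he); case/andP: he => /eqP.
have he : rev G e \in A by rewrite inE hx.1.
apply/mapP; exists (exist (fun e => e \in A) _ he); first by rewrite mem_enum.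
apply: val_inj => /=; rewrite Defs.revK; congr (_, _, _).
by apply: val_inj; rewrite /= hx.2.
Qed.

Lemma cover_point_spectrum (lam : R) :
  point_spectrum (universal_cover G r) (a \o @cover_mapE V E G r)
    (b \o @cover_mapV V E G r) lam <->
  exists eta w, [/\ eigenfun G a b lam r eta, walk_from G r w & eta w != 0].
Proof.
split => [[eta0 [/ell2P[K hK] [v nz]] heq]|[eta [w [[[K hK] he] hw nz]]]].
  pose eta w : R[i] := if insub w is Some u then eta0 u else 0.
  have etaE : eta0 = eta \o val.
    by apply/funext => u; rewrite /eta /= valK.
  exists eta, (val v); split; [split | exact: valP | by rewrite etaE in nz].
    exists K => s us /allP hs.
    have := hK (pmap insub s); rewrite pmap_sub_uniq // => /(_ isT).
    apply: le_trans; rewrite le_eqVlt; apply/orP; left; apply/eqP.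
    elim: s hs {us} => [|w s IH] hs; first by rewrite !big_nil.
    rewrite big_cons IH /=; last by move=> x xs; apply: hs; rewrite inE xs orbT.
    rewrite /eta (insubT (fun w => walk_from G r w) (hs w (mem_head _ _))) /=.
    by rewrite big_cons.
  move=> w hw; have := heq (exist _ w hw).
  rewrite etaE cover_adj_op /= => /eqP; rewrite opprD addrA subr_eq0 => /eqP <-.
  by rewrite rmorphB /= mulrBl.
exists (eta \o val).
  split; last by exists (exist _ w hw).
  apply/ell2P; exists K => s us; have := hK (map val s).
  rewrite big_map (map_inj_uniq val_inj) => hs.
  by apply: hs => //; apply/allP => _ /mapP[x _ ->]; apply: valP.
move=> u; rewrite cover_adj_op opprD addrA /= -mulrBl -rmorphB /=.
by rewrite he ?subrr //; apply: valP.
Qed.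

End CoverSpectrum.

(** * Cavity equations on a bipartite graph *)

Section CavityEquations.
Variables (R : realType) (E W B : finType) (J : {set E}) (p : E -> W) (q : E -> B).
Variables (m : E -> R) (eps : R).
Hypothesis m0 : forall j, j \in J -> 0 < m j.
Hypothesis eps0 : 0 < eps.

(** Schur complement recursions of a tree, for [eps] plus a skew-adjoint hopping with squared moduli
    [m]: once the edge [j] is removed, [t j] stands for the Green value at its black end and [y j]
    for the inverse of the Green value at its white end. On a graph with cycles they describe its
    universal cover. *)
Definition cavity_white (t : E -> R) (j : E) :=
  eps + \sum_(g in J | (g != j) && (p g == p j)) m g * t g.

Definition cavity_black (y : E -> R) (j : E) :=
  (eps + \sum_(k in J | (k != j) && (q k == q j)) m k / y k)^-1.

Definition cavity_solution (t y : E -> R) :=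
  [/\ forall j, 0 < t j, forall j, 0 < y j, y =1 cavity_white t
    & t =1 cavity_black y].

Lemma cavity_white_ge t j : (forall j, 0 <= t j) -> eps <= cavity_white t j.
Proof.
move=> t0; rewrite /cavity_white lerDl sumr_ge0 // => g /andP[gJ _].
by rewrite mulr_ge0 // ltW // m0.
Qed.

Lemma cavity_white_gt0 t j : (forall j, 0 <= t j) -> 0 < cavity_white t j.
Proof. by move=> t0; apply: lt_le_trans eps0 (cavity_white_ge _ t0). Qed.

Lemma cavity_black_den y j : (forall j, 0 < y j) ->
  eps <= eps + \sum_(k in J | (k != j) && (q k == q j)) m k / y k.
Proof.
move=> y0; rewrite lerDl sumr_ge0 // => k /andP[kJ _].
by rewrite divr_ge0 ?ltW ?m0.
Qed.

Lemma cavity_black_gt0 y j : (forall j, 0 < y j) -> 0 < cavity_black y j.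
Proof.
by move=> y0; rewrite invr_gt0 (lt_le_trans eps0) // cavity_black_den.
Qed.

Lemma cavity_black_le y j : (forall j, 0 < y j) -> cavity_black y j <= eps^-1.
Proof.
move=> y0; rewrite lef_pV2 ?posrE // ?cavity_black_den //.
by rewrite (lt_le_trans eps0) // cavity_black_den.
Qed.

Let Phi t := cavity_black (cavity_white t).

Let Phi_homo t t' j : (forall j, 0 <= t j) -> (forall j, t j <= t' j) ->
  Phi t j <= Phi t' j.
Proof.
move=> t0 tt'.
have t'0 k : 0 <= t' k by apply: le_trans (tt' k).
have y0 k := cavity_white_gt0 k t0; have y'0 k := cavity_white_gt0 k t'0.
rewrite /Phi /cavity_black lef_pV2 ?posrE; last 2 first.
- by rewrite (lt_le_trans eps0) // cavity_black_den.
- by rewrite (lt_le_trans eps0) // cavity_black_den.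
rewrite lerD2l; apply: ler_sum => k /andP[kJ _].
apply: ler_wpM2l; first by rewrite ltW ?m0.
rewrite lef_pV2 ?posrE // lerD2l.
by apply: ler_sum => g /andP[gJ _]; rewrite ler_wpM2l // ltW // m0.
Qed.

(* The composition of the two antitone steps is monotone, so that the supremum
   of its post-fixed points is a fixed point. *)
Lemma cavity_exists : exists t y, cavity_solution t y.
Proof.
pose S : set (E -> R) := [set t | forall j, 0 <= t j /\ t j <= Phi t j].
have PhiN t j : (forall j, 0 <= t j) -> Phi t j <= eps^-1.
  by move=> t0; apply: cavity_black_le => k; apply: cavity_white_gt0.
have Phi0 t j : (forall j, 0 <= t j) -> 0 < Phi t j.
  by move=> t0; apply: cavity_black_gt0 => k; apply: cavity_white_gt0.
have S0 : S (fun=> 0) by move=> j; split=> //; apply/ltW/Phi0.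
pose T j := [set t j | t in S].
have supT j : has_sup (T j).
  split; first by exists 0, (fun=> 0).
  exists eps^-1 => _ [t St <-]; apply: le_trans (St j).2 _.
  by apply: PhiN => k; case: (St k).
pose t j := sup (T j).
have tle u j : S u -> u j <= t j.
  by move=> Su; apply: ub_le_sup; [case: (supT j) | exists u].
have t0 j : 0 <= t j by exact: (tle (fun=> 0)).
have tS : S t.
  move=> j; split => //; apply: ge_sup; first by case: (supT j).
  move=> _ [u Su <-]; apply: le_trans (Su j).2 _; apply: Phi_homo.
    by move=> k; case: (Su k).
  by move=> k; apply: tle.
have PS : S (Phi t).
  move=> j; split; first exact/ltW/Phi0.
  by apply: Phi_homo => // k; case: (tS k).
have tE j : t j = Phi t j.
  by apply/eqP; rewrite eq_le (tS j).2 /=; apply: tle.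
exists t, (cavity_white t); split => //.
- by move=> j; rewrite tE; apply: Phi0.
- by move=> j; apply: cavity_white_gt0.
Qed.

Variables (t y : E -> R).
Hypothesis ty : cavity_solution t y.

Lemma cavity_black_edge g k : k \in J -> k != g -> q k = q g -> t g <= y k / m k.
Proof.
have y0 j : 0 < y j by case: ty.
move=> kJ kg qk; case: ty => _ _ _ ->; rewrite -invf_div lef_pV2 ?posrE.
- rewrite (bigD1 k) /= ?kJ ?kg ?qk ?eqxx // addrCA lerDl.
  apply: addr_ge0; first exact: ltW.
  rewrite sumr_ge0 // => j /andP[/andP[jJ _] _].
  by rewrite divr_ge0 // ltW ?m0.
- by rewrite (lt_le_trans eps0) // cavity_black_den.
- by rewrite divr_gt0 ?m0.
Qed.

(** In the limit a black node imposes a linear condition on the ratios [t g / y k]; [eps * t g]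
    measures how far the regularized solution is from it. *)
Lemma cavity_black_defect g :
  1 - \sum_(k in J | (k != g) && (q k == q g)) m k * (t g / y k) = eps * t g.
Proof.
have y0 j : 0 < y j by case: ty.
have tg : t g = cavity_black y g by case: ty.
have d0 : 0 < eps + \sum_(k in J | (k != g) && (q k == q g)) m k / y k.
  by rewrite (lt_le_trans eps0) // cavity_black_den.
have -> : \sum_(k in J | (k != g) && (q k == q g)) m k * (t g / y k) =
  t g * \sum_(k in J | (k != g) && (q k == q g)) m k / y k.
  by rewrite mulr_sumr; apply: eq_bigr => k _; rewrite mulrCA.
move: d0; rewrite tg /cavity_black; set S := \sum_(k in J | _) _ => d0.
by field; rewrite gt_eqF.
Qed.

Definition green_white u := (eps + \sum_(g in J | p g == u) m g * t g)^-1.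

Definition green_black x := (eps + \sum_(k in J | q k == x) m k / y k)^-1.

Let t0 j : 0 < t j. Proof. by case: ty. Qed.
Let y0 j : 0 < y j. Proof. by case: ty. Qed.

Lemma green_white_gt0 u : 0 < green_white u.
Proof.
rewrite invr_gt0 ltr_wpDr // sumr_ge0 // => g /andP[gJ _].
by rewrite mulr_ge0 ?ltW ?m0.
Qed.

Lemma green_black_gt0 x : 0 < green_black x.
Proof.
rewrite invr_gt0 ltr_wpDr // sumr_ge0 // => g /andP[gJ _].
by rewrite divr_ge0 ?ltW ?m0.
Qed.

Lemma green_white_edge j : j \in J -> (green_white (p j))^-1 = y j + m j * t j.
Proof.
move=> jJ; case: ty => _ _ -> _; rewrite invrK (bigD1 j) /= ?jJ ?eqxx //.
rewrite addrCA addrC /cavity_white; congr (_ + _ + _).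
by apply: eq_bigl => g; rewrite -andbA [(g != j) && _]andbC.
Qed.

Lemma green_black_edge j : j \in J ->
  (green_black (q j))^-1 = (t j)^-1 + m j / y j.
Proof.
move=> jJ; case: ty => _ _ _ ->; rewrite !invrK (bigD1 j) /= ?jJ ?eqxx //.
rewrite addrCA addrC; congr (_ + _ + _).
by apply: eq_bigl => g; rewrite -andbA [(g != j) && _]andbC.
Qed.

(** Both sides equal the sum over [J] of [m j * t j / (y j + m j * t j)], grouped by white or by
    black ends. It is the analogue of the equality of row rank and column rank, written with the
    masses of the two kernels. *)
Lemma green_index (X : {set W}) (Y : {set B}) :
  (forall j, j \in J -> p j \in X) -> (forall j, j \in J -> q j \in Y) ->
  \sum_(u in X) (1 - eps * green_white u) = \sum_(x in Y) (1 - eps * green_black x).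
Proof.
move=> hp hq.
pose s j := m j * t j / (y j + m j * t j).
have -> : \sum_(u in X) (1 - eps * green_white u) = \sum_(j in J) s j.
  rewrite (partition_big p (mem X)) //=; apply: eq_bigr => u uX.
  have -> : 1 - eps * green_white u = (\sum_(g in J | p g == u) m g * t g) * green_white u.
    have h := green_white_gt0 u.
    have -> : 1 - eps * green_white u = ((green_white u)^-1 - eps) * green_white u.
    by rewrite mulrBl mulVf ?lt0r_neq0.
  by rewrite [in LHS]/green_white invrK addrAC subrr add0r.
  rewrite mulr_suml; apply: eq_bigr => j /andP[jJ /eqP <-].
  by rewrite /s -green_white_edge // invrK.
have -> // : \sum_(x in Y) (1 - eps * green_black x) = \sum_(j in J) s j.
rewrite (partition_big q (mem Y)) //=; apply: eq_bigr => u uX.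
have -> : 1 - eps * green_black u = (\sum_(g in J | q g == u) m g / y g) * green_black u.
  have h := green_black_gt0 u.
  have -> : 1 - eps * green_black u = ((green_black u)^-1 - eps) * green_black u.
    by rewrite mulrBl mulVf ?lt0r_neq0.
  by rewrite [in LHS]/green_black invrK addrAC subrr add0r.
rewrite mulr_suml; apply: eq_bigr => j /andP[jJ /eqP <-].
rewrite -[green_black _]invrK green_black_edge // /s.
have h1 := t0 j; have h2 := y0 j; have h3 := m0 jJ.
have h4 : 0 < y j + m j * t j by rewrite addr_gt0 // mulr_gt0.
by field; rewrite ?gt_eqF // addrC mulrC.
Qed.

End CavityEquations.

(** * Forests carrying eigenfunctions *)

Section Subforests.
Variables (V E : finType) (G : graph V E).

Definition inner (F : {set E}) (X : {set V}) : {set E} :=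
  [set e in F | (src G e \in X) && (tgt G e \in X)].

Definition outer (F : {set E}) (X : {set V}) : {set V} :=
  [set v | (v \notin X) && [exists e in F, (src G e == v) && (tgt G e \in X)]].

(** Comparing ranks selects one edge of each pair; it stands for the midpoint of the edge, which
    becomes a black node. *)
Definition mid (e : E) : E :=
  if (enum_rank e < enum_rank (rev G e))%N then e else rev G e.

(* Every edge of [D] is a bridge of the graph with edges [D]. *)
Definition forest (D : {set E}) :=
  forall e, e \in D -> exists B : {set V}, [/\ src G e \in B, tgt G e \notin B
    & forall f, f \in D -> src G f \in B -> tgt G f \notin B -> f = e].

Lemma mid_rev e : mid (rev G e) = mid e.
Proof.
rewrite /mid Defs.revK; case: ltngtP => // /val_inj /enum_rank_inj /eqP.
by rewrite (negbTE (rev_neq G e)).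
Qed.

Lemma mid_or e : mid e = e \/ mid e = rev G e.
Proof. by rewrite /mid; case: ifP; [left | right]. Qed.

Lemma mid_eq e f : (mid e == mid f) = (e == f) || (e == rev G f).
Proof.
apply/eqP/orP => [|[]/eqP ->]; rewrite ?mid_rev //.
case: (mid_or e) => ->; case: (mid_or f) => -> ef.
- by left; rewrite ef.
- by right; rewrite ef.
- by right; rewrite -ef Defs.revK.
- by left; rewrite (can_inj (@Defs.revK _ _ G) ef).
Qed.

Definition sym_edges (F : {set E}) := forall e, (rev G e \in F) = (e \in F).

Lemma inner_rev F X e : sym_edges F ->
  (rev G e \in inner F X) = (e \in inner F X).
Proof.
move=> hF; rewrite !inE hF src_revE tgt_revE; congr (_ && _); exact: andbC.
Qed.

(* The black nodes of a bipartite graph whose white nodes are the vertices of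
   [X]: each one is a linear condition on functions supported on [X]. *)
Definition constraints F X : {set V + E} :=
  (inl @: outer F X :|: inr @: (mid @: inner F X))%SET.

(** The black end of the bipartite edge whose white end is the source of [e]. An inner edge and its
    reverse share it. *)
Definition constraint_of (X : {set V}) (e : E) : V + E :=
  if tgt G e \in X then inr (mid e) else inl (tgt G e).

Lemma card_constraints F X :
  #|constraints F X| = (#|outer F X| + #|mid @: inner F X|)%N.
Proof.
rewrite cardsU.
suff -> : (inl @: outer F X :&: inr @: (mid @: inner F X) = finset.set0 :> {set V + E})%SET.
  have i1 : injective (@inl V E) by move=> ? ? [].
  have i2 : injective (@inr V E) by move=> ? ? [].
  by rewrite cards0 subn0 (card_imset _ i1) (card_imset _ i2).
apply/setP => x; rewrite !inE; apply/negP => /andP[/imsetP[v _ ->] /imsetP[e _]].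
by [].
Qed.
End Subforests.

(** * Weights of the bipartite graph and Wronskians *)

Section Balance.
Variables (R : realType) (V E : finType) (G : graph V E).
Variables (a : E -> R[i]) (b : V -> R) (lam : R).
Hypothesis ha : hermitian_weights G a.

Definition supp : {set E} := [set e | a e != 0].

Lemma supp_sym : sym_edges G supp.
Proof.
by move=> e; rewrite !inE -ha -sqn_eq0 sqn_conj sqn_eq0.
Qed.

Lemma rev_weight e : conjc (a (rev G e)) = a e.
Proof. by rewrite ha Defs.revK. Qed.

(* [rho e] is the ratio of the values of an eigenfunction at the end and at the
   origin of a lift of the inner edge [e]. *)
Definition balanced (X : {set V}) (rho : E -> R[i]) :=
  [/\ forall e, e \in inner G supp X -> rho e != 0 /\ rho e * rho (rev G e) = 1,
      forall u, u \in X -> (lam - b u)%:C%C =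
        \sum_(e in inner G supp X | src G e == u) conjc (a e) * rho e
    & (#|constraints G supp X| < #|X|)%N].

Section Weights.
Variables (X : {set V}) (rho : E -> R[i]).
Hypothesis hrho : forall e, e \in inner G supp X ->
  rho e != 0 /\ rho e * rho (rev G e) = 1.

Definition branch_edges : {set E} := [set e in supp | src G e \in X].

(** Squared moduli of the coefficients of the constraints. At a boundary vertex they come from the
    eigenvalue equation. The relation along an inner edge is scaled symmetrically, with coefficients
    of moduli [|rho e|^(1/2)] at its origin and [|rho e|^(-1/2)] at its end, so that the two weights
    have product 1. *)
Definition branch_weight (e : E) : R :=
  if tgt G e \in X then Num.sqrt (sqn (rho e)) else sqn (a e).

Lemma branch_weight_ge0 e : 0 <= branch_weight e.
Proof. by rewrite /branch_weight; case: ifP; rewrite ?sqrtr_ge0 ?sqn_ge0. Qed.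

Lemma branch_edgesE e :
  (e \in branch_edges) = (a e != 0) && (src G e \in X).
Proof. by rewrite !inE. Qed.

Lemma innerE e : (e \in inner G supp X) = (e \in branch_edges) && (tgt G e \in X).
Proof. by rewrite !inE andbA. Qed.

Lemma branch_weight_gt0 e : e \in branch_edges -> 0 < branch_weight e.
Proof.
move=> eJ; rewrite /branch_weight; case: ifP => eX.
  by rewrite sqrtr_gt0 sqn_gt0; apply: (hrho _).1; rewrite innerE eJ.
by move: eJ; rewrite branch_edgesE sqn_gt0 => /andP[].
Qed.

Lemma branch_weight_inner e : e \in inner G supp X ->
  branch_weight e ^+ 2 = sqn (rho e) /\ branch_weight e * branch_weight (rev G e) = 1.
Proof.
move=> eD; have [_ h] := hrho eD.
have := eD; rewrite !inE /branch_weight => /and3P[_ h1 h2].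
rewrite h2 tgt_revE h1 sqr_sqrtr ?sqn_ge0 //; split => //.
by rewrite -sqrtrM ?sqn_ge0 // -sqnM h sqn1 sqrtr1.
Qed.

Lemma branch_edges_constraint e : e \in branch_edges ->
  constraint_of G X e \in constraints G supp X.
Proof.
move=> eJ; rewrite /constraint_of inE; case: ifP => eX; apply/orP; [right|left].
  by rewrite !imset_f // innerE eJ.
rewrite imset_f // inE eX /=; apply/existsP; exists (rev G e).
by move: eJ; rewrite inE => /andP[h1 h2]; rewrite supp_sym h1 src_revE tgt_revE eqxx.
Qed.

Lemma constraint_edge x : x \in constraints G supp X ->
  exists2 e, e \in branch_edges & constraint_of G X e = x.
Proof.
rewrite inE => /orP[/imsetP[v]|/imsetP[e /imsetP[f fD ->]] ->].
  rewrite inE => /andP[vX /existsP[e /and3P[eF /eqP ev eX]]] ->; subst v.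
  exists (rev G e); last first.
    by rewrite /constraint_of tgt_revE (negbTE vX).
  by rewrite inE supp_sym eF src_revE.
by exists f; rewrite /constraint_of; move: fD; rewrite innerE => /andP[] // _ ->.
Qed.

Lemma constraint_of_cross e k : tgt G e \notin X ->
  (constraint_of G X k == constraint_of G X e) = (tgt G k == tgt G e).
Proof.
move=> eX; rewrite /constraint_of (negbTE eX); case: ifP => kX //=.
by apply/esym/negbTE; apply: contraNneq eX => <-.
Qed.

Lemma constraint_of_inner e k : e \in inner G supp X -> k \in branch_edges ->
  (constraint_of G X k == constraint_of G X e) = (k == e) || (k == rev G e).
Proof.
move=> eD kJ; have := eD; rewrite innerE /constraint_of => /andP[_ ->].
case: ifP => kX; first by rewrite -mid_eq.
apply/esym/negbTE; apply: contraFN kX => /orP[/eqP ->|/eqP ->].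
  by move: eD; rewrite !inE => /and3P[].
by rewrite tgt_revE; move: eD; rewrite !inE => /and3P[].
Qed.

End Weights.

Lemma sum_wact_rcons r (eta : seq E -> R[i]) w f : walk_from G r (rcons w f) ->
  \sum_(e | src G e == tgt G f) conjc (a e) * eta (wact G (rcons w f) e) =
  a f * eta w +
    \sum_(e | ext G r (rcons w f) e) conjc (a e) * eta (rcons (rcons w f) e).
Proof.
move=> hw; rewrite (bigD1 (rev G f)) /=; last by rewrite src_revE.
rewrite wact_rcons Defs.revK eqxx rev_weight; congr (_ + _).
apply: eq_big => e.
  by rewrite ext_rcons [f == _]eq_sym rev_eq.
by rewrite wact_rcons [f == _]eq_sym rev_eq => /andP[_ /negbTE ->].
Qed.

Lemma eigen_eq_rcons r eta w f : eigen_eq G a b lam r eta ->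
  walk_from G r (rcons w f) ->
  (lam - b (tgt G f))%:C%C * eta (rcons w f) = a f * eta w +
    \sum_(e | ext G r (rcons w f) e) conjc (a e) * eta (rcons (rcons w f) e).
Proof.
by move=> he hw; rewrite -{1}(wend_rcons G r w f) he // wend_rcons (sum_wact_rcons _ hw).
Qed.

Lemma Re_mul_le_sum (x z : R[i]) : complex.Re (x * z) <= sqn x + sqn z.
Proof.
case: x => x1 x2; case: z => z1 z2; rewrite /sqn /= -subr_ge0.
have -> : x1 ^+ 2 + x2 ^+ 2 + (z1 ^+ 2 + z2 ^+ 2) - (x1 * z1 - x2 * z2) =
  2^-1 * ((x1 - z1) ^+ 2 + (x2 + z2) ^+ 2 + (x1 ^+ 2 + x2 ^+ 2 + z1 ^+ 2 + z2 ^+ 2)).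
  by field.
by rewrite mulr_ge0 ?invr_ge0 // !addr_ge0 ?sqr_ge0.
Qed.

Definition wronskian (eta theta : seq E -> R[i]) (w : seq E) : R[i] :=
  if w is x :: w' then
    conjc (a (last x w')) * eta w * conjc (theta (belast x w')) -
    a (last x w') * eta (belast x w') * conjc (theta w)
  else 0.

Lemma wronskian_rcons eta theta w e : wronskian eta theta (rcons w e) =
  conjc (a e) * eta (rcons w e) * conjc (theta w) -
  a e * eta w * conjc (theta (rcons w e)).
Proof.
by case: w => [|x w] //=; rewrite last_rcons belast_rcons.
Qed.

Lemma conj_real (x : R) : conjc x%:C%C = x%:C%C :> R[i].
Proof. by rewrite /= oppr0. Qed.

Lemma conjM (x z : R[i]) : conjc (x * z) = conjc x * conjc z.
Proof. exact: rmorphM. Qed.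

Lemma conjD (x z : R[i]) : conjc (x + z) = conjc x + conjc z.
Proof. exact: rmorphD. Qed.

Lemma conj_sum (I : finType) (P : pred I) (f : I -> R[i]) :
  conjc (\sum_(i | P i) f i) = \sum_(i | P i) conjc (f i).
Proof. exact: rmorph_sum. Qed.

(** Conservation of current: the real potentials cancel, and the incoming terms of the two equations
    form the Wronskian on the last edge. *)
Lemma wronskian_flux r eta theta w :
  eigen_eq G a b lam r eta -> eigen_eq G a b lam r theta ->
  walk_from G r w -> w != [::] ->
  wronskian eta theta w = \sum_(e | ext G r w e) wronskian eta theta (rcons w e).
Proof.
move=> h1 h2; case/lastP: w => // w f hw _.
have {}h1 := eigen_eq_rcons h1 hw; have := eigen_eq_rcons h2 hw.
move=> /(congr1 conjc); rewrite conjM conj_real conjD conjM conj_sum => {}h2.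
rewrite wronskian_rcons; under eq_bigr do rewrite wronskian_rcons.
rewrite sumrB.
have -> : \sum_(e | ext G r (rcons w f) e) conjc (a e) *
  eta (rcons (rcons w f) e) * conjc (theta (rcons w f)) =
  ((lam - b (tgt G f))%:C%C * eta (rcons w f) - a f * eta w) * conjc (theta (rcons w f)).
  by rewrite h1 addrAC subrr add0r mulr_suml.
have -> : \sum_(e | ext G r (rcons w f) e) a e * eta (rcons w f) *
   conjc (theta (rcons (rcons w f) e)) =
  ((lam - b (tgt G f))%:C%C * conjc (theta (rcons w f)) - conjc (a f) * conjc (theta w))
    * eta (rcons w f).
  rewrite h2 addrAC subrr add0r mulr_suml; apply: eq_bigr => e _.
  by rewrite conjM conjcK mulrAC.
by ring.
Qed.

Lemma sum_sqn_le e : sqn (a e) <= \sum_f sqn (a f).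
Proof. by rewrite (bigD1 e) //= lerDl sumr_ge0 // => f _; apply: sqn_ge0. Qed.

(** The flux through [e] equals the flux through all edges at a given distance behind [e], which
    becomes small by square summability. The real part of its product with [conjc z] satisfies the
    real inequality that [sub_flux] requires, with [eps = 0]; the outcome is [sqn z <= 0]. *)
Lemma wronskian_eq0 e eta theta :
  eigenfun G a b lam (src G e) eta -> eigenfun G a b lam (src G e) theta ->
  conjc (a e) * eta [:: e] * conjc (theta [::]) =
  a e * eta [::] * conjc (theta [:: e]).
Proof.
move=> [[K1 hK1] h1] [[K2 hK2] h2]; apply/eqP; rewrite -subr_eq0.
have -> : conjc (a e) * eta [:: e] * conjc (theta [::]) -
  a e * eta [::] * conjc (theta [:: e]) = wronskian eta theta [:: e] by [].
set z := wronskian _ _ _.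
pose h w := sqn (eta w) + sqn (theta w).
pose Psi w := if w is x :: _ then
  (if x == e then complex.Re (conjc z * wronskian eta theta w) else 0) else 0.
have h0 w : 0 <= h w by rewrite addr_ge0 ?sqn_ge0.
have hK : sums_below G (src G e) h (K1 + K2).
  by move=> s us hs; rewrite big_split /= lerD ?hK1 ?hK2.
pose c := (sqn z * \sum_f sqn (a f)) + 1.
have M0 : 0 <= \sum_f sqn (a f) by apply: sumr_ge0 => f _; apply: sqn_ge0.
have c0 : 0 <= c by rewrite addr_ge0 // mulr_ge0 ?sqn_ge0.
have := @sub_flux _ _ _ G (src G e) h Psi 0 c (K1 + K2) h0 hK (lexx _) c0.
rewrite mul0r level1 (bigD1 e) //= eqxx -/z mulrC -sqnC /= big1; last first.
  by move=> f /andP[_ /negbTE ->].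
rewrite addr0 => H; rewrite -sqn_eq0 eq_le sqn_ge0 andbT; apply: H.
  move=> [|x w] // hw _; rewrite mul0r add0r.
  have PsiE (u : seq E) : Psi (x :: u) =
    if x == e then complex.Re (conjc z * wronskian eta theta (x :: u)) else 0.
    by [].
  rewrite PsiE; under eq_bigr => f _ do rewrite rcons_cons PsiE.
  case: ifP => _; last by rewrite big1.
  rewrite (wronskian_flux h1 h2 hw) // mulr_sumr.
  by rewrite (raddf_sum (@complex.Re R : Rcomplex R -> R)).
move=> w f hw hf.
have R0 : 0 <= c * (h w + h (rcons w f)) by rewrite mulr_ge0 // addr_ge0.
have : complex.Re (conjc z * wronskian eta theta (rcons w f)) <= c * (h w + h (rcons w f)).
  rewrite wronskian_rcons mulrBr raddfB /=.
  have q1 : complex.Re (conjc z * (conjc (a f) * eta (rcons w f) * conjc (theta w)))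
    <= sqn z * (\sum_f sqn (a f)) * sqn (eta (rcons w f)) + sqn (theta w).
    rewrite 2!mulrA; apply: le_trans (Re_mul_le_sum _ _) _.
    rewrite !sqnM !sqn_conj lerD2r ler_wpM2r ?sqn_ge0 //.
    by rewrite ler_wpM2l ?sqn_ge0 // sum_sqn_le.
  have q2 : - complex.Re (conjc z * (a f * eta w * conjc (theta (rcons w f))))
    <= sqn z * (\sum_f sqn (a f)) * sqn (eta w) + sqn (theta (rcons w f)).
    rewrite -raddfN /= -mulNr 2!mulrA; apply: le_trans (Re_mul_le_sum _ _) _.
    rewrite !sqnM sqnN !sqn_conj lerD2r ler_wpM2r ?sqn_ge0 //.
    by rewrite ler_wpM2l ?sqn_ge0 // sum_sqn_le.
  apply: le_trans (lerD q1 q2) _; rewrite /c /h.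
  set M := \sum_f _ in M0 *.
  have p1 := sqn_ge0 (eta w); have p2 := sqn_ge0 (theta w).
  have p3 := sqn_ge0 (eta (rcons w f)); have p4 := sqn_ge0 (theta (rcons w f)).
  have p0 : 0 <= sqn z * M by rewrite mulr_ge0 ?sqn_ge0.
  have p5 := mulr_ge0 p0 p2; have p6 := mulr_ge0 p0 p4; nra.
by case: w hw hf R0 => [|x w] _ _ R0 /=; case: ifP.
Qed.

End Balance.

(** * Ratios of eigenfunctions along inner edges *)

Section Necessity.
Variables (R : realType) (V E : finType) (G : graph V E).
Variables (a : E -> R[i]) (b : V -> R) (lam : R).
Hypothesis ha : hermitian_weights G a.

Local Notation eigenfun := (eigenfun G a b lam).
Local Notation supp := (supp a).

Implicit Types (eta theta : seq E -> R[i]).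

Definition eigen_support : {set V} :=
  [set v | `[< exists2 eta, eigenfun v eta & eta [::] != 0 >]].

Local Notation X := eigen_support.
Local Notation D := (inner G supp X).

Lemma eigen_supportP v :
  reflect (exists2 eta, eigenfun v eta & eta [::] != 0) (v \in X).
Proof. by rewrite inE; apply: asboolP. Qed.

Lemma shift_cons e eta w :
  walk_from G (src G e) (e :: w) -> recenter G e eta w = eta (e :: w).
Proof.
rewrite walk_cons => /and3P[_ _]; rewrite /recenter /=.
by case: w => [|f w] //=; rewrite -rev_eq eq_sym => /negbTE ->.
Qed.

Lemma eigen_support_wend r eta w : eigenfun r eta -> walk_from G r w ->
  eta w != 0 -> wend G r w \in X.
Proof.
elim: w r eta => [|e w IH] r eta he hw nz; first by apply/eigen_supportP; exists eta.
have er : src G e = r by move: hw; rewrite walk_cons => /and3P[/eqP].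
rewrite wend_cons; apply: (IH _ (recenter G e eta)).
- by apply: recenter_eigen; rewrite er.
- by move: hw; rewrite walk_cons => /and3P[].
- by rewrite shift_cons ?er.
Qed.

(** The vanishing Wronskian against one eigenfunction [theta] that is nonzero at the origin of [e]
    fixes the ratio of all others. An eigenfunction that is nonzero at the end of [e], moved to the
    origin, shows that the ratio is nonzero. *)
Lemma inner_ratio_exists e : e \in D ->
  exists rho : R[i], rho != 0 /\
   forall eta, eigenfun (src G e) eta -> eta [:: e] = rho * eta [::].
Proof.
rewrite !inE => /and3P[ae /asboolP[theta ht nz] /asboolP[xi hx nz']].
have cae : conjc (a e) != 0 by rewrite conjc_eq0.
have nzc : conjc (theta [::]) != 0 by rewrite conjc_eq0.
pose rho := a e * conjc (theta [:: e]) / (conjc (a e) * conjc (theta [::])).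
have hrho eta : eigenfun (src G e) eta -> eta [:: e] = rho * eta [::].
  move=> he; have := wronskian_eq0 ha he ht; rewrite /rho => h.
  apply: (mulfI cae); apply: (mulIf nzc); rewrite h.
  by field; rewrite ?cae ?nzc.
exists rho; split => //.
have hs : eigenfun (src G e) (recenter G (rev G e) xi).
  by rewrite -(tgt_revE G e); apply: recenter_eigen; rewrite src_revE.
have := hrho _ hs; rewrite /recenter /= Defs.revK eqxx => h.
by apply: contraNneq nz' => r0; rewrite h r0 mul0r.
Qed.

Variable rho : E -> R[i].
Hypothesis hrho : forall e, e \in D -> rho e != 0 /\
   forall eta, eigenfun (src G e) eta -> eta [:: e] = rho e * eta [::].

Lemma eigen_ratio r eta w e : eigenfun r eta -> walk_from G r w ->
  e \in D -> src G e = wend G r w -> eta (wact G w e) = rho e * eta w.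
Proof.
move=> + + eD; elim: w r eta => [|f w IH] r eta he hw er.
  by apply: (hrho eD).2; rewrite er.
have fr : src G f = r by move: hw; rewrite walk_cons => /and3P[/eqP].
rewrite -fr in hw he er.
have hw' : walk_from G (tgt G f) w by move: hw; rewrite walk_cons => /and3P[].
have lw : lact G f w = f :: w.
  move: hw; rewrite walk_cons => /and3P[_ _].
  by case: w {IH er hw'} => [|g w] //=; rewrite -rev_eq eq_sym => /negbTE ->.
rewrite -lw wact_lact // -[LHS]/(recenter G f eta (wact G w e)).
by rewrite (IH _ _ (recenter_eigen he)).
Qed.

Lemma eigen_outside r eta w : eigenfun r eta -> walk_from G r w ->
  wend G r w \notin X -> eta w = 0.
Proof.
by move=> he hw; apply: contraNeq => /(eigen_support_wend he hw).
Qed.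

Lemma ratio_rev e : e \in D -> rho e * rho (rev G e) = 1.
Proof.
move=> eD; have /eigen_supportP[eta he nz] : src G e \in X.
  by move: eD; rewrite inE => /and3P[].
have eD' : rev G e \in D by rewrite inner_rev //; apply: supp_sym.
have := @eigen_ratio _ eta [:: e] (rev G e) he; rewrite /= Defs.revK eqxx.
rewrite walk_cons /= eqxx src_revE => /(_ isT eD' erefl).
have -> : eta [:: e] = rho e * eta [::] by apply: (hrho eD).2.
by rewrite mulrA [rho _ * rho e]mulrC => h; apply: (mulIf nz); rewrite mul1r -h.
Qed.

Lemma eigen_balance u : u \in X -> (lam - b u)%:C%C =
  \sum_(e in D | src G e == u) conjc (a e) * rho e.
Proof.
move=> /eigen_supportP[eta he nz]; apply: (mulIf nz).
have := he.2 [::] isT; rewrite /wend /= => ->.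
rewrite (bigID (mem D)) /= [X in _ + X]big1 ?addr0.
  rewrite mulr_suml; apply: eq_big => e; first by rewrite andbC.
  move=> /andP[/eqP eu eD]; rewrite -mulrA; congr (_ * _).
  by apply: (hrho eD).2; rewrite eu.
move=> e /andP[/eqP eu]; rewrite !inE => eD.
have [->|ae] := eqVneq (a e) 0; first by rewrite conjc0 mul0r.
move: eD; rewrite ae eu /= (introT (asboolP _)) ?andbT; last by exists eta.
move=> eX; rewrite (eigen_outside he) ?mulr0 //; first by rewrite walk_cons /= eu eqxx.
by rewrite wend_cons /wend /= inE eX.
Qed.

(* Along an inner walk an eigenfunction is multiplied by the ratios of the
   edges, so that a cycle of inner edges and the opposite cycle both have a
   product of ratios of modulus less than 1, by square summability. *)
Definition nbrel : rel E := [rel e f | (tgt G e == src G f) && (e != rev G f)].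

Lemma inner_walk_value r eta w : eigenfun r eta -> walk_from G r w ->
  all (mem D) w -> eta w = (\prod_(e <- w) rho e) * eta [::].
Proof.
move=> he; elim/last_ind: w => [|w e IH]; first by rewrite big_nil mul1r.
rewrite walk_rcons all_rcons => /andP[hw ew] /andP[eD wD].
rewrite -{1}(wact_ext ew) (eigen_ratio he hw eD); last by case/andP: ew => /eqP.
by rewrite IH // -cats1 big_cat big_seq1 /= mulrA [rho e * _]mulrC.
Qed.

Lemma cycle_nseq (T : Type) (e : rel T) x p n :
  cycle e (x :: p) -> path e x (behead (flatten (nseq n (x :: p)))) /\
   (0 < n -> path e x (rcons (behead (flatten (nseq n (x :: p)))) x))%N.
Proof.
move=> hc; elim: n => [|n [IH1 IH2]]; first by [].
split=> [|_]; rewrite /=.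
  case: n IH1 IH2 => [|n] IH1 IH2.
    by rewrite cats0; move: hc; rewrite /= rcons_path => /andP[].
  by rewrite cat_path /=; move: hc IH1 => /=; rewrite rcons_path => /andP[-> ->].
case: n IH1 IH2 => [|n] IH1 IH2; first by rewrite cats0.
by rewrite rcons_cat cat_path /=; move: hc (IH2 isT) => /=; rewrite rcons_path => /andP[-> ->].
Qed.

Lemma inner_cycle_lt1 x p : cycle nbrel (x :: p) -> all (mem D) (x :: p) ->
  sqn (\prod_(e <- x :: p) rho e) < 1.
Proof.
move=> hc hD; rewrite ltNge; apply/negP => ge1.
have /eigen_supportP[eta he nz] : src G x \in X.
  by move: hD => /= /andP[]; rewrite inE => /and3P[].
case: (he) => -[K hK] _.
pose w n := flatten (nseq n (x :: p)).
have ww n : walk_from G (src G x) (w n).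
  case: n => [|n] //; rewrite /walk_from /w /= eqxx andbT /non_backtracking /=.
  by have [] := cycle_nseq n.+1 hc.
have wv n : eta (w n) = (\prod_(e <- x :: p) rho e) ^+ n * eta [::].
  rewrite (inner_walk_value he) //; last first.
    elim: n => [|n IHn] //; rewrite -[w n.+1]/((x :: p) ++ w n) all_cat IHn andbT.
    exact: hD.
  congr (_ * _); elim: n => [|n IH]; first by rewrite /w big_nil expr0.
  by rewrite exprS -IH /w -big_cat.
have ws n : size (w n) = (n * size (x :: p))%N.
  by rewrite size_flatten /shape map_nseq sumn_nseq mulnC.
have us N : uniq [seq w n | n <- iota 0 N].
  rewrite map_inj_uniq ?iota_uniq // => m n /(congr1 size); rewrite !ws.
  by move/eqP; rewrite eqn_pmul2r // => /eqP.
(* The walks [w n] are distinct, and on each of them the eigenfunction would be at least as large as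
   at the root. *)
have low N : N%:R * sqn (eta [::]) <= K.
  have := hK _ (us N); rewrite all_map.
  have -> : all (preim w (walk_from G (src G x))) (iota 0 N) by apply/allP => n _; apply: ww.
  move=> /(_ isT); apply: le_trans; rewrite big_map.
  have -> : N%:R * sqn (eta [::]) = \sum_(n <- iota 0 N) sqn (eta [::]).
    by rewrite big_const_seq count_predT size_iota iter_addr_0 mulr_natl.
  apply: ler_sum => n _ /=; rewrite wv sqnM -[leLHS]mul1r ler_wpM2r ?sqn_ge0 //.
  by elim: n => [|n IH]; rewrite ?expr0 ?sqn1 // exprS sqnM mulr_ege1.
have nz2 : 0 < sqn (eta [::]) by rewrite sqn_gt0.
have := low (Num.trunc (K / sqn (eta [::]))).+1.
by rewrite leNgt -ltr_pdivrMr // truncnS_gt.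
Qed.

Lemma no_inner_cycle x p : cycle nbrel (x :: p) -> ~~ all (mem D) (x :: p).
Proof.
move=> hc; apply/negP => hD.
pose q := seq.rev (map (rev G) (x :: p)).
have hqD : all (mem D) q.
  rewrite all_rev all_map; apply: sub_all hD => e /= eD.
  by rewrite inner_rev //; apply: supp_sym.
have hqc : cycle nbrel q.
  rewrite /q rev_cycle cycle_map; move: hc; apply: sub_cycle => e f /=.
  by rewrite /nbrel /= tgt_revE src_revE [src G f == _]eq_sym Defs.revK => /andP[-> h]; rewrite eq_sym.
case eq: q (hqD) (hqc) => [|y s] hqD' hqc'.
  by have := congr1 size eq; rewrite size_rev size_map.
have h1 := inner_cycle_lt1 hc hD; have := inner_cycle_lt1 hqc' hqD'.
rewrite -eq /q (perm_big _ (permEl (perm_rev _))) big_map => h2.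
have : sqn (\prod_(e <- x :: p) rho e) * sqn (\prod_(e <- x :: p) rho (rev G e)) = 1.
  rewrite -sqnM -big_split big_seq big1 ?sqn1 // => e ep.
  by apply: ratio_rev; apply: (allP hD).
apply/eqP; rewrite lt_eqF //.
apply: le_lt_trans h1; rewrite -[leRHS]mulr1 ler_wpM2l ?sqn_ge0 //.
exact: ltW.
Qed.

(** A closed walk that is not a cycle of [nbrel] backtracks at its base point; removing its first
    and last edges gives a shorter closed walk. *)
Lemma no_inner_closed_walk x p : path nbrel x p -> all (mem D) (x :: p) ->
  tgt G (last x p) != src G x.
Proof.
have [n] := ubnP (size p); elim: n x p => // n IH x p hn hp hD.
apply/negP => /eqP hcl.
have [lr|nlr] := eqVneq (last x p) (rev G x); last first.
  have hc : cycle nbrel (x :: p) by rewrite /= rcons_path hp /nbrel /= hcl eqxx nlr.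
  by move/negP: (no_inner_cycle hc); apply.
case/lastP: p hn hp hD hcl lr => [|p y] hn hp hD hcl.
  by move=> /= lr; have := rev_neq G x; rewrite -lr eqxx.
rewrite last_rcons => yx; subst y.
case: p hn hp hD hcl => [|f p] hn hp hD hcl.
  by move: hp; rewrite /nbrel /= Defs.revK eqxx andbF.
move: hp hD hn; rewrite /= size_rcons rcons_path all_rcons /nbrel /=.
move=> /and3P[/andP[/eqP xf _] hp /andP[/eqP hl _]] /and4P[xD fD _ pD] hn.
have sn : (size p < n)%N by move: hn; rewrite ltnS; apply: ltnW.
have fpD : all (mem D) (f :: p) by rewrite /= fD.
by have := IH f p sn hp fpD; rewrite hl src_revE xf eqxx.
Qed.

(** The cut for [e] is the complement of the set [Y] of vertices reached by inner non-backtracking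
    walks that begin with [e]. If an inner edge other than [e] entered [Y] from outside, prolonging
    or shortening the walk would reach its source. *)
Lemma eigen_forest : forest G D.
Proof.
move=> e eD.
pose Y := [set v | `[< exists p, [/\ path nbrel e p, all (mem D) (e :: p)
   & tgt G (last e p) = v] >]]%SET.
have eY : tgt G e \in Y.
  by rewrite inE; apply/asboolP; exists [::]; split => //=; rewrite eD.
exists (~: Y)%SET; split; first 2 last.
- move=> f fD; rewrite !finset.in_setC negbK => fY; rewrite inE => /asboolP[p [hp hpD hf]].
  have [lf|nlf] := eqVneq (last e p) f; last first.
    case/negP: fY; rewrite inE; apply/asboolP; exists (rcons p (rev G f)).
    split; last by rewrite last_rcons tgt_revE.
      by rewrite rcons_path hp /nbrel /= hf src_revE eqxx Defs.revK.
    by move: hpD; rewrite /= all_rcons => /andP[-> ->]; rewrite /= andbT inner_rev //; apply: supp_sym.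
  case/lastP: p hp hpD hf lf => [|p g] hp hpD hf /=; first by move=> <-.
  rewrite last_rcons => gf; subst g.
  case/negP: fY; rewrite inE; apply/asboolP; exists p.
  move: hp hpD; rewrite rcons_path /nbrel /= all_rcons => /andP[-> /andP[/eqP -> _]].
  by move=> /and3P[-> _ ->].
- rewrite finset.in_setC inE; apply/negP => /asboolP[p [hp hpD hs]].
  by have := no_inner_closed_walk hp hpD; rewrite hs eqxx.
- by rewrite finset.in_setC negbK.
Qed.

End Necessity.

(** * Comparison of eigenfunctions with Green functions *)

Section NecessityIndex.
Variables (R : realType) (V E : finType) (G : graph V E).
Variables (a : E -> R[i]) (b : V -> R) (lam : R).
Hypothesis ha : hermitian_weights G a.

Local Notation eigenfun := (eigenfun G a b lam).
Local Notation supp := (supp a).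
Local Notation X := (eigen_support G a b lam).
Local Notation D := (inner G supp X).
Local Notation J := (branch_edges G a X).

Implicit Types (eta theta : seq E -> R[i]).

Variable rho : E -> R[i].
Hypothesis hrho : forall e, e \in D -> rho e != 0 /\
   forall eta, eigenfun (src G e) eta -> eta [:: e] = rho e * eta [::].

Let hrho1 e : e \in D -> rho e != 0 /\ rho e * rho (rev G e) = 1.
Proof.
by move=> eD; split; [case: (hrho eD) | apply: (ratio_rev ha hrho)].
Qed.

Local Notation m := (branch_weight G a X rho).
Let m0 e : e \in J -> 0 < m e := branch_weight_gt0 hrho1 (e := e).

Section FixedEps.
Variables (eps : R) (t y : E -> R).
Hypothesis eps0 : 0 < eps.
Hypothesis ty : cavity_solution J (src G) (constraint_of G X) m eps t y.

Let t0 e : 0 < t e. Proof. by case: ty. Qed.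
Let y0 e : 0 < y e. Proof. by case: ty. Qed.

(* The least energy, in the Dirichlet form attached to the constraints, of the
   part of an eigenfunction lying beyond the last edge [e] of a walk. *)
Definition branch_energy (xi : seq E -> R[i]) (w : seq E) : R :=
  if w is x :: w' then
    let e := last x w' in
    if e \in supp then
      if tgt G e \in X then sqn (xi w) * y (rev G e)
      else if src G e \in X then m e * sqn (xi (belast x w')) * t e else 0
    else 0
  else 0.

Lemma branch_energy_rcons xi w e : branch_energy xi (rcons w e) =
  if e \in supp then
    if tgt G e \in X then sqn (xi (rcons w e)) * y (rev G e)
    else if src G e \in X then m e * sqn (xi w) * t e else 0
  else 0.
Proof. by case: w => [|x w] //=; rewrite last_rcons belast_rcons. Qed.

Lemma branch_energy_ge0 xi w : 0 <= branch_energy xi w.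
Proof.
case/lastP: w => [|w e] //; rewrite branch_energy_rcons.
have h1 := ltW (t0 e); have h2 := ltW (y0 (rev G e)).
by do !case: ifP => _ //; rewrite ?mulr_ge0 ?sqn_ge0 ?branch_weight_ge0.
Qed.

(** Along an inner edge the black node in its middle is crossed as well; this is [cavity_black_edge]
    for [rev G g], whose weight is the inverse of that of [g]. *)
Lemma branch_energy_step r xi w g : eigenfun r xi -> walk_from G r w ->
  ext G r w g -> g \in J ->
  m g * t g * sqn (xi w) <= branch_energy xi (rcons w g).
Proof.
move=> he hw hg gJ; have := gJ; rewrite inE => /andP[gF gX].
rewrite branch_energy_rcons gF gX; case: ifP => gY; last by rewrite mulrAC.
have gD : g \in D by rewrite innerE gJ.
have [h1 h2] := branch_weight_inner hrho1 gD.
have gJ' : rev G g \in J by rewrite inE supp_sym // gF src_revE.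
have -> : sqn (xi (rcons w g)) = sqn (rho g) * sqn (xi w).
  rewrite -(wact_ext hg) (eigen_ratio hrho he hw gD) ?sqnM //.
  by case/andP: hg => /eqP.
rewrite -h1 [leRHS]mulrAC; apply: ler_wpM2r; first exact: sqn_ge0.
have mg := m0 gJ; have mg' := m0 gJ'; have yg := y0 (rev G g).
rewrite expr2 -mulrA ler_pM2l //.
have -> : m g = (m (rev G g))^-1.
  by apply: (mulIf (lt0r_neq0 mg')); rewrite mulVf ?lt0r_neq0.
rewrite mulrC; apply: (cavity_black_edge m0 eps0 ty gJ'); first exact: rev_neq.
by apply/eqP; rewrite (constraint_of_inner gD gJ') eqxx orbT.
Qed.

(** At a vertex of [X] this is the equation of [y]. Outside [X] the eigenfunction vanishes, so the
    eigenvalue equation expresses [a e * xi w] by the values beyond; weighted Cauchy-Schwarz and the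
    equation of [t] conclude. *)
Lemma branch_energy_sub r xi w : eigenfun r xi -> walk_from G r w -> w != [::] ->
  branch_energy xi w <=
  eps * sqn (xi w) + \sum_(e | ext G r w e) branch_energy xi (rcons w e).
Proof.
move=> he; case/lastP: w => // w e hw _; rewrite branch_energy_rcons.
have S0 : 0 <= eps * sqn (xi (rcons w e)) +
  \sum_(e0 | ext G r (rcons w e) e0) branch_energy xi (rcons (rcons w e) e0).
  apply: addr_ge0; first by rewrite mulr_ge0 ?sqn_ge0 // ltW.
  by apply: sumr_ge0 => f _; exact: branch_energy_ge0.
case: ifP => // eF; case: ifP => [tX|tX].
  (* white node *)
  have -> : y (rev G e) = eps + \sum_(g in J | (g != rev G e) && (src G g == src G (rev G e))) m g * t g.
    by case: ty => _ _ ->.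
  rewrite mulrDr mulrC lerD2l mulr_sumr.
  rewrite [leRHS](bigID (mem J)) /= -[leLHS]addr0 lerD //; last first.
    by rewrite sumr_ge0 // => f _; exact: branch_energy_ge0.
  rewrite [leLHS](eq_bigl (fun g => ext G r (rcons w e) g && (g \in J))); last first.
    move=> g; rewrite ext_rcons src_revE andbC; congr (_ && _).
    by rewrite andbC; congr (_ && ~~ _); rewrite [RHS]eq_sym rev_eq.
  apply: ler_sum => g /andP[hg gJ]; rewrite mulrC.
  exact: branch_energy_step he hw hg gJ.
case: ifP => // sX.
(* black node *)
have tX' : tgt G e \notin X by rewrite tX.
have eJ : e \in J by rewrite inE eF.
have := eigen_eq_rcons ha he.2 hw.
have -> : xi (rcons w e) = 0 by apply: (eigen_outside he hw); rewrite wend_rcons tX.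
rewrite mulr0 => /esym/eqP; rewrite addr_eq0 => /eqP eq.
rewrite sqn0 mulr0 add0r.
have -> : m e * sqn (xi w) = sqn (\sum_(f | ext G r (rcons w e) f && (rev G f \in J)) conjc (a f) * xi (rcons (rcons w e) f)).
  rewrite /branch_weight tX -sqnM eq sqnN (bigID (fun f => rev G f \in J)) /=.
  rewrite [X in _ + X]big1 ?addr0 // => f /andP[hf]; rewrite inE supp_sym // src_revE.
  rewrite negb_and inE negbK => /orP[/eqP ->|fX]; first by rewrite conjc0 mul0r.
  by rewrite (eigen_outside he) ?mulr0 ?walk_rcons ?hf ?andbT ?wend_rcons // -walk_rcons.
set P := (fun f => ext G r (rcons w e) f && (rev G f \in J)).
apply: (@le_trans _ _ ((\sum_(f | P f) sqn (conjc (a f)) / y (rev G f)) *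
   (\sum_(f | P f) y (rev G f) * sqn (xi (rcons (rcons w e) f))) * t e)).
  by apply: ler_wpM2r; [exact: ltW | apply: sqn_sum_le => f _].
rewrite mulrAC.
have -> : \sum_(f | P f) y (rev G f) * sqn (xi (rcons (rcons w e) f)) =
   \sum_(f | P f) branch_energy xi (rcons (rcons w e) f).
  apply: eq_bigr => f /andP[_]; rewrite inE supp_sym // src_revE => /andP[h1 h2].
  by rewrite branch_energy_rcons h1 h2 mulrC.
apply: (@le_trans _ _ (\sum_(f | P f) branch_energy xi (rcons (rcons w e) f))); last first.
  rewrite [leRHS](bigID (fun f => rev G f \in J)) /= lerDl sumr_ge0 // => f _.
  exact: branch_energy_ge0.
rewrite -[leRHS]mul1r ler_wpM2r //.
  by rewrite sumr_ge0 // => f _; exact: branch_energy_ge0.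
have -> : \sum_(f | P f) sqn (conjc (a f)) / y (rev G f) =
  \sum_(k in J | (k != e) && (constraint_of G X k == constraint_of G X e)) m k / y k.
  rewrite [RHS](reindex_inj (can_inj (@Defs.revK _ _ G))) /=.
  apply: eq_big => f.
    rewrite /P ext_rcons constraint_of_cross // tgt_revE andbC; congr (_ && _).
    by rewrite andbC eq_sym.
  move=> /andP[]; rewrite ext_rcons => /andP[/eqP sf _] _.
  by rewrite /branch_weight tgt_revE sf tX -ha.
case: ty => _ _ _ /(_ e) ->; rewrite /cavity_black ler_pdivrMr; last first.
  by rewrite (lt_le_trans eps0) // cavity_black_den.
by rewrite mul1r lerDr ltW.
Qed.

Lemma branch_energy_level1 r xi K : eigenfun r xi -> sums_below G r (sqn \o xi) K ->
  \sum_(e | src G e == r) branch_energy xi [:: e] <= eps * (K - sqn (xi [::])).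
Proof.
move=> he hK; rewrite -level1.
pose c := \sum_e (y (rev G e) + m e * t e).
have ce e : y (rev G e) + m e * t e <= c.
  rewrite /c (bigD1 e) //= lerDl sumr_ge0 // => f _.
  by rewrite addr_ge0 ?mulr_ge0 ?branch_weight_ge0 // ltW.
apply: (@sub_flux _ _ _ G r (sqn \o xi) _ eps c) => //.
- by move=> w; apply: sqn_ge0.
- exact: ltW.
- rewrite /c sumr_ge0 // => f _.
  by rewrite addr_ge0 ?mulr_ge0 ?branch_weight_ge0 // ltW.
- by move=> w hw nw; apply: branch_energy_sub he hw nw.
move=> w e hw hxe /=; rewrite branch_energy_rcons.
have h1 := sqn_ge0 (xi w); have h2 := sqn_ge0 (xi (rcons w e)).
have h3 := y0 (rev G e); have h4 : 0 <= m e * t e by rewrite mulr_ge0 ?branch_weight_ge0 // ltW.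
have h5 := ce e.
have c0 : 0 <= c by apply: le_trans h5; rewrite addr_ge0 // ltW.
have z : 0 <= c * (sqn (xi w) + sqn (xi (rcons w e))) by rewrite mulr_ge0 // addr_ge0.
case: ifP => // _; case: ifP => _; last (case: ifP => // _).
  rewrite mulrC; apply: (@le_trans _ _ (c * sqn (xi (rcons w e)))).
    by rewrite ler_wpM2r //; lra.
  by rewrite ler_wpM2l // lerDr.
rewrite mulrAC; apply: (@le_trans _ _ (c * sqn (xi w))).
  by rewrite ler_wpM2r //; lra.
by rewrite ler_wpM2l // lerDl.
Qed.

(** The energy beyond the root is at most [eps * K], and the term of [rev G k] alone is [y k] times
    the squared value there. That [y k] is of order [eps] makes the black masses vanish in the
    limit. *)
Lemma cavity_white_small k xi K : k \in J -> eigenfun (tgt G k) xi ->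
  sums_below G (tgt G k) (sqn \o xi) K -> xi [:: rev G k] != 0 ->
  y k <= eps * (K / sqn (xi [:: rev G k])).
Proof.
move=> kJ he hK nz; rewrite mulrA ler_pdivlMr ?sqn_gt0 //.
have := branch_energy_level1 he hK.
rewrite (bigD1 (rev G k)) /=; last by rewrite src_revE.
have := kJ; rewrite inE => /andP[kF kX].
rewrite supp_sym // kF tgt_revE kX Defs.revK mulrC => h.
apply: le_trans (le_trans _ h) _.
  by rewrite lerDl sumr_ge0 // => f _; exact: (branch_energy_ge0 xi [:: f]).
by apply: ler_wpM2l; [exact: ltW | rewrite lerBlDr lerDl sqn_ge0].
Qed.

(** The same energy bound, now with all edges at the root: it keeps the white mass
    [eps * green_white] above a constant independent of [eps]. *)
Lemma green_white_large u xi K : u \in X -> eigenfun u xi ->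
  sums_below G u (sqn \o xi) K -> xi [::] != 0 ->
  sqn (xi [::]) / K <= eps * green_white J (src G) m eps t u.
Proof.
move=> uX he hK nz.
have q0 : 0 < sqn (xi [::]) by rewrite sqn_gt0.
have K0 : 0 < K.
  have := hK [:: [::]] isT; rewrite big_seq1 /= => /(_ isT).
  exact: lt_le_trans.
have g0 := green_white_gt0 m0 eps0 ty u.
rewrite ler_pdivrMr //.
suff h : sqn (xi [::]) * (green_white J (src G) m eps t u)^-1 <= eps * K.
  by rewrite -mulrA [_ * K]mulrC mulrA -ler_pdivrMr.
rewrite /green_white invrK mulrDr mulr_sumr.
have := branch_energy_level1 he hK; rewrite mulrBr lerBrDl => h.
apply: le_trans h; rewrite mulrC lerD2l.
rewrite [leRHS](bigID (mem J)) /= -[leLHS]addr0 lerD //; last first.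
  by rewrite sumr_ge0 // => f _; exact: (branch_energy_ge0 xi [:: f]).
rewrite (eq_bigl (fun g => (src G g == u) && (g \in J))); last by move=> g; rewrite andbC.
apply: ler_sum => g /andP[gu gJ]; rewrite mulrC.
by apply: (@branch_energy_step u xi [::]) => //; rewrite /ext gu.
Qed.

End FixedEps.

Lemma eigen_index v : v \in X -> (#|constraints G supp X| < #|X|)%N.
Proof.
move=> vX.
have hk k : exists c : R, k \in J -> 0 <= c /\ forall eps t y, 0 < eps ->
  cavity_solution J (src G) (constraint_of G X) m eps t y -> y k <= eps * c.
  have [kJ|nk] := boolP (k \in J); last by exists 0.
  have := kJ; rewrite inE => /andP[_ /eigen_supportP[eta he nz]].
  have := recenter_eigen he; set xi := recenter _ _ _ => hx.
  have xnz : xi [:: rev G k] != 0 by rewrite /xi /recenter /= eqxx.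
  case: (hx) => -[K hK] _; exists (K / sqn (xi [:: rev G k])) => _; split.
    rewrite divr_ge0 ?sqn_ge0 //; apply: le_trans (hK [::] isT isT).
    by rewrite big_nil.
  by move=> eps t y e0 ty; apply: (cavity_white_small e0 ty kJ hx hK xnz).
have [c hc] := choice hk.
have [d d0 hd] : exists2 d : R, 0 < d & forall eps t y, 0 < eps ->
  cavity_solution J (src G) (constraint_of G X) m eps t y ->
  d <= eps * green_white J (src G) m eps t v.
  have /eigen_supportP[eta he nz] := vX.
  case: (he) => -[K hK] _; exists (sqn (eta [::]) / K).
    have := hK [:: [::]] isT isT; rewrite big_seq1 /= => h.
    have q0 : 0 < sqn (eta [::]) by rewrite sqn_gt0.
    by rewrite divr_gt0 // (lt_le_trans q0).
  by move=> eps t y e0 ty; apply: (green_white_large e0 ty vX he hK nz).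
pose C := \sum_(k in J) c k / m k.
have C0 : 0 <= C by apply: sumr_ge0 => k kJ; rewrite divr_ge0 ?branch_weight_ge0 ?(hc k kJ).1.
pose N : R := #|constraints G supp X|%:R.
have N0 : 0 <= N by rewrite ler0n.
(* This gives [eps <= 1] and [eps * (C * N) < d]: the total black mass, at most [eps * (C * N)],
   stays below the lower bound [d] for the white mass at [v]. *)
pose eps := d / (C * N + d + 1).
have den : 0 < C * N + d + 1 by rewrite ltr_wpDl // addr_ge0 ?mulr_ge0 // ltW.
have e0 : 0 < eps by rewrite divr_gt0.
have e1 : eps <= 1 by rewrite ler_pdivrMr // mul1r; have := mulr_ge0 C0 N0; lra.
have ed : eps * (C * N) < d.
  rewrite /eps mulrAC ltr_pdivrMr // ltr_pM2l //; lra.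
have [t [y ty]] := cavity_exists (src G) (constraint_of G X) m0 e0.
have q0 k : k \in J -> constraint_of G X k \in constraints G supp X.
  exact: branch_edges_constraint.
have p0 k : k \in J -> src G k \in X by rewrite inE => /andP[].
have := green_index m0 e0 ty p0 q0 => H.
have up : \sum_(u in X) (1 - eps * green_white J (src G) m eps t u) <= #|X|%:R - d.
  have -> : #|X|%:R = 1 + \sum_(u in X | u != v) 1 :> R.
    by rewrite -sum1_card natr_sum (bigD1 v).
  rewrite (bigD1 v) //= [leRHS]addrAC lerD //.
    by have := hd _ _ _ e0 ty; lra.
  apply: ler_sum => u _; rewrite gerBl mulr_ge0 // ltW //.
  exact: (green_white_gt0 m0 e0 ty u).
have low : N - eps * (C * N) <= \sum_(x in constraints G supp X)
    (1 - eps * green_black J (constraint_of G X) m eps y x).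
  rewrite /N -sum1_card natr_sum mulrA -/N mulr_sumr -sumrB; apply: ler_sum => x.
  move=> /(constraint_edge ha)[k kJ <-]; rewrite mulr1 lerD2l lerN2.
  rewrite ler_pM2l //.
  have g0 := green_black_gt0 m0 e0 ty (constraint_of G X k).
  have [_ /(_ _ _ _ e0 ty) yk] := hc _ kJ.
  have mk := m0 kJ.
  have yk0 : 0 < y k by case: ty.
  have tk0 : 0 < t k by case: ty.
  have : green_black J (constraint_of G X) m eps y (constraint_of G X k) <= y k / m k.
    rewrite -[leLHS]invrK (green_black_edge ty kJ) -[leRHS]invf_div lef_pV2 ?posrE.
    - by rewrite lerDr ltW // invr_gt0.
    - by rewrite addr_gt0 ?invr_gt0 ?divr_gt0.
    - by rewrite divr_gt0.
  move/le_trans; apply; apply: (@le_trans _ _ (c k / m k)).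
    rewrite ler_pM2r ?invr_gt0 //; apply: le_trans yk _.
    by rewrite ler_piMl // (hc _ kJ).1.
  rewrite /C (bigD1 k) //= lerDl sumr_ge0 // => j /andP[jJ _].
  by rewrite divr_ge0 ?branch_weight_ge0 ?(hc j jJ).1.
rewrite -(ltr_nat R) -/N; move: up; rewrite H => up; lra.
Qed.

End NecessityIndex.

Lemma eigen_balanced (R : realType) (V E : finType) (G : graph V E)
    (a : E -> R[i]) (b : V -> R) (lam : R) (r : V) (eta : seq E -> R[i]) w :
  hermitian_weights G a -> eigenfun G a b lam r eta -> walk_from G r w ->
  eta w != 0 -> exists X rho, forest G (inner G (supp a) X) /\ balanced G a b lam X rho.
Proof.
move=> ha he hw nz; have vX := eigen_support_wend he hw nz.
pose X := eigen_support G a b lam.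
have /choice[rho hrho] : forall e, exists rho : R[i], e \in inner G (supp a) X ->
  rho != 0 /\ forall eta, eigenfun G a b lam (src G e) eta -> eta [:: e] = rho * eta [::].
  move=> e; have [eD|nD] := boolP (e \in inner G (supp a) X); last by exists 0.
  by have [rho h] := inner_ratio_exists ha eD; exists rho.
exists X, rho; split; first exact: (eigen_forest ha hrho).
split; last exact: (eigen_index ha hrho vX).
  by move=> e eD; split; [case: (hrho _ eD) | apply: (ratio_rev ha hrho)].
by move=> u uX; apply: (eigen_balance hrho).
Qed.

(** Along an ultrafilter all bounded quantities converge at once, without successive extractions of
    subsequences. *)
Lemma ultra_bounded_cvg (R : realType) (U : set_system nat) (u : nat -> R) (M : R) :
  UltraFilter U -> (forall n, 0 <= u n <= M) -> exists l : R, u @ U --> l.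
Proof.
move=> hU hu.
have FF : ProperFilter (fmap u U) by apply: fmap_proper_filter; apply: ultra_proper.
have UI : U (u @^-1` `[0, M]%classic).
  by apply: filterE => n; rewrite /= in_itv /=; apply: hu.
have [p [_ cp]] := segment_compact FF UI.
exists p => N hN.
have [//|hNC] := in_ultra_setVsetC (u @^-1` N) hU.
have [x [nx xN]] : (~` N `&` N) !=set0 by apply: cp.
by [].
Qed.

Lemma cvg_bigsum (R : realType) (T I : Type) (F : set_system T) (s : seq I)
    (P : pred I) (f : I -> T -> R) (l : I -> R) : Filter F ->
  (forall i, P i -> f i @ F --> l i) ->
  (fun x => \sum_(i <- s | P i) f i x) @ F --> \sum_(i <- s | P i) l i.
Proof.
move=> hF h; elim: s => [|i s IH].
  under eq_fun do rewrite big_nil; rewrite big_nil; exact: cvg_cst.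
under eq_fun do rewrite big_cons; rewrite big_cons.
by have [Pi|nPi] := boolP (P i); [apply: cvgD => //; apply: h | exact: IH].
Qed.

Section WalkProducts.
Variables (T : comNzRingType) (E : finType) (f : option E -> E -> T).

(** Factors depend on the preceding edge because the ratio across a boundary vertex involves both
    the edge of entry and the edge of exit. *)
Fixpoint wprod (prev : option E) (w : seq E) : T :=
  if w is e :: w' then f prev e * wprod (Some e) w' else 1.

Definition lasto (w : seq E) : option E := if w is x :: w' then Some (last x w') else None.

Lemma lasto_rcons w e : lasto (rcons w e) = Some e.
Proof. by case: w => [|x w] //=; rewrite last_rcons. Qed.

Lemma wprod_rcons w e : wprod None (rcons w e) = wprod None w * f (lasto w) e.
Proof.
have gen p w' : wprod p (rcons w' e) =
    wprod p w' * f (if w' is x :: w'' then Some (last x w'') else p) e.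
  elim: w' p => [|x w' IH] p /=; first by rewrite mulr1 mul1r.
  by rewrite IH mulrA; case: w' {IH}.
by rewrite gen; case: w.
Qed.
End WalkProducts.

(** * Construction of eigenfunctions *)

Section Sufficiency.
Variables (R : realType) (V E : finType) (G : graph V E).
Variables (a : E -> R[i]) (b : V -> R) (lam : R).
Hypothesis ha : hermitian_weights G a.
Variables (X : {set V}) (rho : E -> R[i]).
Hypothesis hbal : balanced G a b lam X rho.

Local Notation supp := (supp a).
Local Notation D := (inner G supp X).
Local Notation J := (branch_edges G a X).
Local Notation m := (branch_weight G a X rho).
Local Notation q := (constraint_of G X).

Let hrho1 e : e \in D -> rho e != 0 /\ rho e * rho (rev G e) = 1.
Proof. by case: hbal => + _ _; apply. Qed.

Let m0 e : e \in J -> 0 < m e := branch_weight_gt0 hrho1 (e := e).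

(* The values of the Green function of the constraint problem, rooted at a
   vertex of [X]: a complex factor that does not depend on [eps], times a
   product of ratios [z]. *)
Definition phase (prev : option E) (e : E) : R[i] :=
  if e \in supp then
    if src G e \in X then
      (if tgt G e \in X then rho e * (m (rev G e))%:C%C else 1)
    else if tgt G e \in X then (if prev is Some g then - (a g * a e) else 0) else 0
  else 0.

Definition ratio (z : E -> E -> R) (prev : option E) (e : E) : R :=
  if src G e \in X then (if tgt G e \in X then z e (rev G e) else 1)
  else if prev is Some g then z g (rev G e) else 0.

Definition amplitude (z : E -> E -> R) (w : seq E) : R[i] :=
  wprod phase None w * (wprod (ratio z) None w)%:C%C.

Lemma amplitude_rcons z w e : amplitude z (rcons w e) =
  amplitude z w * (phase (lasto w) e * (ratio z (lasto w) e)%:C%C).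
Proof. by rewrite /amplitude !wprod_rcons rmorphM /= mulrACA. Qed.

Lemma rev_branch e : e \in supp -> tgt G e \in X -> rev G e \in J.
Proof. by move=> h1 h2; rewrite inE supp_sym // h1 src_revE. Qed.

(** The quotient of Green values between the white ends of [g] and [k] through their common black
    node, up to edge coefficients. The default 0 lets the bounds hold for all pairs. *)
Definition cavity_ratio (t y : E -> R) (g k : E) : R :=
  if [&& g \in J, k \in J, k != g & q k == q g] then t g / y k else 0.

Section FixedEps.
Variables (eps : R) (t y : E -> R).
Hypothesis eps0 : 0 < eps.
Hypothesis ty : cavity_solution J (src G) q m eps t y.

Let t0 e : 0 < t e. Proof. by case: ty. Qed.
Let y0 e : 0 < y e. Proof. by case: ty. Qed.

Local Notation z := (cavity_ratio t y).
Local Notation green := (green_white J (src G) m eps t).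

Lemma cavity_ratio_ge0 g k : 0 <= z g k.
Proof. by rewrite /cavity_ratio; case: ifP => // _; rewrite divr_ge0 // ltW. Qed.

Lemma cavity_ratio_le g k : z g k <= (m k)^-1.
Proof.
rewrite /cavity_ratio; case: ifP => [/and4P[gJ kJ kg /eqP qk]|_].
  rewrite ler_pdivrMr // mulrC.
  exact: (cavity_black_edge m0 eps0 ty kJ kg qk).
by rewrite invr_ge0 branch_weight_ge0.
Qed.

Lemma cavity_ratio_defect g : g \in J ->
  1 - \sum_(k in J | (k != g) && (q k == q g)) m k * z g k = eps * t g.
Proof.
move=> gJ; rewrite -(cavity_black_defect m0 eps0 ty g); congr (_ - _).
apply: eq_bigr => k /and3P[kJ kg qk].
by rewrite /cavity_ratio gJ kJ kg qk.
Qed.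

Variable c0 : R.

Definition energy (w : seq E) : R :=
  if lasto w is Some e then
    if e \in supp then
      if tgt G e \in X then c0 ^+ 2 * sqn (amplitude z w) * y (rev G e)
      else if src G e \in X then m e * (c0 ^+ 2 * sqn (amplitude z w)) * t e else 0
    else 0
  else 0.

Definition white_part r (w : seq E) : R :=
  if wend G r w \in X then c0 ^+ 2 * sqn (amplitude z w) else 0.

Lemma energy_rcons w e : energy (rcons w e) =
  if e \in supp then
    if tgt G e \in X then c0 ^+ 2 * sqn (amplitude z (rcons w e)) * y (rev G e)
    else if src G e \in X then m e * (c0 ^+ 2 * sqn (amplitude z (rcons w e))) * t e else 0
  else 0.
Proof. by rewrite /energy lasto_rcons. Qed.

Lemma energy_ge0 w : 0 <= energy w.
Proof.
rewrite /energy; case: lasto => // e; have h1 := ltW (t0 e); have h2 := ltW (y0 (rev G e)).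
have h3 : 0 <= c0 ^+ 2 * sqn (amplitude z w) by apply: mulr_ge0; rewrite ?sqr_ge0 ?sqn_ge0.
have h4 := branch_weight_ge0 G a X rho e.
case: ifP => // _; case: ifP => _; first exact: mulr_ge0.
by case: ifP => // _; apply: mulr_ge0 => //; apply: mulr_ge0.
Qed.

Lemma energy_child r w g : walk_from G r w -> ext G r w g -> src G g \in X ->
  energy (rcons w g) <=
  if g \in J then (c0 ^+ 2 * sqn (amplitude z w)) * (m g * t g) else 0.
Proof.
move=> hw hg gX; have gJE : (g \in J) = (g \in supp) by rewrite inE gX andbT.
rewrite energy_rcons gJE; case: ifP => // gF.
have gJ : g \in J by rewrite gJE.
rewrite amplitude_rcons /phase /ratio gF gX; case: ifP => gY; last first.
  by rewrite gY mul1r rmorph1 mulr1 [m g * _]mulrC -[leLHS]mulrA lexx.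
rewrite gY.
have gD : g \in D by rewrite innerE gJ.
have [h1 h2] := branch_weight_inner hrho1 gD.
have gJ' := rev_branch gF gY.
have zl := cavity_ratio_le g (rev G g); have z0 := cavity_ratio_ge0 g (rev G g).
have mg := m0 gJ; have mg' := m0 gJ'.
rewrite sqnM; set S := sqn (amplitude _ _); rewrite !sqnM !sqnR -h1.
have -> : c0 ^+ 2 * (S * (m g ^+ 2 * m (rev G g) ^+ 2 * z g (rev G g) ^+ 2)) *
    y (rev G g) = c0 ^+ 2 * S *
   ((m g * m (rev G g)) ^+ 2 * (z g (rev G g) * (z g (rev G g) * y (rev G g)))).
  by ring.
rewrite h2 expr1n mul1r; apply: ler_wpM2l; first by rewrite mulr_ge0 ?sqr_ge0 ?sqn_ge0.
have zE : z g (rev G g) * y (rev G g) = t g.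
  rewrite /cavity_ratio gJ gJ' rev_neq (constraint_of_inner gD gJ') eqxx orbT /=.
  by rewrite divfK // gt_eqF.
rewrite zE; apply: ler_wpM2r; first exact: ltW.
apply: le_trans zl _.
by rewrite -[m g]mulr1 -(mulfV (lt0r_neq0 mg')) mulrA h2 mul1r.
Qed.

(** Energy balance of the Green function: the energy beyond an edge pays for [eps] times the mass at
    its end and for the energies beyond the next edges. A white end uses the equation of [y]; at a
    black end the weighted ratios sum to at most 1, by [cavity_ratio_defect]. *)
Lemma energy_super r w : walk_from G r w -> w != [::] ->
  eps * white_part r w + \sum_(f | ext G r w f) energy (rcons w f) <= energy w.
Proof.
case/lastP: w => // w e hw _; rewrite /white_part wend_rcons.
have [eF|eF] := boolP (e \in supp); last first.
  have am0 : amplitude z (rcons w e) = 0.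
    by rewrite amplitude_rcons /phase (negbTE eF) mul0r mulr0.
  rewrite am0 sqn0 mulr0 if_same mulr0 add0r big1 ?energy_ge0 // => f _.
  rewrite energy_rcons amplitude_rcons am0 mul0r sqn0 mulr0 !mul0r mulr0 mul0r.
  by do !case: ifP.
have [tX|tX] := boolP (tgt G e \in X).
  rewrite {2}/energy lasto_rcons eF tX.
  have -> : y (rev G e) = eps + \sum_(g in J | (g != rev G e) && (src G g == src G (rev G e))) m g * t g.
    by case: ty => _ _ ->.
  set c := c0 ^+ 2 * _; rewrite [leRHS]mulrDr [eps * _]mulrC lerD2l mulr_sumr.
  rewrite [leRHS](eq_bigl (fun g => ext G r (rcons w e) g && (g \in J))); last first.
    move=> g; rewrite ext_rcons src_revE andbC; congr (_ && _).
    by rewrite andbC; congr (_ && ~~ _); rewrite [RHS]eq_sym rev_eq.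
  rewrite [leRHS]big_mkcondr; apply: ler_sum => g hg.
  apply: (energy_child hw hg).
  by case/andP: hg => /eqP -> _; rewrite wend_rcons.
rewrite mulr0 add0r.
have [sX|sX] := boolP (src G e \in X); last first.
  have am0 : amplitude z (rcons w e) = 0.
    by rewrite amplitude_rcons /phase eF (negbTE tX) (negbTE sX) mul0r mulr0.
  rewrite big1 ?energy_ge0 // => f _.
  rewrite energy_rcons amplitude_rcons am0 mul0r sqn0 mulr0 !mul0r mulr0 mul0r.
  by do !case: ifP.
have eJ : e \in J by rewrite inE eF.
rewrite {2}/energy lasto_rcons eF (negbTE tX) sX.
set c := c0 ^+ 2 * _; have cc : 0 <= c by rewrite mulr_ge0 ?sqr_ge0 ?sqn_ge0.
have -> : \sum_(f | ext G r (rcons w e) f) energy (rcons (rcons w e) f) =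
  \sum_(f | ext G r (rcons w e) f && (rev G f \in J)) (m e * c * t e) *
    (m (rev G f) * z e (rev G f)).
  rewrite (bigID (fun f => rev G f \in J)) /= [X in _ + X]big1 ?addr0.
    apply: eq_bigr => f /andP[hf fJ].
    have := fJ; rewrite inE supp_sym // src_revE => /andP[fF fX].
    have sf : src G f = tgt G e by move: hf; rewrite ext_rcons => /andP[/eqP].
    rewrite energy_rcons fF fX amplitude_rcons /phase /ratio fF fX sf (negbTE tX).
    rewrite lasto_rcons sqnM /c; set S := sqn (amplitude _ _); rewrite !sqnM sqnN sqnM sqnR.
    have -> : m e = sqn (a e) by rewrite /branch_weight (negbTE tX).
    have -> : m (rev G f) = sqn (a f).
      by rewrite /branch_weight tgt_revE sf (negbTE tX) -ha sqn_conj.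
    have ze : z e (rev G f) * y (rev G f) = t e.
      rewrite /cavity_ratio eJ fJ constraint_of_cross // tgt_revE sf eqxx andbT /=.
      have -> : rev G f != e by move: hf; rewrite ext_rcons [rev G f == e]eq_sym => /andP[].
      by rewrite divfK // gt_eqF.
    rewrite -ze; ring.
  move=> f /andP[hf]; rewrite inE supp_sym // src_revE negb_and => fJ.
  have sf : src G f = tgt G e by move: hf; rewrite ext_rcons => /andP[/eqP].
  rewrite energy_rcons sf (negbTE tX); case: ifP fJ => //= fF.
  by move/negbTE ->.
rewrite -mulr_sumr -[leRHS]mulr1; apply: ler_wpM2l.
  apply: mulr_ge0; last exact: ltW.
  by apply: mulr_ge0 => //; exact: branch_weight_ge0.
have -> : \sum_(f | ext G r (rcons w e) f && (rev G f \in J)) m (rev G f) * z e (rev G f) =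
  \sum_(k in J | (k != e) && (q k == q e)) m k * z e k.
  rewrite [RHS](reindex_inj (can_inj (@Defs.revK _ _ G))) /=.
  apply: eq_bigl => f.
  rewrite ext_rcons constraint_of_cross // tgt_revE andbC; congr (_ && _).
  by rewrite andbC eq_sym.
by rewrite -subr_ge0 cavity_ratio_defect // mulr_ge0 // ltW.
Qed.

Variable r : V.
Hypothesis rX : r \in X.
Hypothesis c0E : c0 = eps * green r.

Let g0 : 0 < green r. Proof. exact: (green_white_gt0 m0 eps0 ty r). Qed.

Let c0_gt0 : 0 < c0. Proof. by rewrite c0E mulr_gt0. Qed.

Let c0_sqr : c0 ^+ 2 * (green r)^-1 = eps * c0.
Proof.
by have g0' := g0; rewrite c0E; move: g0'; set g := green r => g0'; field; rewrite gt_eqF.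
Qed.

Lemma root_value_le1 : c0 <= 1.
Proof.
rewrite c0E -ler_pdivlMl // mulr1 lef_pV2 ?posrE // ?lerDl; last first.
  by rewrite -invr_gt0.
rewrite sumr_ge0 // => g /andP[gJ _].
by rewrite mulr_ge0 ?branch_weight_ge0 // ltW.
Qed.

Lemma amplitude_nil : amplitude z [::] = 1.
Proof. by rewrite /amplitude /= mulr1. Qed.

Lemma energy_root :
  eps * white_part r [::] + \sum_(e | src G e == r) energy [:: e] <= eps * c0.
Proof.
rewrite -c0_sqr /green_white invrK /white_part /wend /= rX amplitude_nil sqn1 mulr1.
rewrite mulrDr [eps * _]mulrC lerD2l mulr_sumr.
rewrite [leRHS](eq_bigl (fun g => (src G g == r) && (g \in J))); last first.
  by move=> g; rewrite andbC.
rewrite [leRHS]big_mkcondr; apply: ler_sum => g /eqP gr.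
have := @energy_child r [::] g isT; rewrite /ext gr eqxx rX amplitude_nil sqn1 mulr1.
exact.
Qed.

(** The energies telescope down from [eps * c0] at the root; the factor [eps] cancels, so that the
    bound on the mass over [X] survives the limit. *)
Lemma white_sum n : \sum_(w <- walk_ball G r n) white_part r w <= c0.
Proof.
have step k : eps * \sum_(w <- walk_ball G r k.+1) white_part r w +
    \sum_(w <- level G r k.+1) energy w <= eps * c0.
  elim: k => [|k IH].
    rewrite big_walk_ball big_nat1 level1 /= big_seq1; exact: energy_root.
  apply: le_trans IH; rewrite big_walk_ball big_nat_recr // -big_walk_ball mulrDr -addrA.
  rewrite lerD2l [X in _ + X <= _]big_levelS mulr_sumr -big_split.
  rewrite big_seq [leRHS]big_seq; apply: ler_sum => w.
  rewrite -/(level G r k.+1) mem_level => /andP[hw /eqP sw].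
  by apply: energy_super => //; rewrite -size_eq0 sw.
have wp w : 0 <= white_part r w.
  by rewrite /white_part; case: ifP => // _; apply: mulr_ge0; rewrite ?sqr_ge0 ?sqn_ge0.
have := step n; rewrite big_walk_ball big_nat_recr //= -big_walk_ball mulrDr => h.
rewrite -(ler_pM2l eps0); apply: le_trans h; rewrite -addrA lerDl.
apply: addr_ge0; first by apply: mulr_ge0; [exact: ltW | exact: sumr_ge0].
by apply: sumr_ge0 => w _; exact: energy_ge0.
Qed.

Lemma energy_le w : walk_from G r w -> energy w <= eps * c0.
Proof.
elim/last_ind: w => [|w e IH] hw; first by rewrite mulr_ge0 // ltW.
have := hw; rewrite walk_rcons => /andP[hw' he].
have wp u : 0 <= eps * white_part r u.
  apply: mulr_ge0; first exact: ltW.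
  by rewrite /white_part; case: ifP => // _; apply: mulr_ge0; rewrite ?sqr_ge0 ?sqn_ge0.
case: w IH hw hw' he => [|x w] IH hw hw' he.
  apply: le_trans energy_root; rewrite (bigD1 e) /=; last first.
    by move: he; rewrite /ext /wend /= andbT.
  rewrite addrCA lerDl; apply: addr_ge0 => //.
  by apply: sumr_ge0 => f _; exact: energy_ge0.
apply: le_trans (IH hw'); apply: le_trans (energy_super hw' isT).
rewrite (bigD1 e) //= addrCA lerDl; apply: addr_ge0 => //.
by apply: sumr_ge0 => f _; exact: energy_ge0.
Qed.

(** Energy decrease bounds [m g * t g] times the squared amplitude by [eps], and [eps * t g <= 1].
    Hence the amplitude times the violation [eps * t g] of the constraint tends to 0. *)
Lemma amplitude_defect w g : walk_from G r w -> ext G r w g -> g \in J ->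
  (eps * t g) ^+ 2 * (c0 ^+ 2 * sqn (amplitude z w)) <= eps ^+ 2 / m g.
Proof.
move=> hw hg gJ; set c := c0 ^+ 2 * _.
have cc : 0 <= c by apply: mulr_ge0; rewrite ?sqr_ge0 ?sqn_ge0.
have gX : src G g \in X by move: gJ; rewrite inE => /andP[].
have mt0 f : 0 <= m f * t f by rewrite mulr_ge0 ?branch_weight_ge0 // ltW.
have h : m g * t g * c <= eps.
  apply: (@le_trans _ _ (eps * c0)); last by rewrite ler_piMr ?root_value_le1 // ltW.
  rewrite /c {c cc}; case/lastP: w hw hg => [|w e] hw hg.
    rewrite amplitude_nil sqn1 mulr1 -c0_sqr mulrC; apply: ler_wpM2l; first exact: sqr_ge0.
    rewrite /green_white invrK (bigD1 g) /=; last first.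
      by rewrite gJ; move: hg; rewrite /ext /wend /= andbT.
    rewrite addrCA lerDl; apply: addr_ge0; first exact: ltW.
    by apply: sumr_ge0 => f _.
  have tX : tgt G e \in X by move: hg gX; rewrite ext_rcons => /andP[/eqP ->].
  have [eF|eF] := boolP (e \in supp); last first.
    rewrite amplitude_rcons /phase (negbTE eF) mul0r mulr0 sqn0 !mulr0.
    by rewrite mulr_ge0 // ltW.
  apply: le_trans (energy_le hw); rewrite energy_rcons eF tX mulrC.
  apply: ler_wpM2l; first by apply: mulr_ge0; rewrite ?sqr_ge0 ?sqn_ge0.
  have -> : y (rev G e) = eps + \sum_(f in J | (f != rev G e) && (src G f == src G (rev G e))) m f * t f.
    by case: ty => _ _ ->.
  rewrite (bigD1 g) /=.
    rewrite addrCA lerDl; apply: addr_ge0; first exact: ltW.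
    by apply: sumr_ge0 => f _.
  move: hg; rewrite gJ ext_rcons src_revE => /andP[-> h].
  by rewrite andbT eq_sym rev_eq.
have tl : t g <= eps^-1.
  by case: ty => _ _ _ ->; apply: cavity_black_le m0 eps0 _ _ _.
have mg := m0 gJ; rewrite ler_pdivlMr //.
have -> : (eps * t g) ^+ 2 * c * m g = (eps ^+ 2 * t g) * (m g * t g * c) by ring.
apply: (@le_trans _ _ (eps ^+ 2 * t g * eps)).
  by apply: ler_wpM2l => //; apply: mulr_ge0; rewrite ?sqr_ge0 // ltW.
rewrite -mulrA -[leRHS]mulr1; apply: ler_wpM2l; first exact: sqr_ge0.
by rewrite mulrC -ler_pdivlMl // mulr1.
Qed.

End FixedEps.

(** Each black term of [green_index] is at most 1, and there are at most [#|X| - 1] of them. Some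
    root in [X] therefore keeps a positive mass in the limit. *)
Lemma green_sum_ge1 (eps : R) t y : 0 < eps -> cavity_solution J (src G) q m eps t y ->
  1 <= \sum_(u in X) eps * green_white J (src G) m eps t u.
Proof.
move=> e0 ty.
have q0 k : k \in J -> q k \in constraints G supp X by exact: branch_edges_constraint.
have p0 k : k \in J -> src G k \in X by rewrite inE => /andP[].
have := green_index m0 e0 ty p0 q0; rewrite sumrB sumr_const.
set S := \sum_(u in X) _ => H.
have : \sum_(x in constraints G supp X) (1 - eps * green_black J q m eps y x)
   <= #|constraints G supp X|%:R.
  rewrite -sum1_card natr_sum; apply: ler_sum => x _.
  rewrite gerBl; apply: mulr_ge0; first exact: ltW.
  by apply: ltW; exact: (green_black_gt0 m0 e0 ty).
rewrite -H; case: hbal => _ _; rewrite -(ler_nat R) -natr1 => h1 h2; lra.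
Qed.

(* The limit of the Green functions as [eps] tends to 0. *)
Lemma balanced_eigenfun : exists u eta, eigenfun G a b lam u eta /\ eta [::] != 0.
Proof.
pose eps n : R := n.+1%:R^-1.
have e0 n : 0 < eps n by rewrite invr_gt0.
have /choice[ty hty] : forall n, exists ty : (E -> R) * (E -> R),
    cavity_solution J (src G) q m (eps n) ty.1 ty.2.
  by move=> n; have [t [y h]] := cavity_exists (src G) q m0 (e0 n); exists (t, y).
have [U [hU hle]] := ultraFilterLemma eventually_filter.
have UP : ProperFilter U by apply: ultra_proper.
pose zn n := cavity_ratio (ty n).1 (ty n).2.
have [zl hz] : exists zl : E -> E -> R, forall g k, (fun n => zn n g k) @ U --> zl g k.
  have h (gk : E * E) : exists l : R, (fun n => zn n gk.1 gk.2) @ U --> l.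
    have hb n : 0 <= zn n gk.1 gk.2 <= (m gk.2)^-1.
      by rewrite (cavity_ratio_ge0 (hty n)) (cavity_ratio_le (e0 n) (hty n)).
    by have [l hl] := ultra_bounded_cvg hU hb; exists l.
  by have [zl hz] := choice h; exists (fun g k => zl (g, k)) => g k; apply: (hz (g, k)).
pose cn u n := eps n * green_white J (src G) m (eps n) (ty n).1 u.
have cn0 u n : 0 < cn u n by rewrite mulr_gt0 //; exact: (green_white_gt0 m0 (e0 n) (hty n)).
have cn1 u n : cn u n <= 1 by apply: (root_value_le1 (e0 n) (hty n)).
have /choice[c hc] : forall u, exists c : R, cn u @ U --> c.
  by move=> u; apply: (@ultra_bounded_cvg _ _ _ 1) => // n; rewrite ltW //=.
have [r rX cr] : exists2 r, r \in X & c r != 0.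
  apply: contrapT => H.
  have : (fun n => \sum_(u in X) cn u n) @ U --> \sum_(u in X) c u.
    by apply: cvg_bigsum => u _; apply: hc.
  rewrite big1; last first.
    by move=> u uX; apply/eqP/negPn/negP => cu; apply: H; exists u.
  move=> /cvgr_lt /(_ 1 ltr01) h.
  have [n] := @filter_ex _ _ UP _ h.
  by rewrite ltNge (green_sum_ge1 (e0 n) (hty n)).
have heps : eps @ U --> 0 by apply: cvg_trans (@cvg_harmonic R); apply: cvg_app.
pose pn n w := wprod (ratio (zn n)) None w.
pose pl w := wprod (ratio zl) None w.
have hp w : (fun n => pn n w) @ U --> pl w.
  elim/last_ind: w => [|w e IH]; first exact: cvg_cst.
  rewrite /pl wprod_rcons /pn; under eq_fun do rewrite wprod_rcons.
  apply: cvgM => //; rewrite /ratio; case: ifP => _.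
    by case: ifP => _; [exact: hz | exact: cvg_cst].
  by case: lasto => [g|]; [exact: hz | exact: cvg_cst].
pose ka w := wprod phase None w.
have am_sqn z w : sqn (amplitude z w) = sqn (ka w) * (wprod (ratio z) None w) ^+ 2.
  by rewrite /amplitude sqnM sqnR.
have hwhite w : (fun n => (cn r n) ^+ 2 * sqn (amplitude (zn n) w)) @ U -->
    (c r) ^+ 2 * sqn (amplitude zl w).
  under eq_fun do rewrite am_sqn; rewrite am_sqn.
  have h1 : (fun n => cn r n ^+ 2) @ U --> c r ^+ 2.
    by under eq_fun do rewrite expr2; rewrite expr2; apply: cvgM; apply: hc.
  have h2 : (fun n => pn n w ^+ 2) @ U --> pl w ^+ 2.
    by under eq_fun do rewrite expr2; rewrite expr2; apply: cvgM; apply: hp.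
  by apply: cvgM => //; apply: cvgMl_tmp.
(* The amplitudes at boundary vertices only relay the product; the eigenfunction itself vanishes
   there. *)
pose eta w : R[i] := if wend G r w \in X then amplitude zl w * (c r)%:C%C else 0.
(* In the limit either the amplitude vanishes or the condition of the black node on the ratios is
   exact. *)
have defect w g : walk_from G r w -> ext G r w g -> g \in J ->
    amplitude zl w * (c r)%:C%C *
    (1 - \sum_(k in J | (k != g) && (q k == q g)) m k * zl g k)%:C%C = 0.
  move=> hw hg gJ; apply/eqP; rewrite -sqn_eq0 sqnM [sqn (_ * (c r)%:C%C)]sqnM !sqnR.
  set S := 1 - _; rewrite eq_le; apply/andP; split; last first.
    apply: mulr_ge0; last exact: sqr_ge0.
    by apply: mulr_ge0; [exact: sqn_ge0 | exact: sqr_ge0].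
  have hS : (fun n => 1 - \sum_(k in J | (k != g) && (q k == q g)) m k * zn n g k) @ U --> S.
    apply: cvgB; first exact: cvg_cst.
    by apply: cvg_bigsum => k _; apply: cvgMl_tmp; apply: hz.
  have hS2 : (fun n => (1 - \sum_(k in J | (k != g) && (q k == q g)) m k * zn n g k) ^+ 2
       * (cn r n ^+ 2 * sqn (amplitude (zn n) w))) @ U --> S ^+ 2 * (c r ^+ 2 * sqn (amplitude zl w)).
    apply: cvgM => //; under eq_fun do rewrite expr2; rewrite expr2.
    by apply: cvgM.
  have he2 : (fun n => eps n ^+ 2 / m g) @ U --> 0.
    rewrite -(mul0r (m g)^-1) -(mulr0 0); apply: cvgMr_tmp.
    by under eq_fun do rewrite expr2; apply: cvgM.
  have -> : sqn (amplitude zl w) * c r ^+ 2 * S ^+ 2 =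
     S ^+ 2 * (c r ^+ 2 * sqn (amplitude zl w)).
    by rewrite mulrC [sqn _ * _]mulrC.
  apply: (ler_cvg_to hS2 he2); apply: nearW => n.
  rewrite (cavity_ratio_defect (e0 n) (hty n) gJ).
  exact: (amplitude_defect (e0 n) (hty n) rX erefl hw hg gJ).
exists r, eta; split; last first.
  by rewrite /eta /wend /= rX /amplitude /= !mul1r -sqn_eq0 sqnR sqrf_eq0.
split.
  exists 1; apply: sums_below_ball => [w|n]; first exact: sqn_ge0.
  have hl : (fun k => \sum_(w <- walk_ball G r n) white_part (ty k).1 (ty k).2 (cn r k) r w)
     @ U --> \sum_(w <- walk_ball G r n) sqn (eta w).
    apply: cvg_bigsum => w _; rewrite /white_part /eta; case: ifP => _.
      by rewrite sqnM sqnR mulrC; apply: hwhite.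
    by rewrite sqn0; apply: cvg_cst.
  have h1 : (fun _ : nat => 1 : R) @ U --> (1 : R) by exact: cvg_cst.
  apply: (ler_cvg_to hl h1); apply: nearW => k.
  apply: le_trans (cn1 r k).
  exact: (white_sum (e0 k) (hty k) rX erefl n).
have step w e : walk_from G r w -> ext G r w e -> e \in D ->
    eta (rcons w e) = rho e * eta w.
  move=> hw he eD; have := eD; rewrite innerE => /andP[eJ tX].
  have sX : wend G r w \in X by move: eJ he; rewrite inE => /andP[_ sX] /andP[/eqP <-].
  have := defect w e hw he eJ.
  (* The midpoint of an inner edge has no further edge than [rev G e], so the condition reads
     [m (rev G e) * zl e (rev G e) = 1] and the amplitude is multiplied by [rho e]. *)
  rewrite (big_pred1 (rev G e)); last first.
    move=> k; have [kJ|kJ] := boolP (k \in J).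
      rewrite (constraint_of_inner eD kJ) /=; case: (eqVneq k e) => //= ->.
      by rewrite eq_sym (negbTE (rev_neq G e)).
    apply/esym/negbTE; apply: contraNneq kJ => ->.
    by apply: rev_branch => //; move: eJ; rewrite inE => /andP[].
  move=> h; rewrite /eta wend_rcons tX sX amplitude_rcons /phase /ratio tX.
  have := eJ; rewrite inE => /andP[-> ->].
  move: h; rewrite rmorphB rmorph1 rmorphM /= mulrBr mulr1 => /eqP; rewrite subr_eq0 => /eqP h.
  by rewrite [in RHS]h; ring.
move=> w hw; have [uX|uX] := boolP (wend G r w \in X).
  have -> : (lam - b (wend G r w))%:C%C =
      \sum_(e in D | src G e == wend G r w) conjc (a e) * rho e.
    by case: hbal => _ -> .
  rewrite [RHS](bigID (mem D)) /= [X in _ = _ + X]big1 ?addr0.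
    rewrite mulr_suml; apply: eq_big => e; first by rewrite andbC.
    move=> /andP[eD /eqP eu]; rewrite -mulrA; congr (_ * _).
    have [he|he] := boolP (ext G r w e).
      by rewrite (wact_ext he) step.
    case/lastP: w hw uX eu he => [|p f] hw uX eu he.
      by move: he; rewrite /ext eu eqxx.
    have te : src G e = tgt G f by rewrite eu wend_rcons.
    move: he; rewrite ext_rcons te eqxx /= negbK => /eqP ef.
    rewrite wact_rcons ef eqxx.
    have := hw; rewrite walk_rcons => /andP[hpw hf].
    have fD : rev G e \in D by rewrite inner_rev //; apply: supp_sym.
    rewrite ef in hf *; rewrite (step _ _ hpw hf fD) mulrA.
    by have [_ ->] := hrho1 eD; rewrite mul1r.
  move=> e /andP[/eqP eu]; rewrite !inE eu uX => eD.
  have [->|ae] := eqVneq (a e) 0; first by rewrite conjc0 mul0r.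
  move: eD; rewrite ae /= => /negbTE tX.
  by rewrite /eta wend_wact // tX mulr0.
rewrite {1}/eta (negbTE uX) mulr0.
case/lastP: w hw uX => [|p g] hw; first by rewrite /wend /= rX.
rewrite wend_rcons => tX; rewrite (sum_wact_rcons ha _ hw).
have := hw; rewrite walk_rcons => /andP[hpw hg].
have sg : src G g = wend G r p by case/andP: hg => /eqP.
have zero : amplitude zl (rcons p g) = 0 -> \sum_(e | ext G r (rcons p g) e)
   conjc (a e) * eta (rcons (rcons p g) e) = 0.
  move=> am0; apply: big1 => e _; rewrite /eta amplitude_rcons am0 !mul0r.
  by rewrite if_same mulr0.
have [gF|gF] := boolP (g \in supp); last first.
  rewrite zero ?addr0; last by rewrite amplitude_rcons /phase (negbTE gF) mul0r mulr0.
  by move: gF; rewrite inE negbK => /eqP ->; rewrite mul0r.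
have [sX|sX] := boolP (src G g \in X); last first.
  rewrite zero ?addr0; last first.
    by rewrite amplitude_rcons /phase gF (negbTE sX) (negbTE tX) mul0r mulr0.
  by rewrite /eta -sg (negbTE sX) mulr0.
have gJ : g \in J by rewrite inE gF.
have ampg : amplitude zl (rcons p g) = amplitude zl p.
  by rewrite amplitude_rcons /phase /ratio gF sX (negbTE tX) mul1r rmorph1 mulr1.
rewrite (bigID (fun e => rev G e \in J)) /= [X in _ + (_ + X)]big1 ?addr0; last first.
  move=> e /andP[he]; rewrite inE supp_sym // src_revE inE negb_and negbK.
  case/orP => [/eqP ->|eX]; first by rewrite conjc0 mul0r.
  by rewrite /eta wend_rcons (negbTE eX) mulr0.
have etap : eta p = amplitude zl p * (c r)%:C%C by rewrite /eta -sg sX.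
have child e : ext G r (rcons p g) e && (rev G e \in J) ->
    conjc (a e) * eta (rcons (rcons p g) e) =
    - (a g * eta p) * (m (rev G e) * zl g (rev G e))%:C%C.
  move=> /andP[he]; rewrite inE supp_sym // src_revE => /andP[eF eX].
  have se : src G e = tgt G g by move: he; rewrite ext_rcons => /andP[/eqP].
  have -> : m (rev G e) = sqn (a e).
    by rewrite /branch_weight tgt_revE se (negbTE tX) -ha sqn_conj.
  rewrite etap /eta wend_rcons eX amplitude_rcons ampg lasto_rcons /phase /ratio.
  rewrite eF eX se (negbTE tX) rmorphM /= sqnC.
  by ring.
rewrite (eq_bigr _ child) -mulr_sumr -[X in _ + _ * X]rmorph_sum /=.
have -> : \sum_(e | ext G r (rcons p g) e && (rev G e \in J)) m (rev G e) * zl g (rev G e)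
   = \sum_(k in J | (k != g) && (q k == q g)) m k * zl g k.
  rewrite [RHS](reindex_inj (can_inj (@Defs.revK _ _ G))) /=.
  apply: eq_bigl => f.
  rewrite ext_rcons constraint_of_cross // tgt_revE andbC; congr (_ && _).
  by rewrite andbC eq_sym.
have := defect p g hpw hg gJ; rewrite -etap rmorphB rmorph1 => h.
by rewrite mulNr -[X in X - _]mulr1 -mulrBr -mulrA h mulr0.
Qed.

End Sufficiency.

(** The vectors [xi] are dual, up to scaling, to the functionals in [S], which are therefore
    independent; the rows of [w] lie in their common kernel. *)
Lemma dim_count (F : fieldType) (V T : finType) (A : {set V}) (S : {set T}) (d : nat)
    (w : 'M[F]_(d, #|A|)) (k : V -> T -> F) : row_free w ->
  (forall s t, t \in S -> \sum_(i < #|A|) w s i * k (enum_val i) t = 0) ->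
  (forall t, t \in S -> exists2 xi : V -> F, \sum_(v in A) xi v * k v t != 0 &
     forall t', t' \in S -> t' != t -> \sum_(v in A) xi v * k v t' = 0) ->
  (d + #|S| <= #|A|)%N.
Proof.
move=> wfree wk hxi.
pose K : 'M[F]_(#|A|, #|S|) := \matrix_(i, j) k (enum_val i) (enum_val j).
have wK : w *m K = 0.
  apply/matrixP => s j; rewrite !mxE -[RHS](wk s (enum_val j)) ?enum_valP //.
  by apply: eq_bigr => i _; rewrite mxE.
have := mulmx0_rank_max wK; rewrite (eqP wfree).
suff /eqP -> : row_full K by [].
have /choice[xi hx] : forall j : 'I_#|S|, exists xi : V -> F,
    \sum_(v in A) xi v * k v (enum_val j) != 0 /\
    forall t', t' \in S -> t' != enum_val j -> \sum_(v in A) xi v * k v t' = 0.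
  by move=> j; have [xi h1 h2] := hxi _ (enum_valP j); exists xi.
apply/row_fullP.
exists (\matrix_(j, i) ((\sum_(v in A) xi j v * k v (enum_val j))^-1 * xi j (enum_val i))).
apply/matrixP => j j'; rewrite !mxE.
under eq_bigr do rewrite !mxE -mulrA.
rewrite -mulr_sumr -(big_enum_val (fun v => xi j v * k v (enum_val j'))) /=.
have [h1 h2] := hx j; have [<-|ne] := eqVneq j j'; first by rewrite mulVf.
rewrite (h2 (enum_val j')) ?mulr0 ?enum_valP //.
by apply: contraNneq ne => /enum_val_inj ->.
Qed.

(** * Kernels of finite Hermitian matrices on a forest *)

Section FiniteForest.
Variables (R : realType) (V E : finType) (G : graph V E).
Variables (a : E -> R[i]) (b : V -> R) (lam : R).
Hypothesis ha : hermitian_weights G a.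

Definition adj_entry (u v : V) : R[i] :=
  (if u == v then (b u)%:C%C else 0) +
  \sum_(e | (src G e == u) && (tgt G e == v)) conjc (a e).

Definition adj_matrix (X : {set V}) : 'M[R[i]]_#|X| :=
  \matrix_(i, j) adj_entry (enum_val i) (enum_val j).

Local Notation supp := (supp a).

Variable X : {set V}.
Local Notation D := (inner G supp X).

Definition restricted_kernel (psi : V -> R[i]) :=
  (forall v, v \notin X -> psi v = 0) /\
  (forall u, u \in X -> (lam - b u)%:C%C * psi u =
     \sum_(e | src G e == u) conjc (a e) * psi (tgt G e)).

Definition row_fun (w : 'rV[R[i]]_#|X|) (v : V) : R[i] :=
  \sum_(i < #|X|) w 0 i * (enum_val i == v)%:R.

Lemma row_fun_val w i : row_fun w (enum_val i) = w 0 i.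
Proof.
rewrite /row_fun (bigD1 i) //= eqxx mulr1 big1 ?addr0 // => j ji.
by rewrite (inj_eq enum_val_inj) (negbTE ji) mulr0.
Qed.

Lemma row_fun_out w v : v \notin X -> row_fun w v = 0.
Proof.
move=> vX; apply: big1 => i _; case: eqP => [iv|_]; last by rewrite mulr0.
by move: vX; rewrite -iv enum_valP.
Qed.

Lemma row_fun_mul w (i : 'I_#|X|) :
  (w *m (lam%:C%C%:M - adj_matrix X)^T) 0 i =
  (lam - b (enum_val i))%:C%C * row_fun w (enum_val i) -
    \sum_(e | src G e == enum_val i) conjc (a e) * row_fun w (tgt G e).
Proof.
set u := enum_val i; have uX : u \in X by apply: enum_valP.
transitivity (\sum_(v in X) row_fun w v * (lam%:C%C *+ (u == v) - adj_entry u v)).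
  rewrite mxE (big_enum_val (fun v => row_fun w v * ((lam%:C%C *+ (u == v)) - adj_entry u v))) /=.
  apply: eq_bigr => j _; rewrite !mxE row_fun_val; congr (_ * (_ *+ _ - _)).
  by rewrite -(inj_eq enum_val_inj).
under eq_bigr => v _ do rewrite /adj_entry opprD addrA mulrDr mulrN.
rewrite sumrB; congr (_ - _).
  rewrite (bigD1 u) //= eqxx -rmorphB mulrC big1 ?addr0 // => v /andP[_ vu].
  by rewrite eq_sym (negbTE vu) subrr mulr0.
rewrite [RHS](bigID (fun e => tgt G e \in X)) /= [X in _ = _ + X]big1 ?addr0; last first.
  by move=> e /andP[_ eX]; rewrite row_fun_out ?mulr0.
rewrite [RHS](partition_big (tgt G) (mem X)) /=; last by move=> e /andP[].
apply: eq_bigr => v vX; rewrite mulr_sumr; apply: eq_big => e.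
  by case: (eqVneq (tgt G e) v) => [->|_]; rewrite ?andbF // vX !andbT.
by move=> /andP[_ /eqP ->]; rewrite mulrC.
Qed.

Lemma row_fun_kernel w : w *m (lam%:C%C%:M - adj_matrix X)^T = 0 <->
  restricted_kernel (row_fun w).
Proof.
split=> [hw|[_ hw]].
  split=> [|u uX]; first exact: row_fun_out.
  have := row_fun_mul w (enum_rank_in uX u).
  by rewrite hw mxE enum_rankK_in // => /esym/eqP; rewrite subr_eq0 => /eqP.
by apply/rowP => i; rewrite row_fun_mul hw ?enum_valP // subrr mxE.
Qed.

Hypothesis hforest : forest G D.

Lemma forest_cut e : e \in D -> exists B : {set V}, [/\ src G e \in B, tgt G e \notin B
  & forall f, f \in D -> (src G f \in B) != (tgt G f \in B) -> f = e \/ f = rev G e].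
Proof.
move=> eD; have [B [h1 h2 h3]] := hforest eD; exists B; split => // f fD.
case: (boolP (src G f \in B)) => sB; case: (boolP (tgt G f \in B)) => tB //= _.
  by left; apply: h3.
right; rewrite -(h3 (rev G f)) ?Defs.revK ?src_revE ?tgt_revE //.
by rewrite inner_rev //; apply: supp_sym.
Qed.

Lemma kernel_edge_sum (psi phi : V -> R[i]) (B : {set V}) :
  restricted_kernel psi -> restricted_kernel phi ->
  \sum_(x in B) conjc (psi x) * ((lam - b x)%:C%C * phi x) =
  \sum_(e in D | src G e \in B) conjc (psi (src G e)) * (conjc (a e) * phi (tgt G e)).
Proof.
move=> [psi0 _] [phi0 hphi].
rewrite (bigID (mem X)) /= [X in _ + X]big1 ?addr0; last first.
  by move=> x /andP[_ xX]; rewrite psi0 // conjc0 mul0r.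
under eq_bigr => x /andP[_ xX] do rewrite hphi // mulr_sumr.
rewrite [RHS](partition_big (src G) (fun x => (x \in B) && (x \in X))) /=; last first.
  by move=> e; rewrite !inE => /andP[/and3P[_ -> _] ->].
apply: eq_bigr => x /andP[xB xX]; rewrite [LHS](bigID (mem D)) /= [X in _ + X]big1 ?addr0.
  apply: eq_big => e; last by move=> /andP[/eqP ->].
  by case: (eqVneq (src G e) x) => [->|_]; rewrite ?andbF // xB !andbT.
move=> e /andP[/eqP ex]; rewrite !inE ex xX /= negb_and negbK => /orP[/eqP ->|eX].
  by rewrite conjc0 mul0r mulr0.
by rewrite phi0 // !mulr0.
Qed.

(** The Hermitian form summed over the side [B] of the bridge [e] is symmetric except for the flux
    through [e], the only inner edge leaving [B]. *)
Lemma finite_wronskian e psi phi : e \in D -> restricted_kernel psi ->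
  restricted_kernel phi ->
  conjc (a e) * phi (tgt G e) * conjc (psi (src G e)) =
  a e * phi (src G e) * conjc (psi (tgt G e)).
Proof.
move=> eD hpsi hphi; have [B [sB tB hB]] := hforest eD.
have h1 := kernel_edge_sum B hpsi hphi.
have := congr1 conjc (kernel_edge_sum B hphi hpsi); rewrite !conj_sum.
have -> : \sum_(x in B) conjc (conjc (phi x) * ((lam - b x)%:C%C * psi x)) =
  \sum_(x in B) conjc (psi x) * ((lam - b x)%:C%C * phi x).
  by apply: eq_bigr => x _; rewrite !conjM conjcK conj_real; ring.
rewrite h1 => {}h1; move: h1.
rewrite [LHS](bigID (fun f => tgt G f \in B)) [RHS](bigID (fun f => tgt G f \in B)) /=.
have e1 (F : E -> R[i]) :
    \sum_(f in D | (src G f \in B) && (tgt G f \notin B)) F f = F e.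
  rewrite (big_pred1 e) // => f; apply/idP/eqP => [/and3P[fD fs ft]|->].
    exact: hB.
  by rewrite eD sB tB.
have e2 (F : E -> R[i]) : \sum_(f | (f \in D) && (src G f \in B) && (tgt G f \notin B)) F f = F e.
  by rewrite -e1; apply: eq_bigl => f; rewrite andbA.
rewrite !e2.
have -> : \sum_(f | (f \in D) && (src G f \in B) && (tgt G f \in B))
    conjc (psi (src G f)) * (conjc (a f) * phi (tgt G f)) =
  \sum_(f | (f \in D) && (src G f \in B) && (tgt G f \in B))
    conjc (conjc (phi (src G f)) * (conjc (a f) * psi (tgt G f))).
  rewrite (reindex_inj (can_inj (@Defs.revK _ _ G))) /=.
  have hD f : (rev G f \in D) = (f \in D) by rewrite inner_rev //; apply: supp_sym.
  apply: eq_big => f; rewrite ?hD src_revE tgt_revE.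
    by rewrite -!andbA; congr (_ && _); rewrite andbC.
  by move=> _; rewrite !conjM !conjcK rev_weight //; ring.
move=> /addrI; rewrite !conjM !conjcK => h.
by rewrite mulrC h; ring.
Qed.

Definition kernel_support : {set V} :=
  [set v | `[< exists2 psi, restricted_kernel psi & psi v != 0 >]].

Local Notation X' := kernel_support.

Lemma kernel_supportP v :
  reflect (exists2 psi, restricted_kernel psi & psi v != 0) (v \in X').
Proof. by rewrite inE; apply: asboolP. Qed.

Lemma kernel_support_sub v : v \in X' -> v \in X.
Proof.
by move/kernel_supportP => [psi [h _]]; apply: contraNT => /h ->.
Qed.

Lemma kernel_support_out psi v : restricted_kernel psi -> v \notin X' -> psi v = 0.
Proof.
by move=> h; apply: contraNeq => nz; apply/kernel_supportP; exists psi.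
Qed.

Lemma inner_kernel_sub e : e \in inner G supp X' -> e \in D.
Proof.
rewrite inE => /and3P[h1 /kernel_support_sub h2 /kernel_support_sub h3].
by rewrite inE h1 h2.
Qed.

Lemma kernel_ratio_exists e : exists rho : R[i], e \in inner G supp X' ->
  rho != 0 /\ forall psi, restricted_kernel psi -> psi (tgt G e) = rho * psi (src G e).
Proof.
have [eD|nD] := boolP (e \in inner G supp X'); last by exists 0.
have eD0 := inner_kernel_sub eD.
move: eD; rewrite !inE => /and3P[ae /asboolP[theta ht nz] /asboolP[xi hx nz']].
have cae : conjc (a e) != 0 by rewrite conjc_eq0.
have nzc : conjc (theta (src G e)) != 0 by rewrite conjc_eq0.
pose rho := a e * conjc (theta (tgt G e)) / (conjc (a e) * conjc (theta (src G e))).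
have hrho psi : restricted_kernel psi -> psi (tgt G e) = rho * psi (src G e).
  move=> he; have := finite_wronskian eD0 ht he; rewrite /rho => h.
  apply: (mulfI cae); apply: (mulIf nzc); rewrite h.
  by field; rewrite ?cae ?nzc.
exists rho => _; split => //.
by apply: contraNneq nz' => r0; rewrite (hrho _ hx) r0 mul0r.
Qed.

(** Seen on its support, the kernel satisfies one condition for each boundary vertex of the support
    inside [X] and one for each inner edge of the support; the forest makes these conditions
    independent. *)
Lemma kernel_dim_le rho : (forall e, e \in inner G supp X' ->
    rho e != 0 /\ forall psi, restricted_kernel psi -> psi (tgt G e) = rho e * psi (src G e)) ->
  (#|X| - \rank (lam%:C%C%:M - adj_matrix X)%R +
    (#|outer G supp X' :&: X| + #|mid G @: inner G supp X'|) <= #|X'|)%N.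
Proof.
move=> hrho.
pose M := (lam%:C%C%:M - adj_matrix X)^T.
pose W := row_base (kermx M).
have hWM : W *m M = 0 by apply/sub_kermxP; rewrite eq_row_base.
have hW s : restricted_kernel (row_fun (row s W)).
  by apply/row_fun_kernel; rewrite -row_mul hWM row0.
pose w : 'M[R[i]]_(_, #|X'|) := \matrix_(s, i) row_fun (row s W) (enum_val i).
have wfree : row_free w.
  apply: inj_row_free => c cw; apply: (row_free_inj (row_base_free (kermx M))).
  rewrite mul0mx; apply/rowP => i; rewrite !mxE.
  have [iX|iX] := boolP (enum_val i \in X').
    pose j := enum_rank_in iX (enum_val i).
    have ij : enum_val j = enum_val i by rewrite enum_rankK_in.
    have := congr1 (fun z : 'rV_#|X'| => z 0 j) cw; rewrite !mxE => h; rewrite -[RHS]h.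
    by apply: eq_bigr => s _; rewrite [w s j]mxE ij row_fun_val [row s W _ _]mxE.
  apply: big1 => s _; have := kernel_support_out (hW s) iX.
  by rewrite row_fun_val mxE => ->; rewrite mulr0.
pose S : {set V + E} := (inl @: (outer G supp X' :&: X) :|: inr @: (mid G @: inner G supp X'))%SET.
pose k (v : V) (t : V + E) : R[i] := match t with
  | inl x => \sum_(e | (src G e == x) && (tgt G e == v)) conjc (a e)
  | inr e => (v == tgt G e)%:R - rho e * (v == src G e)%:R end.
have kl xi x : \sum_(v in X') xi v * k v (inl x) =
    \sum_(e | (src G e == x) && (tgt G e \in X')) conjc (a e) * xi (tgt G e).
  rewrite [RHS](partition_big (tgt G) (mem X')) /=; last by move=> e /andP[].
  apply: eq_bigr => v vX; rewrite mulr_sumr; apply: eq_big => e.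
    by case: (eqVneq (tgt G e) v) => [->|_]; rewrite ?andbF // vX !andbT.
  by move=> /andP[_ /eqP ->]; rewrite mulrC.
have pick (xi : V -> R[i]) u : u \in X' -> \sum_(v in X') xi v * (v == u)%:R = xi u.
  move=> uX; rewrite (bigD1 u) //= eqxx mulr1 big1 ?addr0 // => v /andP[_ /negbTE ->].
  by rewrite mulr0.
have kr xi e : e \in inner G supp X' ->
    \sum_(v in X') xi v * k v (inr e) = xi (tgt G e) - rho e * xi (src G e).
  rewrite inE => /and3P[_ h1 h2].
  under eq_bigr => v _ do rewrite /k mulrBr mulrCA.
  by rewrite sumrB -mulr_sumr !pick.
have midin e : e \in inner G supp X' -> mid G e \in inner G supp X'.
  by move=> eD; case: (mid_or G e) => ->; rewrite ?inner_rev //; apply: supp_sym.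
have psil psi x : restricted_kernel psi -> x \in X -> x \notin X' ->
    \sum_(e | (src G e == x) && (tgt G e \in X')) conjc (a e) * psi (tgt G e) = 0.
  move=> hp xX xX'; have := hp.2 x xX; rewrite (kernel_support_out hp xX') mulr0 => h; rewrite [RHS]h.
  rewrite [RHS](bigID (fun e => tgt G e \in X')) /= [X in _ = _ + X]big1 ?addr0 //.
  by move=> e /andP[_ eX]; rewrite (kernel_support_out hp eX) mulr0.
have -> : (#|outer G supp X' :&: X| + #|mid G @: inner G supp X'| = #|S|)%N.
  have i1 : injective (@inl V E) by move=> ? ? [].
  have i2 : injective (@inr V E) by move=> ? ? [].
  rewrite /S cardsU (card_imset _ i1) (card_imset _ i2).
  suff -> : (inl @: (outer G supp X' :&: X) :&: inr @: (mid G @: inner G supp X') = finset.set0 :> {set V + E})%SET.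
    by rewrite cards0 subn0.
  apply/setP => x; rewrite !inE; apply/negP => /andP[/imsetP[v _ ->] /imsetP[e _]].
  by [].
have -> : (#|X| - \rank (lam%:C%C%:M - adj_matrix X)%R = \rank (kermx M))%N.
  by rewrite mxrank_ker mxrank_tr.
apply: (dim_count wfree (k := k)) => [s t|t].
  under eq_bigr do rewrite mxE.
  rewrite -(big_enum_val (fun v => row_fun (row s W) v * k v t)) /=.
  rewrite inE => /orP[/imsetP[x xS]|/imsetP[e /imsetP[f fD ->]]] ->.
    rewrite kl; move: xS; rewrite !inE => /andP[/andP[xX' _] xX].
    by apply: psil => //; rewrite inE.
  by rewrite kr ?midin // (hrho _ (midin _ fD)).2 ?subrr.
(* cutting a kernel function along a bridge violates a single constraint *)
have cut psi (B : {set V}) (e : E) x : restricted_kernel psi -> x \in X -> x \notin X' ->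
  (forall f, f \in D -> (src G f \in B) != (tgt G f \in B) -> f = e \/ f = rev G e) ->
  x != src G e -> x != tgt G e ->
  \sum_(v in X') (if v \in B then psi v else 0) * k v (inl x) = 0.
  move=> hp xX xX' hB xs xt; rewrite kl.
  have [xB|xB] := boolP (x \in B).
    rewrite -[RHS](psil psi x hp xX xX'); apply: eq_bigr => f /andP[/eqP fx fX].
    case: ifP => // fB; have [->|af] := eqVneq (a f) 0; first by rewrite conjc0 !mul0r.
    have fD : f \in D by rewrite !inE af fx xX kernel_support_sub.
    have [|fe|fe] := hB f fD; first by rewrite fx xB fB.
      by move: xs; rewrite -fx fe eqxx.
    by move: xt; rewrite -fx fe src_revE eqxx.
  apply: big1 => f /andP[/eqP fx fX].
  case: ifP => // fB; last by rewrite mulr0.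
  have [->|af] := eqVneq (a f) 0; first by rewrite conjc0 !mul0r.
  have fD : f \in D by rewrite !inE af fx xX kernel_support_sub.
  have [|fe|fe] := hB f fD; first by rewrite fx (negbTE xB) fB.
    by move: xs; rewrite -fx fe eqxx.
  by move: xt; rewrite -fx fe src_revE eqxx.
have cutr psi (B : {set V}) (e : E) f : restricted_kernel psi -> f \in inner G supp X' ->
  (forall f, f \in D -> (src G f \in B) != (tgt G f \in B) -> f = e \/ f = rev G e) ->
  f != e -> f != rev G e ->
  \sum_(v in X') (if v \in B then psi v else 0) * k v (inr f) = 0.
  move=> hp fD hB fe fe'; rewrite kr //.
  have [eq|ne] := eqVneq (src G f \in B) (tgt G f \in B).
    by rewrite eq; case: ifP => _; rewrite ?(hrho _ fD).2 // ?mulr0 subrr.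
  have [h|h] := hB f (inner_kernel_sub fD) ne; first by rewrite h eqxx in fe.
  by rewrite h eqxx in fe'.
rewrite inE => /orP[/imsetP[x xS]|/imsetP[e' /imsetP[f fD ->]]] ->.
  move: xS; rewrite finset.in_setI => /andP[xO xX].
  move: xO; rewrite inE => /andP[xnX /existsP[e /and3P[ae /eqP ex tX']]].
  have eD : e \in D by rewrite inE ae ex xX kernel_support_sub.
  have eD' : rev G e \in D by rewrite inner_rev //; apply: supp_sym.
  have [B [sB tB hB]] := forest_cut eD'; rewrite src_revE tgt_revE ex in sB tB.
  have [psi hp nz] := kernel_supportP _ tX'.
  pose xi v := if v \in B then psi v else 0.
  exists xi.
    rewrite kl (bigD1 e) /=; last by rewrite ex eqxx.
    rewrite big1 ?addr0 => [|f /andP[/andP[/eqP fx fX] fe]].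
      by rewrite /xi sB mulf_neq0 // conjc_eq0; move: ae; rewrite inE.
    have [->|af] := eqVneq (a f) 0; first by rewrite conjc0 mul0r.
    rewrite /xi; case: ifP => fB; last by rewrite mulr0.
    have fD : f \in D by rewrite inE inE af fx xX kernel_support_sub.
    have [|f1|f1] := hB f fD; first by rewrite fx (negbTE tB) fB.
      by move: xnX; rewrite -fx f1 src_revE tX'.
    by move: fe; rewrite f1 Defs.revK eqxx.
  move=> t'; rewrite inE => /orP[/imsetP[z zS]|/imsetP[h' /imsetP[h hD ->]]] ->.
    move: zS; rewrite finset.in_setI => /andP[zO zX] ne.
    have zX' : z \notin X' by move: zO; rewrite inE => /andP[].
    apply: (cut _ _ _ _ hp zX zX' hB); rewrite ?src_revE ?tgt_revE ?ex.
      by apply: contraNneq zX' => ->.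
    by apply: contraNneq ne => ->.
  move=> _; have mD := midin _ hD.
  have := mD; rewrite inE => /and3P[_ m1 m2].
  apply: (cutr _ _ _ _ hp mD hB); apply: contraNneq xnX; last rewrite Defs.revK.
    by move=> eq; rewrite -ex -(tgt_revE G e) -eq.
  by move=> eq; rewrite -ex -eq.
have := midin _ fD; set g := mid G f => gD.
have gX : src G g \in X' by move: gD; rewrite inE => /and3P[].
have [psi hp nz] := kernel_supportP _ gX.
have [B [sB tB hB]] := forest_cut (inner_kernel_sub gD).
exists (fun v => if v \in B then psi v else 0).
  rewrite kr // sB (negbTE tB) sub0r oppr_eq0 mulf_neq0 //.
  by case: (hrho _ gD).
move=> t'; rewrite inE => /orP[/imsetP[x xS]|/imsetP[e /imsetP[h hD ->]]] ->.
  move: xS; rewrite finset.in_setI => /andP[]; rewrite inE => /andP[xX' _] xX _.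
  apply: (cut _ _ _ _ hp xX xX' hB); apply: contraNneq xX' => -> //.
  by move: gD; rewrite inE => /and3P[].
move=> ne; apply: (cutr _ _ _ _ hp (midin _ hD) hB).
  by apply: contraNneq ne => ->.
apply: contraNneq ne => eq; apply/eqP; congr inr.
have := congr1 (mid G) eq; rewrite mid_rev /g.
have mm (z : E) : mid G (mid G z) = mid G z.
  by case: (mid_or G z) => {1}->; rewrite ?mid_rev.
by rewrite !mm.
Qed.

(** [X] is shrunk to the support of the kernel. A boundary vertex of the smaller set either is one
    of [X], covered by the assumed inequality, or lies in [X] and is counted in [kernel_dim_le]. *)
Lemma kernel_balanced : (\rank (lam%:C%C%:M - adj_matrix X)%R + #|outer G supp X| < #|X|)%N ->
  exists rho, balanced G a b lam X' rho.
Proof.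
move=> hr; have /choice[rho hrho] := kernel_ratio_exists.
have hdim := kernel_dim_le hrho.
exists rho; split.
- move=> e eD; have [h1 h2] := hrho _ eD; split => //.
  have eD' : rev G e \in inner G supp X' by rewrite inner_rev //; apply: supp_sym.
  have [_ h3] := hrho _ eD'; rewrite src_revE tgt_revE in h3.
  have /kernel_supportP[psi hp nz] : src G e \in X' by move: eD; rewrite inE => /and3P[].
  by apply: (mulIf nz); rewrite mul1r mulrAC -h2 // mulrC -h3.
- move=> u uX; have /kernel_supportP[psi hp nz] := uX.
  apply: (mulIf nz); rewrite hp.2 ?kernel_support_sub //.
  rewrite (bigID (mem (inner G supp X'))) /= [X in _ + X]big1 ?addr0.
    rewrite mulr_suml; apply: eq_big => e; first by rewrite andbC.
    by move=> /andP[/eqP eu eD]; rewrite -mulrA -eu (hrho _ eD).2.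
  move=> e /andP[/eqP eu]; rewrite inE eu uX inE /= negb_and negbK => /orP[/eqP ->|eX].
    by rewrite conjc0 mul0r.
  by rewrite (kernel_support_out hp eX) mulr0.
rewrite card_constraints.
have hout : (#|outer G supp X'| <= #|outer G supp X| + #|outer G supp X' :&: X|)%N.
  rewrite -(cardsID X (outer G supp X')) addnC leq_add2r.
  apply: subset_leq_card; apply/fintype.subsetP => v.
  rewrite finset.in_setD => /andP[vX vO].
  move: vO; rewrite inE => /andP[_ /existsP[e /and3P[h1 h2 h3]]].
  rewrite inE vX /=; apply/existsP; exists e.
  by rewrite h1 h2 kernel_support_sub.
have := rank_leq_row (lam%:C%C%:M - adj_matrix X).
move: hr hdim hout; set r := \rank _; set x := #|X|; set o := #|outer G supp X|.
lia.
Qed.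
End FiniteForest.

(** * Rank criterion for point spectrum *)

Section Criterion.
Variables (R : realType) (V E : finType) (G : graph V E).
Variables (a : E -> R[i]) (b : V -> R).
Hypothesis ha : hermitian_weights G a.

Definition kernel_excess (lam : R) (F : {set E}) (X : {set V}) :=
  (\rank (lam%:C%C%:M - adj_matrix G a b X)%R + #|outer G F X| < #|X|)%N.

Local Notation supp := (supp a).

(** Functions on [X] with ratio [rho] along inner edges form a space of dimension at least [#|X|]
    minus the number of inner edges up to reversal, and balance puts them in the kernel of
    [lam - A_X]. *)
Lemma balanced_excess lam X rho :
  balanced G a b lam X rho -> kernel_excess lam supp X.
Proof.
case=> hrho hbal; rewrite card_constraints /kernel_excess => hc.
pose S := mid G @: inner G supp X.
pose K : 'M[R[i]]_(#|X|, #|S|) := \matrix_(i, j)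
  ((enum_val i == tgt G (enum_val j))%:R - rho (enum_val j) * (enum_val i == src G (enum_val j))%:R).
have KM : kermx K *m (lam%:C%C%:M - adj_matrix G a b X)^T = 0.
  apply/row_matrixP => s; rewrite row_mul row0; apply/row_fun_kernel.
  set psi := row_fun _.
  have hin e : e \in inner G supp X -> psi (tgt G e) = rho e * psi (src G e).
    have gen f : f \in S -> psi (tgt G f) = rho f * psi (src G f).
      move=> fS; pose j := enum_rank_in fS f.
      have h : \sum_i kermx K s i * K i j = 0.
        have := congr1 (fun M : 'M[R[i]]_(#|X|, #|S|) => M s j) (mulmx_ker K).
        by rewrite [LHS]mxE [RHS]mxE.
      apply/eqP; rewrite -subr_eq0 -[X in _ == X]h; apply/eqP.
      rewrite /psi /row_fun mulr_sumr -sumrB; apply: eq_bigr => i _.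
      rewrite [K _ _]mxE enum_rankK_in // [row _ _ _ _]mxE mulrBr; congr (_ - _).
      by rewrite mulrCA.
    move=> eD; have := gen (mid G e); rewrite imset_f // => /(_ isT).
    case: (mid_or G e) => -> //; rewrite src_revE tgt_revE => ->.
    by rewrite mulrA (hrho _ eD).2 mul1r.
  split=> [v|u uX]; first exact: row_fun_out.
  rewrite hbal // mulr_suml [RHS](bigID (mem (inner G supp X))) /= [X in _ = _ + X]big1 ?addr0.
    apply: eq_big => e; first by rewrite andbC.
    by move=> /andP[eD /eqP eu]; rewrite -mulrA -eu hin.
  move=> e /andP[/eqP eu]; rewrite inE eu uX inE /= negb_and negbK => /orP[/eqP ->|eX].
    by rewrite conjc0 mul0r.
  by rewrite /psi row_fun_out ?mulr0.
have := mulmx0_rank_max KM; rewrite mxrank_ker mxrank_tr.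
have := rank_leq_col K; have := rank_leq_row K.
move: hc; rewrite -/S; set r := \rank _; set k := \rank K.
lia.
Qed.

Lemma forest_sub (D D' : {set E}) : {subset D' <= D} -> forest G D -> forest G D'.
Proof.
move=> sD h e /sD eD; have [B [h1 h2 h3]] := h e eD.
by exists B; split => // f /sD; apply: h3.
Qed.

(** From left to right [F] is the support. Conversely a larger [F] only has more inner edges and
    more boundary vertices, so that both conditions pass to the support. *)
Lemma point_spectrum_criterion (r : V) : connected_graph G ->
  point_spectrum (universal_cover G r) (a \o @cover_mapE V E G r)
    (b \o @cover_mapV V E G r) !=set0 <->
  exists (F : {set E}) (X : {set V}), [/\ sym_edges G F, forest G (inner G F X),
    (forall e, e \notin F -> a e = 0) & exists lam, kernel_excess lam F X].
Proof.
move=> hconn; split=> [[lam /(cover_point_spectrum b r ha)[eta [w [he hw nz]]]]|].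
  have [X [rho [hf hb]]] := eigen_balanced ha he hw nz.
  exists supp, X; split => //; first exact: supp_sym.
    by move=> e; rewrite inE negbK => /eqP.
  by exists lam; apply: balanced_excess hb.
move=> [F [X [hF hf aF [lam hr]]]].
have sF : {subset supp <= F}.
  by move=> e; rewrite inE; apply: contraNT => /aF ->.
have hf' : forest G (inner G supp X).
  apply: forest_sub hf => e; rewrite inE => /andP[/sF h1 h2].
  by rewrite inE h1.
have hr' : kernel_excess lam supp X.
  apply: leq_ltn_trans hr; rewrite leq_add2l; apply: subset_leq_card.
  apply/fintype.subsetP => v; rewrite inE => /andP[vX /existsP[e /andP[/sF h1 h2]]].
  by rewrite inE vX /=; apply/existsP; exists e; rewrite h1.
have [rho hb] := kernel_balanced ha hf' hr'.
have [u [eta [he nz]]] := balanced_eigenfun ha hb.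
exists lam; apply/(cover_point_spectrum b r ha).
have H := @eigen_connected _ _ _ _ a b lam u r hconn; apply: H; exists eta, [::]; split. exact: he. exact: walk_nil. exact: nz.
Qed.

End Criterion.

(** * Coordinates of the parameters *)

Section ParameterSpace.
Variables (R : realType) (V E : finType) (G : graph V E) (O : {set E}).
Hypothesis hO : orientation G O.

Local Notation N := (#|E| + #|V|)%N.

Definition edge_coord (e : E) : 'I_N := lshift _ (enum_rank e).
Definition vertex_coord (v : V) : 'I_N := rshift _ (enum_rank v).

Definition weight_of (x : 'rV[R]_N) (e : E) : R[i] :=
  if e \in O then Complex (x 0 (edge_coord e)) (x 0 (edge_coord (rev G e)))
  else Complex (x 0 (edge_coord (rev G e))) (- x 0 (edge_coord e)).

Definition potential_of (x : 'rV[R]_N) (v : V) : R := x 0 (vertex_coord v).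

Lemma weight_of_hermitian x : hermitian_weights G (weight_of x).
Proof.
move=> e; rewrite /weight_of hO Defs.revK; case: ifP => //= _.
by rewrite opprK.
Qed.

Lemma param_point_of x : param_point G O (weight_of x) (potential_of x) = x.
Proof.
apply/rowP => i; rewrite mxE; case: splitP => j ij; rewrite mxE.
  have -> : i = edge_coord (enum_val j).
    by apply: val_inj; rewrite /= enum_valK.
  by rewrite /weight_of hO Defs.revK /=; case: ifP => h; rewrite ?h.
have -> : i = vertex_coord (enum_val j).
  by apply: val_inj; rewrite /= enum_valK.
by [].
Qed.

Lemma of_param_point a b : hermitian_weights G a ->
  weight_of (param_point G O a b) = a /\ potential_of (param_point G O a b) = b.
Proof.
move=> ha; split; apply/funext => z.
  rewrite /weight_of /edge_coord !row_mxEl !mxE /= !enum_rankK hO Defs.revK.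
  case: (boolP (z \in O)) => zO /=; first by case: (a z).
  by rewrite -(ha z) /=; case: (a z) => u v /=; rewrite opprK.
by rewrite /potential_of /vertex_coord row_mxEr mxE enum_rankK.
Qed.

Lemma weight_of_eq0 x e :
  (weight_of x e == 0) = (x 0 (edge_coord e) == 0) && (x 0 (edge_coord (rev G e)) == 0).
Proof.
rewrite /weight_of; case: ifP => _; rewrite eq_complex /= ?oppr_eq0 //.
exact: andbC.
Qed.

Definition excess_set (F : {set E}) (X : {set V}) : set 'rV[R]_N :=
  [set x | (forall e, e \notin F -> weight_of x e = 0) /\
    exists lam, kernel_excess G (weight_of x) (potential_of x) lam F X].

Lemma point_spectrum_paramsE (r : V) : connected_graph G ->
  point_spectrum_params G O r = [set x | exists (F : {set E}) (X : {set V}),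
    [/\ sym_edges G F, forest G (inner G F X) & excess_set F X x]].
Proof.
move=> hconn; apply/seteqP; split => x /=.
  move=> [a [b [ha hs ->]]]; have [h1 h2] := of_param_point b ha.
  have [F [X [q1 q2 q3 q4]]] := (point_spectrum_criterion b ha r hconn).1 hs.
  by exists F, X; split => //; split; rewrite ?h1 ?h2.
move=> [F [X [q1 q2 [q3 q4]]]]; exists (weight_of x), (potential_of x); split.
- exact: weight_of_hermitian.
- apply/(point_spectrum_criterion _ (weight_of_hermitian x) r hconn).
  by exists F, X; split.
- by rewrite param_point_of.
Qed.

End ParameterSpace.

(** * Eigenvalue multiplicity as a polynomial condition *)

Section Multiplicity.

Lemma rank_diag_mx (F : fieldType) n (d : 'rV[F]_n) :
  \rank (diag_mx d) = #|[set i | d 0 i != 0]%SET|.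
Proof.
set S := [set i | d 0 i != 0]%SET.
pose U : 'M[F]_(n, #|S|) := \matrix_(i, j) (i == enum_val j)%:R.
pose dS : 'rV[F]_#|S| := \row_j d 0 (enum_val j).
have pick (f : 'I_n -> F) (j : 'I_#|S|) : \sum_i f i * (i == enum_val j)%:R = f (enum_val j).
  rewrite (bigD1 (enum_val j)) //= eqxx mulr1 big1 ?addr0 // => i /negbTE ->.
  by rewrite mulr0.
have ev (i j : 'I_#|S|) : (enum_val i == enum_val j) = (i == j).
  by apply/eqP/eqP => [/enum_val_inj|->].
have dU : diag_mx d *m U = \matrix_(i, j) (d 0 i * (i == enum_val j)%:R).
  apply/matrixP => i j; rewrite !mxE (bigD1 i) //= !mxE eqxx mulr1n big1 ?addr0 // => k.
  by rewrite !mxE eq_sym => /negbTE ->; rewrite mulr0n mul0r.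
have UdU : U^T *m (diag_mx d *m U) = diag_mx dS.
  rewrite dU; apply/matrixP => i j; rewrite !mxE.
  under eq_bigr do rewrite !mxE mulrA.
  rewrite pick mulrC ev eq_sym.
  by case: eqVneq => [->|_]; rewrite ?mulr1 ?mulr0 ?mulr1n ?mulr0n.
have dE : diag_mx d = (diag_mx d *m U) *m U^T.
  apply/matrixP => i j; rewrite dU !mxE.
  under eq_bigr do rewrite !mxE.
  have [iS|iS] := boolP (i \in S).
    pose k := enum_rank_in iS i.
    have ki : enum_val k = i by rewrite enum_rankK_in.
    rewrite (bigD1 k) //= ki eqxx mulr1 [j == i]eq_sym big1 ?addr0.
      by case: eqVneq; rewrite ?mulr1 ?mulr0 ?mulr1n ?mulr0n.
    move=> k' kk'; have -> : (i == enum_val k') = false.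
      by rewrite -[X in X == _]ki ev eq_sym (negbTE kk').
    by rewrite mulr0 mul0r.
  have d0 : d 0 i = 0 by move: iS; rewrite inE negbK => /eqP.
  by rewrite d0 mul0rn big1 // => k _; rewrite !mul0r.
apply/eqP; rewrite eqn_leq; apply/andP; split.
  by rewrite dE; apply: leq_trans (mxrankM_maxr _ _) (rank_leq_row _).
have <- : \rank (diag_mx dS) = #|S|.
  apply/eqP; rewrite -[_ == _]/(row_free _) row_free_unit unitmxE det_diag unitfE.
  apply/prodf_neq0 => j _; rewrite mxE.
  by have := enum_valP j; rewrite inE.
rewrite -UdU; apply: leq_trans (mxrankM_maxr _ _) (mxrankM_maxl _ _).
Qed.

Lemma derivn_root_power (F : numFieldType) (lam : F) (c : nat) (q : {poly F}) :
  q.[lam] != 0 ->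
  (forall j, (j < c)%N -> ((('X - lam%:P) ^+ c * q)^`(j)).[lam] = 0) /\
  ((('X - lam%:P) ^+ c * q)^`(c)).[lam] != 0.
Proof.
elim: c q => [|c IH] q hq; first by rewrite expr0 mul1r derivn0.
have dq : (('X - lam%:P) ^+ c.+1 * q)^`() =
    ('X - lam%:P) ^+ c * (q *+ c.+1 + ('X - lam%:P) * q^`()).
  rewrite derivM deriv_exp derivXsubC mul1r /= mulrDr mulrnAl mulrnAr.
  by rewrite exprSr mulrA.
have [|h1 h2] := IH (q *+ c.+1 + ('X - lam%:P) * q^`()).
  by rewrite !hornerE subrr mul0r addr0 hornerMn mulrn_eq0.
split=> [[|j]|].
- by rewrite derivn0 !hornerE subrr expr0n mul0r.
- by rewrite ltnS => /h1; rewrite derivSn dq.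
- by rewrite derivSn dq.
Qed.

Variable C : numClosedFieldType.

Lemma multiplicity_derivn n (d : 'I_n -> C) (lam : C) k :
  let p := \prod_i ('X - (d i)%:P) in
  (forall j, (j <= k)%N -> (p^`(j)).[lam] = 0) <->
  (k < #|[set i | d i == lam]%SET|)%N.
Proof.
move=> p; set S := [set i | d i == lam]%SET.
have pE : p = ('X - lam%:P) ^+ #|S| * \prod_(i | d i != lam) ('X - (d i)%:P).
  rewrite /p (bigID (fun i => d i == lam)) /=; congr (_ * _).
  rewrite (eq_bigr (fun=> 'X - lam%:P)) ?prodr_const; last by move=> i /eqP ->.
  by congr (_ ^+ _); apply: eq_card => i; rewrite inE.
have qn : (\prod_(i | d i != lam) ('X - (d i)%:P)).[lam] != 0.
  rewrite horner_prod; apply/prodf_neq0 => i hi.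
  by rewrite !hornerE subr_eq0 eq_sym.
have [h1 h2] := derivn_root_power #|S| qn; rewrite -pE in h1 h2.
split=> [h|hk j jk]; last by apply: h1; apply: leq_ltn_trans hk.
by rewrite ltnNge; apply/negP => /h; apply/eqP.
Qed.

(** For Hermitian [A] this is a sum of squares of reals at each real point, hence vanishes there
    exactly when [char_poly A] and its first [k] derivatives do. Evaluated at [A], it has as
    determinant the product of its values at the eigenvalues. *)
Definition multiplicity_poly n (A : 'M[C]_n) (k : nat) : {poly C} :=
  \sum_(j < k.+1) ((char_poly A)^`(j)) ^+ 2.

(** The value 1 in size 0 records that an empty matrix has no eigenvalue. *)
Definition multiplicity_det n : 'M[C]_n -> nat -> C :=
  match n return 'M[C]_n -> nat -> C with
  | 0 => fun _ _ => 1
  | n'.+1 => fun A k => \det (horner_mx A (multiplicity_poly A k))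
  end.

Lemma multiplicity_detP n (A : 'M[C]_n) k :
  (forall i j, A i j = (A j i)^*) ->
  (exists2 lam : C, lam \is Num.real & \rank (lam%:M - A)%R + k < n)%N <->
  multiplicity_det A k = 0.
Proof.
case: n A => [|n] A hA /=.
  by split=> [[? _]|/eqP]; rewrite ?oner_eq0.
have hherm : A \is hermsymmx.
  apply/is_hermitianmxP; rewrite expr0 scale1r; apply/matrixP => i j.
  by rewrite !mxE hA.
have hreal := hermitian_spectral_diag_real hherm.
have /orthomx_spectralP AE := hermitian_normalmx hherm.
set P := spectralmx A in AE; set d := spectral_diag A in AE hreal.
have Pu : P \in unitmx := spectral_unit A.
have dr i : d 0 i \is Num.real by apply: (mxOverP hreal).
have cA : char_poly A = \prod_i ('X - (d 0 i)%:P).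
  have <- : char_poly (diag_mx d) = \prod_i ('X - (d 0 i)%:P).
    rewrite char_poly_trig ?diag_mx_is_trig //; apply: eq_bigr => i _.
    by rewrite !mxE eqxx mulr1n.
  rewrite /char_poly /char_poly_mx.
  have -> : 'X%:M - map_mx polyC A = map_mx polyC (invmx P) *m
      ('X%:M - map_mx polyC (diag_mx d)) *m map_mx polyC P.
    rewrite mulmxBr mulmxBl -!map_mxM /= -AE; congr (_ - _).
    rewrite scalar_mxC -mulmxA -map_mxM mulVmx //.
    by rewrite map_mx1 mulmx1.
  rewrite !det_mulmx mulrC mulrA -det_mulmx -map_mxM mulmxV // map_mx1 det1 mul1r.
  by [].
set q := multiplicity_poly A k.
have -> : \det (horner_mx A q) = \prod_i q.[d 0 i].
  rewrite AE horner_mx_uconjC // !det_mulmx mulrC mulrA -det_mulmx mulmxV // det1 mul1r.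
  by rewrite horner_mx_diag det_diag; apply: eq_bigr => i _; rewrite mxE.
have rk lam : \rank (lam%:M - A) = #|[set i | d 0 i != lam]%SET|.
  have -> : lam%:M - A = invmx P *m (lam%:M - diag_mx d) *m P.
    rewrite mulmxBr mulmxBl -AE; congr (_ - _).
    by rewrite scalar_mxC -mulmxA mulVmx // mulmx1.
  rewrite mxrankMfree ?row_free_unit // eqmxMfull ?row_full_unit ?unitmx_inv //.
  rewrite -diag_const_mx -raddfB rank_diag_mx; apply: eq_card => i.
  by rewrite !inE !mxE subr_eq0 eq_sym.
have card lam : (#|[set i | d 0%R i == lam]%SET| + #|[set i | d 0%R i != lam]%SET| = n.+1)%N.
  rewrite -[RHS]card_ord -(cardsC [set i | d 0 i == lam]%SET); congr (_ + _)%N.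
  by apply: eq_card => i; rewrite !inE.
have realp i j : ((char_poly A)^`(j)).[d 0 i] \is Num.real.
  have : forall l, (char_poly A)`_l \is Num.real.
    rewrite cA; apply: (big_ind (fun p : {poly C} => forall l, p`_l \is Num.real)).
    - by move=> l; rewrite coefC; case: ifP => _; rewrite ?rpred0 ?rpred1.
    - by move=> p p' hp hp' l; rewrite coefM rpred_sum // => s _; rewrite rpredM.
    move=> s _ l; rewrite coefB coefX coefC rpredB //.
      by case: eqP; rewrite ?rpred0 ?rpred1.
    by case: ifP => _; rewrite ?rpred0 ?dr.
  elim: j (char_poly A) => [|j IH] p hp.
    by rewrite derivn0 horner_coef rpred_sum // => s _; rewrite rpredM ?rpredX.
  by rewrite derivSn; apply: IH => l; rewrite coef_deriv rpredMn.
have q0 i : q.[d 0 i] = 0 <-> (forall j, (j <= k)%N -> ((char_poly A)^`(j)).[d 0 i] = 0).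
  rewrite /q /multiplicity_poly horner_sum; under eq_bigr do rewrite horner_exp.
  split=> [/eqP h j jk|h].
    have nn (l : 'I_k.+1) : true -> 0 <= ((char_poly A)^`(l)).[d 0 i] ^+ 2.
      by move=> _; rewrite real_exprn_even_ge0.
    rewrite psumr_eq0 // in h.
    have := allP h (Ordinal (n := k.+1) (m := j) jk) (mem_index_enum _).
    by rewrite /= sqrf_eq0 => /eqP.
  by apply: big1 => j _; rewrite h ?expr0n // -ltnS.
split=> [[lam lr hl]|/eqP/prodf_eq0[i _ /eqP/q0 h]].
  rewrite rk in hl; have := card lam => hc.
  have : (0 < #|[set i | d 0%R i == lam]%SET|)%N by lia.
  case/card_gt0P => i; rewrite inE => /eqP di.
  apply/eqP/prodf_eq0; exists i => //; apply/eqP/q0; rewrite cA di.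
  apply/(multiplicity_derivn (fun i => d 0 i)) => /=.
  by move: hc hl; set x := #|_|; set y := #|_|; lia.
exists (d 0 i); first exact: dr.
rewrite rk; rewrite cA in h; move/(multiplicity_derivn (fun i => d 0 i)): h.
have /= := card (d 0 i).
by set x := #|_|; set y := #|_|; lia.
Qed.

End Multiplicity.

(** * Complex polynomial functions of real parameters *)

Section PolynomialFunctions.
Variables (R : realType) (N : nat).
Local Notation C := R[i].
Implicit Types (h : 'rV[R]_N -> C).

Definition polyfun h := exists p q : mpoly.mpoly N R,
  forall x, h x = Complex (peval x p) (peval x q).

Lemma polyfun_ext h h' : h =1 h' -> polyfun h -> polyfun h'.
Proof. by move=> e [p [q hp]]; exists p, q => x; rewrite -e. Qed.

Lemma polyfun_cst c : polyfun (fun=> c).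
Proof.
case: c => u v; exists (mpoly.mpolyC N u), (mpoly.mpolyC N v) => x.
by rewrite /peval !mpoly.mevalC.
Qed.

Lemma polyfunD h h' : polyfun h -> polyfun h' -> polyfun (fun x => h x + h' x).
Proof.
move=> [p [q hp]] [p' [q' hp']]; exists (p + p'), (q + q') => x.
by rewrite hp hp' /peval !mpoly.mevalD.
Qed.

Lemma polyfunM h h' : polyfun h -> polyfun h' -> polyfun (fun x => h x * h' x).
Proof.
move=> [p [q hp]] [p' [q' hp']]; exists (p * p' - q * q'), (p * q' + q * p') => x.
by rewrite hp hp' /peval !(mpoly.mevalB, mpoly.mevalD, mpoly.mevalM).
Qed.

Lemma polyfun_sum (I : Type) (s : seq I) (P : pred I) (f : I -> 'rV[R]_N -> C) :
  (forall i, polyfun (f i)) -> polyfun (fun x => \sum_(i <- s | P i) f i x).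
Proof.
move=> hf; elim: s => [|i s IH].
  by apply: polyfun_ext (polyfun_cst 0) => x; rewrite big_nil.
have [Pi|Pi] := boolP (P i).
  by apply: polyfun_ext (polyfunD (hf i) IH) => x; rewrite big_cons Pi.
by apply: polyfun_ext IH => x; rewrite big_cons (negbTE Pi).
Qed.

Lemma polyfun_prod (I : Type) (s : seq I) (f : I -> 'rV[R]_N -> C) :
  (forall i, polyfun (f i)) -> polyfun (fun x => \prod_(i <- s) f i x).
Proof.
move=> hf; elim: s => [|i s IH].
  by apply: polyfun_ext (polyfun_cst 1) => x; rewrite big_nil.
by apply: polyfun_ext (polyfunM (hf i) IH) => x; rewrite big_cons.
Qed.

Lemma polyfun_det n (A : 'rV[R]_N -> 'M[C]_n) :
  (forall i j, polyfun (fun x => A x i j)) -> polyfun (fun x => \det (A x)).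
Proof.
move=> hA; apply: polyfun_sum => s; apply: polyfunM; first exact: polyfun_cst.
exact: polyfun_prod.
Qed.

Lemma polyfun_coord (i : 'I_N) : polyfun (fun x => (x 0 i)%:C%C).
Proof.
exists (mpoly.mpolyX R (mpoly.mnm1 i)), (mpoly.mpolyC N 0) => x.
by rewrite /peval mpoly.mevalXU mpoly.mevalC.
Qed.

Definition polyfun_coefs (f : 'rV[R]_N -> {poly C}) := forall i, polyfun (fun x => (f x)`_i).

Lemma polyfun_coefsM f g : polyfun_coefs f -> polyfun_coefs g ->
  polyfun_coefs (fun x => f x * g x).
Proof.
move=> hf hg i; apply: (@polyfun_ext (fun x => \sum_(j < i.+1) (f x)`_j * (g x)`_(i - j))).
  by move=> x; rewrite coefM.
by apply: polyfun_sum => j; apply: polyfunM.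
Qed.

Lemma polyfun_coefs_cst p : polyfun_coefs (fun=> p).
Proof. by move=> i; apply: polyfun_cst. Qed.

Lemma polyfun_coefs_sum (I : Type) (s : seq I) (f : I -> 'rV[R]_N -> {poly C}) :
  (forall i, polyfun_coefs (f i)) -> polyfun_coefs (fun x => \sum_(i <- s) f i x).
Proof.
move=> hf i; apply: (@polyfun_ext (fun x => \sum_(j <- s) (f j x)`_i)).
  by move=> x; rewrite coef_sum.
by apply: polyfun_sum => j; apply: hf.
Qed.

Lemma polyfun_coefs_prod (I : Type) (s : seq I) (f : I -> 'rV[R]_N -> {poly C}) :
  (forall i, polyfun_coefs (f i)) -> polyfun_coefs (fun x => \prod_(i <- s) f i x).
Proof.
move=> hf; elim: s => [|i s IH] k.
  by apply: polyfun_ext (polyfun_coefs_cst 1 k) => x; rewrite big_nil.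
by apply: polyfun_ext (polyfun_coefsM (hf i) IH k) => x; rewrite big_cons.
Qed.

Lemma polyfun_char_poly n (A : 'rV[R]_N -> 'M[C]_n) :
  (forall i j, polyfun (fun x => A x i j)) -> polyfun_coefs (fun x => char_poly (A x)).
Proof.
move=> hA; apply: polyfun_coefs_sum => s; apply: polyfun_coefsM.
  exact: polyfun_coefs_cst.
apply: polyfun_coefs_prod => i k.
have hk : polyfun (fun x => ('X *+ (i == s i) : {poly C})`_k +
    (- 1) * (if k == 0%N then A x i (s i) else 0)).
  apply: polyfunD; first exact: polyfun_cst.
  apply: polyfunM; first exact: polyfun_cst.
  by case: (k == 0%N); [exact: hA | exact: polyfun_cst].
by apply: polyfun_ext hk => x; rewrite !mxE coefB coefC mulN1r.
Qed.

Lemma polyfun_coefs_derivn f j : polyfun_coefs f -> polyfun_coefs (fun x => (f x)^`(j)).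
Proof.
move=> hf i; apply: (@polyfun_ext (fun x => (f x)`_(j + i) * ((j + i) ^_ j)%:R)).
  by move=> x; rewrite coef_derivn mulr_natr.
by apply: polyfunM; [exact: hf | exact: polyfun_cst].
Qed.

Lemma polyfun_mx_exp n (A : 'rV[R]_N -> 'M[C]_n.+1) k :
  (forall i j, polyfun (fun x => A x i j)) ->
  forall i j, polyfun (fun x => (A x ^+ k) i j).
Proof.
move=> hA; elim: k => [|k IH] i j.
  apply: (@polyfun_ext (fun=> (1 : 'M[C]_n.+1) i j)); last exact: polyfun_cst.
  by move=> x; rewrite expr0.
apply: (@polyfun_ext (fun x => \sum_l A x i l * (A x ^+ k) l j)).
  by move=> x; rewrite exprS mxE.
by apply: polyfun_sum => l; apply: polyfunM.
Qed.

(** The bound [d] on the sizes, uniform in [x], turns the evaluation into a fixed finite sum. *)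
Lemma polyfun_horner_mx n (A : 'rV[R]_N -> 'M[C]_n.+1) f d :
  (forall i j, polyfun (fun x => A x i j)) -> polyfun_coefs f ->
  (forall x, size (f x) <= d)%N ->
  forall i j, polyfun (fun x => horner_mx (A x) (f x) i j).
Proof.
move=> hA hf hd i j.
apply: (@polyfun_ext (fun x => \sum_(k < d) (f x)`_k * (A x ^+ k) i j)).
  move=> x; have {2}-> : f x = \sum_(k < d) (f x)`_k *: 'X^k.
    apply/polyP => k; rewrite coef_sum; under eq_bigr do rewrite coefZ coefXn.
    have [kd|dk] := ltnP k d.
      rewrite (bigD1 (Ordinal kd)) //= eqxx mulr1 big1 ?addr0 // => l.
      by rewrite -val_eqE /= eq_sym => /negbTE ->; rewrite mulr0.
    rewrite nth_default ?(leq_trans (hd x)) // big1 // => l _.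
    by rewrite gtn_eqF ?mulr0 // (leq_trans _ dk).
  rewrite raddf_sum summxE; apply: eq_bigr => k _.
  by rewrite /= (horner_mxZ (A x)) rmorphXn /= horner_mx_X mxE.
by apply: polyfun_sum => k; apply: polyfunM; [exact: hf | exact: polyfun_mx_exp].
Qed.

Lemma polyfun_multiplicity_det n (A : 'rV[R]_N -> 'M[C]_n) k :
  (forall i j, polyfun (fun x => A x i j)) ->
  polyfun (fun x => multiplicity_det (A x) k).
Proof.
case: n A => [|n] A hA; first exact: polyfun_cst.
apply: polyfun_det; apply: (polyfun_horner_mx (d := (n.+2 + n.+2)%N)) => //.
  apply: polyfun_coefs_sum => j i.
  apply: polyfun_ext (polyfun_coefsM (f := fun x => (char_poly (A x))^`(j))
    (g := fun x => (char_poly (A x))^`(j)) _ _ i).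
  - by move=> x; rewrite expr2.
  - exact/polyfun_coefs_derivn/polyfun_char_poly.
  - exact/polyfun_coefs_derivn/polyfun_char_poly.
move=> x; apply: (leq_trans (size_sum _ _ _)); apply/bigmax_leqP => j _.
rewrite expr2; apply: (leq_trans (size_polyMleq _ _)).
apply: leq_trans (leq_pred _) _.
have sz : (size (char_poly (A x))^`(j) <= n.+2)%N.
  apply/leq_sizeP => i hi; rewrite coef_derivn nth_default ?mul0rn // size_char_poly.
  by rewrite (leq_trans hi) // leq_addl.
exact: leq_add.
Qed.

Lemma peval_continuous (p : mpoly.mpoly N R) :
  continuous (fun x : 'rV[R]_N => peval x p).
Proof.
move=> x.
have pE y : peval y p = \sum_(m <- mpoly.msupp p)
    mpoly.mcoeff m p * \prod_i y 0 i ^+ mpoly.fun_of_multinom m i.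
  by rewrite /peval mpoly.mevalE.
rewrite /continuous_at pE (funext pE).
have hc (i : 'I_N) : (fun y : 'rV[R]_N => y 0 i) @ nbhs x --> x 0 i.
  exact: coord_continuous.
have hF : Filter (nbhs x) by exact: nbhs_filter.
move: (nbhs x) hF hc => F hF hc.
apply: cvg_bigsum => m _; apply: cvgM; first exact: cvg_cst.
elim: (index_enum _) => [|i s IH].
  by under eq_fun do rewrite big_nil; rewrite big_nil; exact: cvg_cst.
under eq_fun do rewrite big_cons; rewrite big_cons; apply: cvgM => //.
elim: (mpoly.fun_of_multinom m i) => [|k IHk]; first exact: cvg_cst.
by under eq_fun do rewrite exprS; rewrite exprS; apply: cvgM.
Qed.

Section AlgebraicUnion.
Variables (T : finType) (P : pred T) (L : T -> seq (mpoly.mpoly N R)).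

Let Z := [set x : 'rV[R]_N | exists2 t, P t & all (fun p => peval x p == 0) (L t)].

Lemma algebraic_union_semialgebraic : semialgebraic Z.
Proof.
exists #|P|, (fun i => (L (enum_val i), [::])); apply/seteqP; split => x /=.
  move=> [t Pt ht]; exists (enum_rank_in (A := P) Pt t) => //=.
  by rewrite /basic_semialgebraic /= enum_rankK_in // ht.
move=> [i _]; rewrite /basic_semialgebraic /= andbT => h.
by exists (enum_val i) => //; exact: (enum_valP i).
Qed.

Lemma algebraic_union_closed : closed Z.
Proof.
have -> : Z = \bigcup_(t in [set t | P t])
    [set x | all (fun p => peval x p == 0) (L t)].
  apply/seteqP; split => x /=; first by move=> [t Pt h]; exists t.
  by move=> [t Pt h]; exists t.
apply: closed_bigcup => [|t _]; first exact: finite_finset.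
elim: (L t) => [|p s IH].
  by rewrite (_ : [set _ | _] = setT); [exact: closedT | apply/seteqP].
rewrite (_ : [set _ | _] = (fun x => peval x p) @^-1` [set y | y = 0] `&`
  [set x | all (fun p => peval x p == 0) s]).
  apply: closedI => //; apply: preimage_closed; last exact: closed_eq.
  by move=> x _; exact: peval_continuous.
apply/seteqP; split => x /=; first by move=> /andP[/eqP].
by move=> [-> ->]; rewrite eqxx.
Qed.

End AlgebraicUnion.
End PolynomialFunctions.

(** * The parameter set is closed and semialgebraic *)

Section PolynomialCriterion.
Variables (R : realType) (V E : finType) (G : graph V E) (O : {set E}).
Hypothesis hO : orientation G O.
Local Notation N := (#|E| + #|V|)%N.

Lemma polyfun_weight e : polyfun (fun x : 'rV[R]_N => weight_of G O x e).
Proof.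
have cE (f g : 'I_N) (s : R) : polyfun (fun x : 'rV[R]_N => Complex (x 0 f) (s * x 0 g)).
  apply: polyfun_ext (polyfunD (polyfun_coord R f)
    (polyfunM (polyfun_cst N (Complex 0 s)) (polyfun_coord R g))) => x.
  by apply/eqP; rewrite eq_complex /=; apply/andP; split; apply/eqP; ring.
rewrite /weight_of; case: (e \in O).
  by apply: polyfun_ext (cE (edge_coord V e) (edge_coord V (rev G e)) 1) => x; rewrite mul1r.
by apply: polyfun_ext (cE (edge_coord V (rev G e)) (edge_coord V e) (-1)) => x; rewrite mulN1r.
Qed.

Lemma polyfun_conj (h : 'rV[R]_N -> R[i]) : polyfun h -> polyfun (fun x => conjc (h x)).
Proof.
move=> [p [q hp]]; exists p, (- q) => x.
by rewrite hp /peval mpoly.mevalN.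
Qed.

Lemma polyfun_adj_matrix X i j :
  polyfun (fun x : 'rV[R]_N => adj_matrix G (weight_of G O x) (potential_of x) X i j).
Proof.
have h : polyfun (fun x : 'rV[R]_N => (if enum_val i == enum_val j then 1 else 0) *
   (x 0 (vertex_coord E (enum_val i)))%:C%C +
   \sum_(e | (src G e == enum_val i) && (tgt G e == enum_val j)) conjc (weight_of G O x e)).
  apply: polyfunD.
    by apply: polyfunM; [exact: polyfun_cst | exact: polyfun_coord].
  by apply: polyfun_sum => e; apply: polyfun_conj; apply: polyfun_weight.
apply: polyfun_ext h => x; rewrite mxE /adj_entry; congr (_ + _).
by case: ifP => _; rewrite ?mul1r ?mul0r.
Qed.

Lemma adj_matrix_hermitian (a : E -> R[i]) (b : V -> R) X : hermitian_weights G a ->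
  forall i j, adj_matrix G a b X i j = conjc (adj_matrix G a b X j i).
Proof.
move=> ha i j; rewrite !mxE /adj_entry conjD conj_sum; congr (_ + _).
  by rewrite eq_sym; case: eqVneq => [->|_]; rewrite ?conj_real ?conjc0.
rewrite (reindex_inj (can_inj (@Defs.revK _ _ G))) /=.
apply: eq_big => e; first by rewrite src_revE tgt_revE andbC.
by move=> _; rewrite -ha.
Qed.

Lemma kernel_excess_det (a : E -> R[i]) (b : V -> R) F X : hermitian_weights G a ->
  (exists lam, kernel_excess G a b lam F X) <->
  multiplicity_det (adj_matrix G a b X) #|outer G F X| = 0.
Proof.
move=> ha; have hA := adj_matrix_hermitian b (X := X) ha.
rewrite -multiplicity_detP //; split=> [[lam h]|[z /complex_realP[lam ->] h]].
  by exists lam%:C%C => //; apply/complex_realP; exists lam.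
by exists lam.
Qed.

Lemma excess_set_algebraic (F : {set E}) (X : {set V}) : exists L : seq (mpoly.mpoly N R),
  excess_set (R := R) G O F X = [set x | all (fun p => peval x p == 0) L].
Proof.
have [p [q hpq]] := polyfun_multiplicity_det #|outer G F X| (polyfun_adj_matrix (X := X)).
have /choice[w hw] : forall e, exists w : mpoly.mpoly N R * mpoly.mpoly N R,
    forall x, weight_of G O x e = Complex (peval x w.1) (peval x w.2).
  by move=> e; have [u [v h]] := polyfun_weight e; exists (u, v).
exists ([:: p; q] ++ flatten [seq [:: (w e).1; (w e).2] | e <- enum (~: F)%SET]).
apply/seteqP; split => x /=.
  move=> [h1 /(kernel_excess_det _ _ _ (weight_of_hermitian hO x)) h2].
  move: h2; rewrite hpq => -[-> ->]; rewrite eqxx /=.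
  apply/allP => u /flattenP[s /mapP[e]]; rewrite mem_enum finset.in_setC => eF ->.
  have := h1 e eF; rewrite hw => -[e1 e2].
  by rewrite !inE => /orP[] /eqP ->; rewrite ?e1 ?e2.
move=> /and3P[/eqP h1 /eqP h2 /allP h3]; split.
  move=> e eF; rewrite hw.
  have hin u : u \in [:: (w e).1; (w e).2] -> peval x u = 0.
    move=> hu; apply/eqP/h3/flattenP; exists [:: (w e).1; (w e).2] => //.
    by apply/mapP; exists e; rewrite // mem_enum finset.in_setC.
  by rewrite !hin ?inE ?eqxx ?orbT.
apply/(kernel_excess_det _ _ _ (weight_of_hermitian hO x)).
by rewrite hpq h1 h2.
Qed.

Lemma point_spectrum_params_algebraic (r : V) : connected_graph G ->
  closed (point_spectrum_params (R := R) G O r) /\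
  semialgebraic (point_spectrum_params (R := R) G O r).
Proof.
move=> hconn; rewrite point_spectrum_paramsE //.
have /choice[L hL] : forall t : {set E} * {set V}, exists L : seq (mpoly.mpoly N R),
    excess_set (R := R) G O t.1 t.2 = [set x | all (fun p => peval x p == 0) L].
  by move=> t; apply: excess_set_algebraic.
pose P (t : {set E} * {set V}) := `[< sym_edges G t.1 /\ forest G (inner G t.1 t.2) >].
rewrite (_ : [set x | _] =
  [set x | exists2 t, P t & all (fun p => peval x p == 0) (L t)]).
  by split; [exact: algebraic_union_closed | exact: algebraic_union_semialgebraic].
apply/seteqP; split => x /=.
  move=> [F [X [h1 h2 h3]]]; exists (F, X); first by apply/asboolP.
  by move: h3; rewrite (hL (F, X)).
move=> [[F X] /asboolP[h1 h2] h3]; exists F, X; split => //.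
by rewrite (hL (F, X)).
Qed.

End PolynomialCriterion.

(** * Leaves of the forest *)

Section Combinatorics.
Variables (V E : finType) (G : graph V E).

(** A closed walk through [e] leaves the cut [B] and can come back only through [rev G e]. The part
    in between is nonempty, as the walk does not backtrack, and is a shorter closed walk. *)
Lemma forest_acyclic : forest G [set: E]%SET -> ~ has_cycle G.
Proof.
move=> hf; case=> e [w]; have [n] := ubnP (size w).
elim: n e w => // n IH e w /ltnSE hw [hnb hclosed].
have [B [eB etB hB]] := hf e (finset.in_setT e).
have enter f : src G f \notin B -> tgt G f \in B -> f = rev G e.
  move=> h1 h2; rewrite -[f](Defs.revK G) (hB (rev G f)) ?finset.in_setT //.
    by rewrite src_revE.
  by rewrite tgt_revE.
have crossing : forall p f, tgt G f \notin B ->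
    path [rel e f | (tgt G e == src G f) && (e != rev G f)] f p ->
    tgt G (last f p) \in B -> rev G e \in p.
  elim=> [|g p IHp] f fB /=; first by rewrite (negbTE fB).
  move=> /andP[/andP[/eqP fg _] hp] hl; rewrite inE.
  have [gB|gB] := boolP (tgt G g \in B); first by rewrite (enter g) ?eqxx // -fg.
  by rewrite (IHp g) ?orbT.
have rin : rev G e \in w by apply: (crossing w e) => //; rewrite hclosed.
move: hnb hclosed hw; case/splitPr: rin => w1 w2.
rewrite /non_backtracking /= cat_path /= => /and3P[h1 /andP[/eqP h2 h3] _] _.
case: w1 h1 h2 h3 => [|f w1] /=; first by rewrite Defs.revK eqxx.
move=> /andP[/andP[/eqP h1 _] h1'] h2 _; rewrite size_cat /= => hw.
apply: (IH f w1); first by lia.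
by split=> //; rewrite h2 src_revE.
Qed.

Variables (F : {set E}) (X : {set V}).
Hypotheses (hF : sym_edges G F) (hf : forest G (inner G F X)).
Hypotheses (hconn : connected_graph G) (hcycle : has_cycle G).

(* An edge leaving a cut set of minimal size starts at a leaf of the forest. *)
Lemma forest_leaf : X != finset.set0 -> exists (u : V) (e0 : E), u \in X /\
  forall e, e \in inner G F X -> src G e = u -> e = e0.
Proof.
move=> /set0Pn[v vX]; pose D := inner G F X.
pose cut (t : E * {set V}) := [&& t.1 \in D, src G t.1 \in t.2, tgt G t.1 \notin t.2 &
  [forall f in D, (src G f \in t.2) ==> (tgt G f \notin t.2) ==> (f == t.1)]].
have [[e eD]|hn] := pselect (exists e, e \in D); last first.
  by case: hcycle => e _; exists v, e; split => // f fD; case: hn; exists f.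
have cutP f : f \in D -> exists B, cut (f, B).
  move=> fD; have [B [h1 h2 h3]] := hf fD; exists B; rewrite /cut /= fD h1 h2 /=.
  by apply/forallP => g; apply/implyP => gD; apply/implyP => g1; apply/implyP => g2; rewrite (h3 g).
have [B hB] := cutP e eD.
case: (@arg_minnP _ (e, B) cut (fun t => #|t.2|) hB) => -[e1 B1] /and4P[/= e1D h1 h2 /forallP h3] hmin.
exists (src G e1), e1; split; first by move: e1D; rewrite inE => /and3P[].
move=> f fD fe; apply/eqP; apply: contraT => ne.
have fB : tgt G f \in B1.
  apply: contraT => nf; move: (h3 f); rewrite fD fe h1 nf /= => /eqP h.
  by rewrite h eqxx in ne.
(* [B1 :&: B2] still cuts the reverse of [f] alone and misses the origin of [e1], which contradicts
   the minimality of [B1]. *)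
have [B2] := cutP (rev G f) (etrans (inner_rev X f hF) fD).
move=> /and4P[/= rD g1 g2 /forallP g3].
have : cut (rev G f, (B1 :&: B2)%SET).
  rewrite /cut /= rD src_revE tgt_revE !finset.in_setI fB fe.
  move: g1 g2; rewrite src_revE tgt_revE fe => -> /negbTE g2; rewrite g2 andbF /=.
  apply/forallP => g; apply/implyP => gD; rewrite !finset.in_setI.
  apply/implyP => /andP[gB1 gB2]; apply/implyP; rewrite negb_and => /orP[] gt.
    by move: (h3 g); rewrite gD gB1 gt /= => /eqP ge; rewrite ge g2 in gB2.
  by move: (g3 g); rewrite gD gB2 gt.
move=> /hmin /=; rewrite leqNgt; apply: contraNT => _; apply: proper_card.
rewrite properE finset.subsetIl /=; apply/negP => /fintype.subsetP /(_ _ h1).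
by rewrite finset.in_setI; move: g2; rewrite tgt_revE fe => /negbTE ->; rewrite andbF.
Qed.

(** An edge outside [F] counts for one real coordinate, since the pair that it forms with its
    reverse carries a real and an imaginary part. *)
Lemma codim_count dmin : X != finset.set0 ->
  (forall v : V, dmin <= #|neighbors G v|)%N ->
  (maxn (dmin - 1) 1 <= #|~: F|%SET + #|outer G F X|)%N.
Proof.
move=> X0 hd; rewrite geq_max; apply/andP; split.
  have [u [e0 [uX h0]]] := forest_leaf X0.
  rewrite leq_subLR; apply: leq_trans (hd u) _.
  apply: (@leq_trans #|[set tgt G e0] :|: (tgt G @: (~: F) :|: outer G F X)|%SET); last first.
    rewrite (leq_trans (leq_card_setU _ _)) // cards1 leq_add2l.
    by rewrite (leq_trans (leq_card_setU _ _)) // leq_add2r leq_imset_card.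
  apply/subset_leq_card/fintype.subsetP => v; rewrite inE => /existsP[f /andP[/eqP ev /eqP eu]].
  move: ev eu; rewrite -(Defs.revK G f) src_revE; move: (rev G f) => e ev; rewrite tgt_revE => eu.
  rewrite !finset.in_setU finset.in_set1; have [eF|eF] := boolP (e \in F); last first.
    have -> : v \in tgt G @: (~: F)%SET by rewrite -ev; apply: imset_f; rewrite finset.in_setC.
    exact: orbT.
  rewrite [v \in outer _ _ _]inE.
  have [vX|vX] /= := boolP (v \in X).
    by rewrite -ev -(h0 e) ?eqxx // inE eF eu ev uX.
  by apply/orP; right; apply/orP; right; apply/existsP; exists (rev G e); rewrite hF eF src_revE tgt_revE ev eu eqxx.
rewrite addn_gt0 !lt0n !cards_eq0 -negb_and; apply/negP => /andP[/eqP F0 /eqP m0].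
have FT : F = [set: E]%SET by rewrite -[F]finset.setCK F0 finset.setC0.
apply: forest_acyclic hcycle; move: hf; suff -> : inner G F X = [set: E]%SET by [].
have XT v : v \in X.
  have [u uX] := set0Pn _ X0.
  have /connectP[p hp ->] := hconn u v.
  elim: p u uX hp => //= w p IH u uX /andP[/existsP[e /andP[/eqP eu /eqP ew]] hp].
  apply: (IH w) => //; apply: contraT => wX.
  have : w \in outer G F X.
    rewrite inE wX /=; apply/existsP; exists (rev G e).
    by rewrite hF FT inE src_revE tgt_revE ew eu uX eqxx.
  by rewrite m0 inE.
by apply/setP => e; rewrite !inE FT !XT finset.in_setT.
Qed.

End Combinatorics.

Section RowNorm.
Variables (R : realType) (n : nat).
Implicit Types x : 'rV[R]_n.

Lemma le_rV_norm x i : `|x 0 i| <= `|x|.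
Proof.
rewrite [leRHS]/Num.Def.normr /= mx_normrE.
exact: (le_bigmax _ (fun ij : 'I_1 * 'I_n => `|x ij.1 ij.2|) (0, i)).
Qed.

Lemma rV_norm_le x (t : R) : 0 <= t -> (forall i, `|x 0 i| <= t) -> `|x| <= t.
Proof.
move=> t0 h; rewrite [leLHS]/Num.Def.normr /= mx_normrE.
by apply: bigmax_le => // -[i j] _ /=; rewrite ord1.
Qed.

Lemma rV_norm_lt x (t : R) : 0 < t -> (forall i, `|x 0 i| < t) -> `|x| < t.
Proof.
move=> t0 h; rewrite [ltLHS]/Num.Def.normr /= mx_normrE.
by apply: bigmax_lt => // -[i j] _ /=; rewrite ord1.
Qed.

End RowNorm.

(** * Packing dimension of images of cubes *)

Section Thin.
Variables (R : realType) (N n : nat).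

(* The packing form of "the upper box dimension is at most [n]". *)
Definition thin (S : set 'rV[R]_N) := exists C : nat,
  forall (k : nat) (J : finType) (y : J -> 'rV[R]_N), (0 < k)%N ->
    (forall j, S (y j)) -> (forall i j, i != j -> k%:R^-1 < `|y i - y j|) ->
    (#|J| <= C * k ^ n)%N.

(** Moving each point by less than [1 / (4 * k)] into [S] keeps the separation above [1 / (2 * k)],
    whence the factor [2 ^ n]. *)
Lemma thin_closure S : thin S -> thin (closure S).
Proof.
move=> [C hC]; exists (C * 2 ^ n)%N => k J y k0 hy hd.
rewrite -mulnA -expnMn.
have k4 : 0 < (4 * k%:R)^-1 :> R by rewrite invr_gt0 mulr_gt0 // ltr0n.
have /choice[z hz] : forall j, exists z, S z /\ `|y j - z| < (4 * k%:R)^-1.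
  move=> j; have [z [Sz hz]] := hy j _ (nbhsx_ballx (y j) _ k4).
  by exists z; split => //; move: hz; rewrite -ball_normE.
apply: (hC _ J z) => [|j|i j ij]; [by rewrite muln_gt0 | by case: (hz j) |].
have := hd i j ij; have [_ hi] := hz i; have [_ hj] := hz j.
have -> : y i - y j = (y i - z i) + (z i - z j) - (y j - z j).
  by rewrite !addrA subrK opprB addrA subrK.
have h1 := ler_normB (y i - z i + (z i - z j)) (y j - z j).
have h2 := ler_normD (y i - z i) (z i - z j).
rewrite natrM invfM; move: hi hj; rewrite invfM.
have -> : 4^-1 = 2^-1 * 2^-1 :> R by rewrite -invfM; congr _^-1; lra.
move: h1 h2; set D := `|y i - z i + (z i - z j) - (y j - z j)|.
set B := `|y i - z i + (z i - z j)|; set A := `|z i - z j|.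
set F := `|y i - z i|; set H := `|y j - z j|; set K := k%:R^-1 : R.
by move=> *; lra.
Qed.

(** The images of the [K ^ d] points of a grid of mesh [e / (2 * K)] are separated by more than
    [1 / (K * T)], so [K ^ d <= C * (K * T) ^ n] for every [K]; this fails for large [K] if
    [n < d]. *)
Lemma thin_dimension d (S : set 'rV[R]_N) (g : 'rV[R]_d -> 'rV[R]_N) y0 (e L : R) :
  thin S -> 0 < e -> 0 < L -> (forall y, `|y - y0| < e -> S (g y)) ->
  (forall y y', `|y - y0| < e -> `|y' - y0| < e -> `|y - y'| <= L * `|g y - g y'|) ->
  (d <= n)%N.
Proof.
move=> [C hC] e0 L0 hS hL; rewrite leqNgt; apply/negP => nd.
pose T := (Num.trunc (2 * L / e)).+1.
have hT : 2 * L / e < T%:R.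
  by have /andP[] := truncn_itv (ltW (divr_gt0 (mulr_gt0 (ltr0n _ 2) L0) e0)).
suff h K : (0 < K)%N -> (K <= C * T ^ n)%N.
  by have := h (C * T ^ n).+1 isT; rewrite ltnn.
move=> K0; have KR : 0 < K%:R :> R by rewrite ltr0n.
have e2 : 0 < e / 2 / K%:R by rewrite !divr_gt0.
pose y (j : {ffun 'I_d -> 'I_K}) : 'rV[R]_d := y0 + (e / 2 / K%:R) *: \row_i (j i)%:R.
have yin j : `|y j - y0| < e.
  rewrite /y addrAC subrr add0r; apply: rV_norm_lt => // i; rewrite !mxE.
  rewrite ger0_norm; last by apply: mulr_ge0; [exact: ltW | exact: ler0n].
  have : (j i)%:R <= K%:R :> R by rewrite ler_nat ltnW.
  move=> /(ler_wpM2l (ltW e2)); rewrite divfK ?gt_eqF //; lra.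
have hsep : forall i j, i != j -> ((K * T)%N)%:R^-1 < `|g (y i) - g (y j)|.
  move=> i j ij; have [k hk] : exists k, i k != j k.
    by apply/existsP; rewrite -negb_forall; apply: contra ij => /forallP h; apply/eqP/ffunP => k; apply/eqP.
  rewrite -(ltr_pM2l L0); apply: lt_le_trans (hL _ _ (yin i) (yin j)).
  apply: lt_le_trans (le_rV_norm _ k).
  rewrite /y !mxE opprD addrACA subrr add0r -mulrBr normrM (gtr0_norm e2).
  have : 1 <= `|(i k)%:R - (j k)%:R : R|.
    have ne : (i k : nat) != j k by apply: contra hk => /eqP /val_inj ->.
    rewrite ler_normr; case: (ltngtP (i k) (j k)) ne => // h _; apply/orP; [right|left].
      by rewrite opprB lerBrDl natr1 ler_nat.
    by rewrite lerBrDl natr1 ler_nat.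
  move=> /(ler_wpM2l (ltW e2)); apply: lt_le_trans.
  have T0 : 0 < T%:R :> R by rewrite ltr0n.
  rewrite mulr1 natrM ltr_pdivrMr ?mulr_gt0 //.
  have -> : e / 2 / K%:R * (K%:R * T%:R) = T%:R * e / 2 by field; rewrite gt_eqF.
  by move: hT; rewrite ltr_pdivrMr //; lra.
have := hC (K * T)%N _ (g \o y); rewrite muln_gt0 K0 => /(_ isT (fun j => hS _ (yin j)) hsep).
rewrite card_ffun !card_ord expnMn mulnA [(C * _)%N]mulnC -mulnA => h.
have : (K ^ n.+1 <= K ^ n * (C * T ^ n))%N.
  by apply: leq_trans h; rewrite leq_pexp2l.
by rewrite expnSr leq_pmul2l // expn_gt0 K0.
Qed.

End Thin.

(** * Local Lipschitz bounds for C1 maps *)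

Section LocalLipschitz.
Variables (R : realType) (N d : nat) (U : set 'rV[R]_N) (F : 'rV[R]_N -> 'rV[R]_d).
Local Notation dx i := (delta_mx 0 i : 'rV[R]_N).

Lemma partial_lipschitz (w : 'rV[R]_N) (i : 'I_N) (B s t : R) : s <= t ->
  (forall c, s <= c <= t -> derivable F (w + c *: dx i) (dx i) /\
     `|'D_(dx i) F (w + c *: dx i)| <= B) ->
  `|F (w + t *: dx i) - F (w + s *: dx i)| <= B * (t - s).
Proof.
move=> st h; have B0 : 0 <= B.
  have /h[_] : s <= s <= t by rewrite lexx.
  exact: le_trans.
apply: rV_norm_le => [|k]; first by rewrite mulr_ge0 // subr_ge0.
pose f (c : R) := F (w + c *: dx i) 0 k.
have fE (c h' : R) : f (h' *: 1 + c) = F (h' *: dx i + (w + c *: dx i)) 0 k.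
  by rewrite /f; congr (F _ 0 k); rewrite scalerDl addrCA [h' *: 1]mulr1.
have fd c : s <= c <= t -> is_derive c 1 f (('D_(dx i) F (w + c *: dx i)) 0 k).
  move=> /h[hd _]; have hk := (derivable_mxP _ _ _).1 hd 0 k.
  have e : (fun h' => h'^-1 *: (f (h' *: 1 + c) - f c)) =
     (fun h' => h'^-1 *: (F (h' *: dx i + (w + c *: dx i)) 0 k - F (w + c *: dx i) 0 k)).
    by apply/funext => h'; rewrite fE.
  apply: DeriveDef; first by move: hk; rewrite /derivable -e.
  by rewrite derive_mx // mxE /derive e.
have fc : {within `[s, t], continuous f}.
  apply: derivable_within_continuous => c; rewrite in_itv /= => /fd hc.
  exact: ex_derive.
have [|c] := @MVT_segment R f (fun c => ('D_(dx i) F (w + c *: dx i)) 0 k) s t st _ fc.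
  by move=> c; rewrite in_itv /= => /andP[/ltW c1 /ltW c2]; apply: fd; rewrite c1.
rewrite in_itv /= => /h[_ hB] hf.
have -> : (F (w + t *: dx i) - F (w + s *: dx i)) 0 k = f t - f s by rewrite !mxE.
rewrite hf.
rewrite normrM (ger0_norm (x := t - s)) ?subr_ge0 // ler_wpM2r ?subr_ge0 //.
exact: le_trans (le_rV_norm _ _) hB.
Qed.

(** Two points of a ball are joined by changing one coordinate at a time. Balls of the sup norm are
    boxes, so the path stays inside and the mean value theorem applies to each step. *)
Lemma C1_lipschitz x0 : open U -> U x0 -> Ck 1 U F -> exists r L : R,
  [/\ 0 < r, 0 < L, forall x, `|x - x0| < r -> U x &
      forall x x', `|x - x0| < r -> `|x' - x0| < r -> `|F x - F x'| <= L * `|x - x'|].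
Proof.
move=> oU Ux0 [_ hD].
pose B := 1 + \sum_i `|'D_(dx i) F x0|.
have hB i : \forall x \near x0, `|'D_(dx i) F x| <= B.
  have [_ [hc _]] := hD i; have := hc x0 Ux0.
  move=> /cvgr_norm_le; apply; rewrite /B (bigD1 i) //= addrCA ltrDl.
  by rewrite ltr_wpDr // sumr_ge0.
have hB' : \forall x \near x0, forall i, `|'D_(dx i) F x| <= B.
  exact: (@filter_forall _ _ _ (nbhs x0) (nbhs_filter x0) hB).
have : \forall x \near x0, U x /\ forall i, `|'D_(dx i) F x| <= B.
  by apply: filterI => //; exact: open_nbhs_nbhs.
move=> /nbhs_ballP[r r0 hr].
have B0 : 0 < B by rewrite ltr_wpDr // sumr_ge0.
have {}hr x : `|x - x0| < r -> U x /\ forall i, `|'D_(dx i) F x| <= B.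
  by move=> hx; apply: hr; rewrite -ball_normE /= distrC.
exists r, (N%:R * B + 1); split => //.
- by rewrite ltr_wpDl // mulr_ge0 // ltW.
- by move=> x /hr[].
move=> x x' hx hx'.
have step (w : 'rV[R]_N) i s t : `|w + s *: dx i - x0| < r -> `|w + t *: dx i - x0| < r ->
    `|F (w + t *: dx i) - F (w + s *: dx i)| <= B * `|t - s|.
  wlog st : s t / s <= t.
    move=> H h1 h2; have [st|/ltW st] := leP s t; first exact: H.
    by rewrite distrC (distrC t); apply: H.
  move=> h1 h2; rewrite (ger0_norm (x := t - s)) ?subr_ge0 //.
  apply: partial_lipschitz => // c /andP[sc ct].
  have /hr[Uc hc] : `|w + c *: dx i - x0| < r.
    apply: rV_norm_lt => // k.
    have := le_lt_trans (le_rV_norm _ k) h1; have := le_lt_trans (le_rV_norm _ k) h2.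
    rewrite !mxE eqxx /=; case: (k == i); rewrite ?mulr1 ?mulr0 // !ltr_norml.
    by move=> /andP[a1 a2] /andP[a3 a4]; apply/andP; split; lra.
  by split => //; case: (hD i) => + _; apply.
pose z k : 'rV[R]_N := \row_i (if (i < k)%N then x 0 i else x' 0 i).
have zin k : `|z k - x0| < r.
  apply: rV_norm_lt => // i; rewrite !mxE.
  have := le_lt_trans (le_rV_norm _ i) hx; have := le_lt_trans (le_rV_norm _ i) hx'.
  by rewrite !mxE; case: ifP.
have z0 : z 0%N = x' by apply/rowP => i; rewrite mxE.
have zN : z N = x by apply/rowP => i; rewrite mxE ltn_ord.
have hz k : (k <= N)%N -> `|F (z k) - F x'| <= k%:R * (B * `|x - x'|).
  elim: k => [|k IH] kN; first by rewrite z0 subrr normr0 mul0r.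
  have -> : F (z k.+1) - F x' = (F (z k.+1) - F (z k)) + (F (z k) - F x') by rewrite addrA subrK.
  apply: le_trans (ler_normD _ _) _; rewrite -natr1 mulrDl mul1r addrC.
  apply: lerD; first by apply: IH; apply: ltnW.
  pose i := Ordinal kN; pose w := z k - z k 0 i *: dx i.
  have e1 : z k = w + x' 0 i *: dx i by rewrite /w [z k 0 i]mxE ltnn subrK.
  have e2 : z k.+1 = w + x 0 i *: dx i.
    apply/rowP => l; rewrite /w !mxE eqxx /= ltnn ltnS leq_eqVlt.
    have -> : (l == k :> nat) = (l == i) by [].
    case: eqVneq => [->|li] /=; first by rewrite ltnn mulr1 subrr add0r mulr1.
    by rewrite !mulr0 subr0 addr0.
  rewrite e1 e2; apply: le_trans (step w i _ _ _ _) _; rewrite -?e1 -?e2 //.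
  apply: ler_wpM2l; first exact: ltW.
  by have := le_rV_norm (x - x') i; rewrite !mxE.
have := hz N (leqnn N); rewrite zN => /le_trans; apply.
by rewrite mulrA ler_wpM2r // lerDl.
Qed.

End LocalLipschitz.

HB.instance Definition _ (R : realType) (d : nat) := Complete.on 'rV[R]_d.

Section DiffeomorphicCube.
Variables (R : realType) (N d : nat) (A : set 'rV[R]_N).
Hypothesis hA : diffeomorphic A (@open_cube R d).

Let center : 'rV[R]_d := const_mx (1 / 2).

Lemma ball_open_cube y : `|y - center| < 1 / 2 -> open_cube y.
Proof.
move=> h i; have := le_lt_trans (le_rV_norm _ i) h.
by rewrite !mxE ltr_norml => /andP[h1 h2]; apply/andP; split; lra.
Qed.

(* By Baire's theorem the closure of one of the [S i] contains the image of a
   ball under the parametrization, which cannot contract distances by more than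
   a constant factor because its left inverse is locally Lipschitz. *)
Lemma diffeomorphic_cube_dimension (I : countType) (S : I -> set 'rV[R]_N)
    (n : I -> nat) : A `<=` \bigcup_i S i -> (forall i, thin (n i) (S i)) ->
  exists i, (d <= n i)%N.
Proof.
move=> AS hS; have [f [g [[sf sg] fA gB]]] := hA.
(* The radius leaves a margin of 1/4 inside the cube around each point of [Q], on which [g] agrees
   locally with a smooth map. *)
pose Q := closed_ball center (1 / 4 : R).
have q0 : 0 < 1 / 4 :> R by lra.
have QE y : Q y <-> `|y - center| <= 1 / 4 by rewrite /Q closed_ballE // distrC.
have Qcube y z : Q y -> `|z - y| < 1 / 4 -> open_cube z.
  move=> /QE hy hz; apply: ball_open_cube.
  by have := ler_normD (z - y) (y - center); rewrite addrA subrK; lra.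
have gc y : Q y -> {for y, continuous g}.
  move=> Qy; have cy : open_cube y by apply: (Qcube y) => //; rewrite subrr normr0.
  have [W [H [oW Wy hH Hg]]] := sg y cy.
  have nW : \forall z \near y, H z = g z.
    have h1 : \forall z \near y, W z by exact: open_nbhs_nbhs.
    apply: filterS2 h1 (nbhsx_ballx y _ q0) => z Wz; rewrite -ball_normE /= distrC => hz.
    by apply: Hg => //; apply: Qcube hz.
  have [+ _] := hH 0%N => /(_ y Wy) Hy; change (g z @[z --> y] --> g y); rewrite -(Hg y Wy cy).
  exact: cvg_trans (near_eq_cvg nW) Hy.
(* The index type is enumerated by its codes, since Baire's theorem takes a sequence; a code of no
   index gets the empty set. *)
pose T k := if @choice.unpickle I k is Some i then closure (S i) else set0.
have Tc k : closed (T k).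
  by rewrite /T; case: choice.unpickle => [i|]; [exact: closed_closure | exact: closed0].
pose D k := [set y | Q y /\ T k (g y)].
have Dc k : closed (D k).
  move=> y hy; have Qy : Q y.
    by apply: closed_ball_closed => B /hy[z [[Qz _] Bz]]; exists z.
  split => //; apply: Tc => B /(gc y Qy) /hy[z [[_ Tz] Bz]].
  by exists (g z).
have [k [y0 [e [e0 hD]]]] : exists k y0 (e : R), 0 < e /\ forall y, `|y - y0| < e -> D k y.
  (* Otherwise the complements of the closed sets [D k] are open and dense, and some point of the
     ball avoids all of them, although its image lies in some [S i]. *)
  apply: contrapT => hn.
  have hO k : open (~` D k) /\ dense (~` D k).
    split; first exact: closed_openC.
    move=> W [y Wy] oW; apply: contrapT => hW; apply: hn.
    have /nbhs_ballP[e e0 he] : nbhs y W by exact: open_nbhs_nbhs.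
    exists k, y, e; split => // z hz; apply: contrapT => nz.
    by apply: hW; exists z; split => //; apply: he; rewrite -ball_normE /= distrC.
  have [y [hy hDy]] := Baire hO (ex_intro _ center (ballxx center q0)) (ball_open center (1 / 4)).
  have Qy : Q y.
    have : ball (center : 'rV[R]_d) (1 / 4) y := hy.
    by move=> h; apply/QE; move: h; rewrite -ball_normE /= distrC => /ltW.
  have cy : open_cube y by apply: (Qcube y) => //; rewrite subrr normr0.
  have [i _ Si] := AS _ (gB y cy).1.
  apply: (hDy (choice.pickle i)) => //; split => //.
  by rewrite /T choice.pickleK; apply: subset_closure.
have D0 : D k y0 by apply: hD; rewrite subrr normr0.
have [Qy0 Ty0] := D0; move: Ty0 hD; rewrite /D /T; case: choice.unpickle => [i|//] _ hD.
exists i.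
have cube0 y : `|y - y0| < e -> open_cube y.
  by move=> /hD[Qy _]; apply: (Qcube y) => //; rewrite subrr normr0.
have A0 := (gB y0 (cube0 y0 ltac:(by rewrite subrr normr0))).
have [U [F [oU Ug hF Ff]]] := sf (g y0) A0.1.
have [r [L [r0 L0 rU hL]]] := C1_lipschitz oU Ug (hF 1%N).
have /nbhs_ballP[e1 e10 he1] : nbhs y0 (g @^-1` [set x | `|x - g y0| < r]).
  apply: (gc y0 Qy0); apply/nbhs_ballP; exists r => // x.
  by rewrite -ball_normE /= distrC.
have lee (y : 'rV[R]_d) : `|y - y0| < Num.min e e1 -> `|y - y0| < e /\ `|g y - g y0| < r.
  rewrite lt_min => /andP[h1 h2]; split => //.
  by apply: he1; rewrite -ball_normE /= distrC.
apply: (@thin_dimension _ _ _ _ _ g y0 (Num.min e e1) L (thin_closure (hS i))) => //.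
- by rewrite lt_min e0.
- by move=> y /lee[/hD[]].
move=> y y' /lee[h1 h2] /lee[h3 h4].
have [B1 f1] := gB y (cube0 y h1); have [B2 f2] := gB y' (cube0 y' h3).
rewrite -{1}f1 -{1}f2 -!Ff //; try exact: rU.
exact: hL.
Qed.

End DiffeomorphicCube.

(** Let [f] select a basis of the row space. By Hermitian symmetry the columns selected by [f] have
    the same rank; they factor through the principal block, which is therefore invertible. *)
Lemma hermitian_core (R : rcfType) n (M : 'M[R[i]]_n) :
  (forall i j, M i j = conjc (M j i)) ->
  exists f : 'I_(\rank M) -> 'I_n, [/\ injective f, mxsub f f M \in unitmx &
    M = colsub f M *m invmx (mxsub f f M) *m rowsub f M].
Proof.
move=> hM; pose f : 'I_(\rank M) -> 'I_n := maxrankfun M.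
exists f; have fI : injective f := @maxrankfun_inj _ _ _ M.
pose P := rowsub f M; have PM : (P :=: M)%MS := eq_maxrowsub M.
have /submxP[Y MY] : (M <= P)%MS by rewrite PM.
pose B := mxsub f f M.
have cB : colsub f M = Y *m B.
  apply/matrixP => i j; rewrite mxE {1}MY !mxE; apply: eq_bigr => k _.
  by rewrite !mxE.
have rB : B \in unitmx.
  rewrite -row_full_unit /row_full eqn_leq rank_leq_row /=.
  have rc : \rank (colsub f M) = \rank M.
    have -> : colsub f M = map_mx (@conjc R) P^T by apply/matrixP => i j; rewrite !mxE -hM.
    by rewrite (mxrank_map (GRing.RMorphism.clone _ _ (@conjc R) _)) mxrank_tr PM.
  by apply: (@leq_trans (\rank (colsub f M))); [rewrite rc | rewrite cB mxrankM_maxr].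
by split => //; rewrite cB mulmxK.
Qed.

Lemma normc_ge0 (R : rcfType) (z : R[i]) : 0 <= ComplexField.Normc.normc z.
Proof. by case: z => u v; exact: sqrtr_ge0. Qed.

(** * Bounded Lipschitz functions of the parameters *)

Section Controlled.
Variables (R : realType) (T : Type) (Z : set T) (close : R -> T -> T -> Prop).
Local Notation C := R[i].
Local Notation normc := (@ComplexField.Normc.normc R).
Implicit Types h k : T -> C.

(** The bound on values is carried along because products need it. The relation [close] is left
    abstract; it will compare only some of the coordinates. *)
Definition controlled h := exists L : R, [/\ 0 <= L, forall p, Z p -> normc (h p) <= L &
  forall p q t, Z p -> Z q -> 0 <= t -> close t p q -> normc (h p - h q) <= L * t].

Lemma controlled_cst c : controlled (fun=> c).
Proof.
exists (normc c); split => // [|p q t _ _ t0 _]; first exact: normc_ge0.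
by rewrite subrr ComplexField.Normc.normc0 mulr_ge0 // normc_ge0.
Qed.

Lemma controlled_ext h h' : (forall p, Z p -> h p = h' p) -> controlled h -> controlled h'.
Proof.
move=> e [L [L0 h1 h2]]; exists L; split => // [p Zp|p q t Zp Zq t0 pq].
  by rewrite -e // h1.
by rewrite -!e // h2.
Qed.

Lemma controlledD h k : controlled h -> controlled k -> controlled (fun p => h p + k p).
Proof.
move=> [L [L0 h1 h2]] [K [K0 k1 k2]]; exists (L + K); split=> [|p Zp|p q t Zp Zq t0 pq].
- exact: addr_ge0.
- by apply: le_trans (le_normcD _ _) _; apply: lerD; [exact: h1 | exact: k1].
rewrite opprD addrACA mulrDl; apply: le_trans (le_normcD _ _) _.
by apply: lerD; [exact: h2 | exact: k2].
Qed.

Lemma controlledM h k : controlled h -> controlled k -> controlled (fun p => h p * k p).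
Proof.
move=> [L [L0 h1 h2]] [K [K0 k1 k2]]; exists (2 * (L * K)).
have LK : 0 <= L * K by exact: mulr_ge0.
have nn z : 0 <= normc z := normc_ge0 z.
split=> [|p Zp|p q t Zp Zq t0 pq]; first by rewrite mulr_ge0.
  rewrite ComplexField.Normc.normcM; have : normc (h p) * normc (k p) <= L * K.
    by apply: ler_pM => //; [exact: h1 | exact: k1].
  by lra.
have -> : h p * k p - h q * k q = h p * (k p - k q) + (h p - h q) * k q by ring.
apply: le_trans (le_normcD _ _) _; rewrite !ComplexField.Normc.normcM.
have e1 : normc (h p) * normc (k p - k q) <= L * (K * t).
  by apply: ler_pM => //; [exact: h1 | exact: k2].
have e2 : normc (h p - h q) * normc (k q) <= L * t * K.
  by apply: ler_pM => //; [exact: h2 | exact: k1].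
apply: le_trans (lerD e1 e2) _; lra.
Qed.

Lemma controlledV h (m : R) : 0 <= m -> (forall p, Z p -> 1 <= m * normc (h p)) ->
  controlled h -> controlled (fun p => (h p)^-1).
Proof.
move=> m0 hm [L [L0 h1 h2]]; exists (m + m * m * L).
have nn z : 0 <= normc z := normc_ge0 z.
have n0 p : Z p -> 0 < normc (h p).
  by move=> /hm; rewrite lt_neqAle nn andbT eq_sym; case: eqP => // ->; rewrite mulr0 ler10.
have inv p : Z p -> (normc (h p))^-1 <= m.
  by move=> Zp; rewrite -[leLHS]mul1r ler_pdivrMr ?n0 // hm.
have mL : 0 <= m * m * L by rewrite !mulr_ge0.
split=> [|p Zp|p q t Zp Zq t0 pq]; first exact: addr_ge0.
  by rewrite ComplexField.Normc.normcV; apply: le_trans (inv p Zp) _; rewrite lerDl.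
have hn p' : Z p' -> h p' != 0.
  by move=> /n0; apply: contraTneq => ->; rewrite ComplexField.Normc.normc0 ltxx.
have -> : (h p)^-1 - (h q)^-1 = (h p)^-1 * (h q)^-1 * (h q - h p).
  by field; rewrite !hn.
rewrite !ComplexField.Normc.normcM !ComplexField.Normc.normcV.
have -> : normc (h q - h p) = normc (h p - h q) by rewrite -normcN opprB.
apply: (@le_trans _ _ (m * m * (L * t))); last by rewrite mulrA ler_wpM2r // lerDr.
apply: ler_pM => //; rewrite ?mulr_ge0 ?invr_ge0 //; last exact: h2.
by apply: ler_pM; rewrite ?invr_ge0 // inv.
Qed.

Lemma controlled_sum (I : Type) (s : seq I) (P : pred I) (h : I -> T -> C) :
  (forall i, P i -> controlled (h i)) -> controlled (fun p => \sum_(i <- s | P i) h i p).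
Proof.
move=> H; elim: s => [|i s IH].
  by apply: controlled_ext (controlled_cst 0) => p _; rewrite big_nil.
have [Pi|Pi] := boolP (P i).
  by apply: controlled_ext (controlledD (H i Pi) IH) => p _; rewrite big_cons Pi.
by apply: controlled_ext IH => p _; rewrite big_cons (negbTE Pi).
Qed.

Lemma controlled_prod (I : Type) (s : seq I) (h : I -> T -> C) :
  (forall i, controlled (h i)) -> controlled (fun p => \prod_(i <- s) h i p).
Proof.
move=> H; elim: s => [|i s IH].
  by apply: controlled_ext (controlled_cst 1) => p _; rewrite big_nil.
by apply: controlled_ext (controlledM (H i) IH) => p _; rewrite big_cons.
Qed.

Lemma controlledN h : controlled h -> controlled (fun p => - h p).
Proof.
move=> hh; apply: controlled_ext (controlledM (controlled_cst (-1)) hh) => p _.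
by rewrite mulN1r.
Qed.

Lemma controlled_det n (A : T -> 'M[C]_n) :
  (forall i j, controlled (fun p => A p i j)) -> controlled (fun p => \det (A p)).
Proof.
move=> hA; apply: controlled_sum => s _; apply: controlledM; first exact: controlled_cst.
exact: controlled_prod.
Qed.

(** Cramer's formula, with the determinant bounded away from 0. *)
Lemma controlled_invmx n (A : T -> 'M[C]_n) (m : R) : 0 <= m ->
  (forall p, Z p -> 1 <= m * normc (\det (A p))) ->
  (forall i j, controlled (fun p => A p i j)) ->
  forall i j, controlled (fun p => invmx (A p) i j).
Proof.
move=> m0 hm hA i j.
have h : controlled (fun p => (\det (A p))^-1 * ((-1) ^+ (j + i) * \det (row' j (col' i (A p))))).
  apply: controlledM; first exact: (controlledV m0 hm (controlled_det hA)).
  apply: controlledM; first exact: controlled_cst.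
  apply: controlled_det => k l.
  by apply: controlled_ext (hA (lift j k) (lift i l)) => p _; rewrite !mxE.
apply: controlled_ext h => p /hm hp; rewrite /invmx unitmxE unitfE.
have -> : \det (A p) != 0.
  by apply: contraTneq hp => ->; rewrite ComplexField.Normc.normc0 mulr0 ler10.
by rewrite !mxE.
Qed.

End Controlled.

Section ControlledThin.
Variables (R : realType) (N M : nat) (I : {set 'I_N}) (Z : set ('rV[R]_N * R)).

Definition close_on (t : R) (p q : 'rV[R]_N * R) :=
  (forall i, i \in I -> `|p.1 0 i - q.1 0 i| <= t) /\ `|p.2 - q.2| <= t.

Hypothesis Z_bounded : forall p, Z p -> (forall i, `|p.1 0 i| <= M%:R) /\ `|p.2| <= M%:R.
Hypothesis Z_controlled : forall i, controlled Z close_on (fun p => (p.1 0 i)%:C%C).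

Let bucket (D : nat) (t : R) := Num.trunc ((t + M%:R) * D%:R).

Let bucket_lt D t : `|t| <= M%:R -> (bucket D t < (2 * M * D).+1)%N.
Proof.
rewrite ler_norml => /andP[h1 h2].
have h : 0 <= (t + M%:R) * D%:R by rewrite mulr_ge0 // ; lra.
have /andP[h3 _] := truncn_itv h; rewrite ltnS -(ler_nat R).
apply: le_trans h3 _; rewrite !natrM; apply: ler_wpM2r => //.
by move: h2; rewrite -[2%:R]/(1 + 1 : R); lra.
Qed.

Let bucket_close D s t : (0 < D)%N -> `|s| <= M%:R -> `|t| <= M%:R ->
  bucket D s = bucket D t -> `|s - t| <= D%:R^-1.
Proof.
move=> D0; rewrite !ler_norml => /andP[s1 s2] /andP[t1 t2].
have D0' : 0 < D%:R :> R by rewrite ltr0n.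
have hs : 0 <= (s + M%:R) * D%:R by rewrite mulr_ge0 //; lra.
have ht : 0 <= (t + M%:R) * D%:R by rewrite mulr_ge0 //; lra.
have := truncn_itv hs; have := truncn_itv ht; rewrite /bucket => + + e; rewrite e -natr1.
set u := _%:R => /andP[a1 a2] /andP[a3 a4].
have e1 : (s - t) * D%:R <= 1 by nra.
have e2 : - 1 <= (s - t) * D%:R by nra.
have -> : s - t = (s - t) * D%:R * D%:R^-1 by field; rewrite gt_eqF.
have Di : 0 <= D%:R^-1 :> R by rewrite invr_ge0 ltW.
apply/andP; split; last by rewrite -[leRHS]mul1r ler_wpM2r.
by rewrite -mulN1r ler_wpM2r.
Qed.

(** The coordinates in [I] and the last component are cut into cells of side [1 / D] with
    [D = L * k]. Two points in one cell are at distance at most [L / D = 1 / k], so separated points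
    occupy distinct cells; the exponent [#|I|.+1] counts the last component. *)
Lemma controlled_thin : thin #|I|.+1 [set x | exists lam, Z (x, lam)].
Proof.
have [L [L0 hL]] : exists L : nat, (0 < L)%N /\ forall i p q t, Z p -> Z q -> 0 <= t ->
    close_on t p q -> `|p.1 0 i - q.1 0 i| <= L%:R * t.
  have /choice[l hl] : forall i, exists l : nat, forall p q t, Z p -> Z q -> 0 <= t ->
      close_on t p q -> `|p.1 0 i - q.1 0 i| <= l%:R * t.
    move=> i; have [c [c0 _ hc]] := Z_controlled i; exists (Num.trunc c).+1 => p q t Zp Zq t0 pq.
    have /andP[_ /ltW ce] := truncn_itv c0.
    apply: le_trans (ler_wpM2r t0 ce); have := hc p q t Zp Zq t0 pq.
    by rewrite -rmorphB /= expr0n addr0 sqrtr_sqr.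
  exists (\sum_i l i).+1; split => // i p q t Zp Zq t0 pq.
  apply: le_trans (hl i p q t Zp Zq t0 pq) _; rewrite ler_wpM2r // ler_nat.
  by rewrite (bigD1 i) //= -addnS leq_addr.
exists ((2 * M * L).+1 ^ #|I|.+1)%N => k J y k0 hy hd.
have /choice[lam hlam] := hy; pose D := (L * k)%N; pose q := (2 * M * D).+1.
have D0 : (0 < D)%N by rewrite muln_gt0 L0.
pose cell j : {ffun {i | i \in I} -> 'I_q} * 'I_q :=
  ([ffun i => inord (bucket D (y j 0 (val i)))], inord (bucket D (lam j))).
have cellI : injective cell.
  move=> j j' [e1 e2]; apply/eqP; apply: contraT => /hd; rewrite ltNge => /negP[].
  have [b1 b2] := Z_bounded (hlam j); have [b3 b4] := Z_bounded (hlam j').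
  have hc : close_on D%:R^-1 (y j, lam j) (y j', lam j').
    split=> [i iI|] /=; apply: bucket_close => //.
      have := congr1 (fun F : {ffun {i | i \in I} -> 'I_q} => nat_of_ord (F (exist _ i iI))) e1.
      by rewrite !ffunE /= !inordK //; apply: bucket_lt.
    by have := congr1 (@nat_of_ord _) e2; rewrite !inordK //; apply: bucket_lt.
  have k0' : 0 < k%:R :> R by rewrite ltr0n.
  have L0' : 0 < L%:R :> R by rewrite ltr0n.
  apply: rV_norm_le => [|i]; first by rewrite invr_ge0 ltW.
  rewrite !mxE; have := hL i _ _ _ (hlam j) (hlam j') _ hc; rewrite invr_ge0 ler0n /= => /(_ isT).
  by rewrite natrM invfM mulVKf ?gt_eqF.
apply: leq_trans (leq_card cell cellI) _.
rewrite card_prod card_ffun !card_ord card_sig -expnSr -expnMn leq_exp2r //.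
by rewrite /q /D; nia.
Qed.

End ControlledThin.

(** * Pieces of the parameter set *)

Section Pieces.
Variables (R : realType) (V E : finType) (G : graph V E) (O : {set E}).
Hypothesis hO : orientation G O.
Local Notation N := (#|E| + #|V|)%N.
Local Notation C := R[i].
Local Notation normc := (@ComplexField.Normc.normc R).
Local Notation entry p := (adj_entry G (weight_of G O p.1) (potential_of p.1)).

Section Piece.
Variables (F : {set E}) (X : {set V}) (M s : nat) (f : {ffun 'I_s -> V}).

Definition core (p : 'rV[R]_N * R) : 'M[C]_s :=
  \matrix_(i, j) ((p.2)%:C%C *+ (i == j) - entry p (f i) (f j)).

(** The single number [M] bounds the coordinates and [lam] and keeps the minor away from 0:
    countably many pieces suffice, and inverses stay controlled. Of the identity in [hermitian_core]
    only the diagonal entries are recorded, as they determine the remaining potentials. *)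
Definition piece : set ('rV[R]_N * R) := [set p |
  [/\ forall e, e \notin F -> weight_of G O p.1 e = 0,
      (forall i, `|p.1 0 i| <= M%:R) /\ `|p.2| <= M%:R,
      1 <= M%:R * normc (\det (core p)) &
      forall v, v \in X -> v \notin codom f -> (p.2)%:C%C - entry p v v =
        \sum_j (\sum_i entry p v (f i) * invmx (core p) i j) * entry p (f j) v]].

(* On a piece the remaining coordinates are Lipschitz functions of these and of
   the eigenvalue. *)
Definition kept : {set 'I_N} :=
  ([set edge_coord V e | e in F] :|:
   [set vertex_coord E v | v in ~: (X :\: [set v in codom f])])%SET.

Lemma card_kept : injective f -> (forall i, f i \in X) ->
  (#|kept| + #|~: F|%SET + #|X| <= N + s)%N.
Proof.
move=> fI fX; have hX : (#|X :\: [set v in codom f]|%SET + s = #|X|)%N.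
  have cs : #|[set v in codom f]%SET| = s.
    by rewrite cardsE card_codom // card_ord.
  rewrite -[in RHS](finset.cardsID [set v in codom f]%SET X) addnC; congr addn.
  rewrite (finset.setIidPr _) ?cs //; apply/fintype.subsetP => v.
  by rewrite inE => /codomP[i ->].
have h1 : (#|kept| <= #|F| + #|~: (X :\: [set v in codom f])|%SET)%N.
  by apply: leq_trans (leq_card_setU _ _) _; apply: leq_add; exact: leq_imset_card.
have := cardsC F; have := cardsC (X :\: [set v in codom f])%SET.
move: h1 hX; rewrite /=.
set a := #|kept|; set b := #|~: (_ :\: _)|%SET; set c := #|_ :\: _|%SET; lia.
Qed.

Local Notation ctrl := (controlled piece (close_on kept)).

Lemma controlled_kept i : i \in kept -> ctrl (fun p => (p.1 0 i)%:C%C).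
Proof.
move=> iI; exists (M%:R + 1); split=> [|p [_ [hM _] _ _]|p q t _ _ t0 [h _]].
- by rewrite addr_ge0.
- by rewrite /= expr0n addr0 sqrtr_sqr; apply: le_trans (hM i) _; rewrite lerDl.
rewrite -rmorphB /= expr0n addr0 sqrtr_sqr; apply: le_trans (h i iI) _.
by rewrite mulrDl mul1r lerDr mulr_ge0.
Qed.

Lemma controlled_lam : ctrl (fun p => (p.2)%:C%C).
Proof.
exists (M%:R + 1); split=> [|p [_ [_ hM] _ _]|p q t _ _ t0 [_ h]].
- by rewrite addr_ge0.
- by rewrite /= expr0n addr0 sqrtr_sqr; apply: le_trans hM _; rewrite lerDl.
rewrite -rmorphB /= expr0n addr0 sqrtr_sqr; apply: le_trans h _.
by rewrite mulrDl mul1r lerDr mulr_ge0.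
Qed.

Lemma controlled_edge e : ctrl (fun p => (p.1 0 (edge_coord V e))%:C%C).
Proof.
have [eF|eF] := boolP (e \in F).
  by apply: controlled_kept; rewrite inE imset_f.
apply: controlled_ext (controlled_cst _ _ 0) => p [h _ _ _].
by have /eqP := h e eF; rewrite weight_of_eq0 => /andP[/eqP -> _].
Qed.

Lemma controlled_weight e : ctrl (fun p => weight_of G O p.1 e).
Proof.
have gen g g' (c : R) : ctrl (fun p => (p.1 0 (edge_coord V g))%:C%C +
    Complex 0 c * (p.1 0 (edge_coord V g'))%:C%C).
  apply: controlledD; first exact: controlled_edge.
  by apply: controlledM; [exact: controlled_cst | exact: controlled_edge].
rewrite /weight_of; case: (e \in O).
  apply: controlled_ext (gen e (rev G e) 1) => p _.
  by apply/eqP; rewrite eq_complex /=; apply/andP; split; apply/eqP; ring.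
apply: controlled_ext (gen (rev G e) e (-1)) => p _.
by apply/eqP; rewrite eq_complex /=; apply/andP; split; apply/eqP; ring.
Qed.

Lemma controlled_edges u v : ctrl (fun p =>
  \sum_(e | (src G e == u) && (tgt G e == v)) conjc (weight_of G O p.1 e)).
Proof.
apply: controlled_sum => e _.
apply: controlled_ext (controlled_weight (rev G e)) => p _.
by rewrite (weight_of_hermitian hO).
Qed.

Lemma controlled_entry u v : (u == v -> vertex_coord E u \in kept) -> ctrl (fun p => entry p u v).
Proof.
move=> huv; rewrite /adj_entry; apply: controlledD; last exact: controlled_edges.
by case: eqP huv => [_ /(_ isT)/controlled_kept|_ _]; [apply: controlled_ext | exact: controlled_cst].
Qed.

(** A potential that is not kept is solved from the diagonal identity of [piece], whose other terms
    involve weights, kept potentials and [lam]. *)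
Lemma controlled_vertex v : ctrl (fun p => (p.1 0 (vertex_coord E v))%:C%C).
Proof.
have kf u i : u == f i -> vertex_coord E u \in kept.
  move=> /eqP ->; rewrite inE; apply/orP; right; apply: imset_f.
  by rewrite !inE codom_f.
have [vk|vk] := boolP (vertex_coord E v \in kept); first exact: controlled_kept.
have [vX vf] : v \in X /\ v \notin codom f.
  apply/andP; apply: contraNT vk => h; rewrite inE; apply/orP; right; apply: imset_f.
  by rewrite !inE andbC.
have cc i j : ctrl (fun p => core p i j).
  have h : ctrl (fun p => (if i == j then 1 else 0) * (p.2)%:C%C - entry p (f i) (f j)).
    apply: controlledD.
      by apply: controlledM; [exact: controlled_cst | exact: controlled_lam].
    by apply/controlledN/controlled_entry => _; apply: kf.
  by apply: controlled_ext h => p _; rewrite mxE; case: eqP; rewrite ?mul1r ?mul0r.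
have h : ctrl (fun p => (p.2)%:C%C -
   \sum_(e | (src G e == v) && (tgt G e == v)) conjc (weight_of G O p.1 e) -
   \sum_j (\sum_i entry p v (f i) * invmx (core p) i j) * entry p (f j) v).
  apply: controlledD; first (apply: controlledD; first exact: controlled_lam).
    exact/controlledN/controlled_edges.
  apply/controlledN/controlled_sum => j _; apply: controlledM.
    apply: controlled_sum => i _; apply: controlledM; first exact/controlled_entry/kf.
    by apply: (@controlled_invmx _ _ _ _ _ _ M%:R) => // p [].
  by apply: controlled_entry => _; apply: (kf _ j).
apply: controlled_ext h => p [_ _ _ hp]; rewrite -hp //.
by rewrite /adj_entry eqxx; ring.
Qed.

Lemma piece_thin : thin #|kept|.+1 [set x | exists lam, piece (x, lam)].
Proof.
apply: (@controlled_thin _ _ M) => [p []//|i].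
rewrite -(splitK i); case: (fintype.split i) => j /=.
  by rewrite -(enum_valK j); exact: controlled_edge.
by rewrite -(enum_valK j); exact: controlled_vertex.
Qed.

End Piece.

Lemma excess_set_pieces F X x : excess_set G O F X x ->
  exists (M s : nat) (f : {ffun 'I_s -> V}), [/\ injective f, forall i, f i \in X,
    (s + #|outer G F X| < #|X|)%N & exists lam, piece F X M f (x, lam)].
Proof.
move=> [hF [lam hk]].
pose a := weight_of G O x; pose b := potential_of x.
have ha : hermitian_weights G a := weight_of_hermitian hO x.
pose A : 'M[C]_#|X| := (lam%:C%C%:M - adj_matrix G a b X)%R.
have hA i j : A i j = conjc (A j i).
  rewrite /A; move: (adj_matrix G a b X) (adj_matrix_hermitian b (X := X) ha) => D hD.
  by rewrite !mxE hD eq_sym rmorphB rmorphMn /= oppr0.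
have [g [gI gU gE]] := hermitian_core hA.
pose f : {ffun 'I_(\rank A) -> V} := [ffun i => enum_val (g i)].
have fI : injective f by move=> i j; rewrite !ffunE => /enum_val_inj/gI.
have coreE : core f (x, lam) = mxsub g g A.
  apply/matrixP => i j; rewrite !mxE !ffunE /= -/a -/b; congr (_ *+ _ - _).
  by rewrite (inj_eq gI).
have dn0 : 0 < normc (\det (mxsub g g A)).
  rewrite lt_neqAle normc_ge0 andbT eq_sym; apply/eqP => /ComplexField.Normc.eq0_normc h.
  by move: gU; rewrite unitmxE unitfE h eqxx.
(* The three terms dominate [lam], each coordinate and the inverse of the minor, as [piece]
   requires. *)
pose T := `|lam| + \sum_i `|x 0 i| + (normc (\det (mxsub g g A)))^-1.
pose M := (Num.trunc T).+1.
have S0 : 0 <= \sum_i `|x 0 i| by exact: sumr_ge0.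
have d0 : 0 <= (normc (\det (mxsub g g A)))^-1 by rewrite invr_ge0 ltW.
have T0 : 0 <= T by rewrite !addr_ge0.
have TM : T <= M%:R by have /andP[_ /ltW] := truncn_itv T0.
exists M, (\rank A), f; split => //.
  by move=> i; rewrite ffunE; exact: enum_valP.
exists lam; split => //=.
- split=> [i|]; apply: le_trans TM; rewrite /T.
    have h : `|x 0 i| <= \sum_i `|x 0 i|.
      by rewrite (bigD1 i) //= lerDl; apply: sumr_ge0.
    have := normr_ge0 lam; lra.
  by rewrite -addrA lerDl addr_ge0.
- rewrite coreE -ler_pdivrMr // mul1r; apply: le_trans TM; rewrite /T lerDr.
  by rewrite addr_ge0.
move=> v vX vf; rewrite coreE.
have [k kv] : exists k : 'I_#|X|, enum_val k = v.
  by exists (enum_rank_in vX v); rewrite enum_rankK_in.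
have Av i : A k (g i) = - adj_entry G a b v (f i).
  rewrite !mxE kv ffunE; case: eqP => [e|_]; last by rewrite mulr0n sub0r.
  by case/negP: vf; apply/codomP; exists i; rewrite ffunE -e.
have Av' i : A (g i) k = - adj_entry G a b (f i) v.
  rewrite !mxE kv ffunE; case: eqP => [e|_]; last by rewrite mulr0n sub0r.
  by case/negP: vf; apply/codomP; exists i; rewrite ffunE e.
have -> : lam%:C%C - adj_entry G a b v v = A k k by rewrite !mxE kv eqxx mulr1n.
rewrite {1}gE mxE; apply: eq_bigr => j _; rewrite [rowsub _ _ _ _]mxE Av' mulrN -mulNr.
congr (_ * _); rewrite mxE -sumrN; apply: eq_bigr => i _.
by rewrite [colsub _ _ _ _]mxE Av mulNr opprK.
Qed.

End Pieces.

Lemma cube_dimension_bound (R : realType) (V E : finType) (G : graph V E)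
    (dmin : nat) (O : {set E}) (r : V) (A : set 'rV[R]_(#|E| + #|V|)) (d : nat) :
  connected_graph G -> has_cycle G -> (forall v : V, (dmin <= #|neighbors G v|)%N) ->
  orientation G O -> A `<=` point_spectrum_params G O r ->
  diffeomorphic A (@open_cube R d) -> (d + maxn (dmin - 1) 1 <= #|E| + #|V|)%N.
Proof.
move=> hconn hcycle hdmin hO AP hA.
pose T : countType := ({set E} * {set V} * nat * {s : nat & {ffun 'I_s -> V}})%type.
pose ok (t : T) := let: (F, X, M, existT s f) := t in
  [/\ sym_edges G F, forest G (inner G F X), injective f, forall i, f i \in X &
     (s + #|outer G F X| < #|X|)%N].
pose I : countType := {t : T | `[< ok t >]}.
pose S (i : I) : set 'rV[R]_(#|E| + #|V|) := let: (F, X, M, existT s f) := val i in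
  [set x | exists lam, piece G O F X M f (x, lam)].
pose n (i : I) := let: (F, X, M, existT s f) := val i in #|kept F X f|.+1.
have [||i hi] := @diffeomorphic_cube_dimension R _ d A hA I S n.
- move=> x /AP; rewrite point_spectrum_paramsE // => -[F [X [hF hf hx]]].
  have [M [s [f [fI fX hs [lam hp]]]]] := excess_set_pieces hO hx.
  have okt : `[< ok (F, X, M, existT _ s f) >] by apply/asboolP; split.
  by exists (exist (fun t => is_true `[< ok t >]) _ okt); last by exists lam.
- by move=> [[[[F X] M] [s f]] h]; apply: piece_thin.
apply: leq_trans (_ : (n i + maxn (dmin - 1) 1 <= _)%N); first by rewrite leq_add2r.
case: i {hi} => -[[[F X] M] [s f]] h; rewrite /n /=.
have /asboolP[hF hf fI fX hs] := h.
have X0 : X != finset.set0.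
  by rewrite -card_gt0; apply: leq_ltn_trans hs.
(* The strictness of [u + m < x] pays for the coordinate [lam], which accounts for the successor in
   [k.+1]. *)
have arith (k c p q x m u : nat) : (k + p + x <= q + u)%N -> (u + m < x)%N ->
  (c <= p + m)%N -> (k.+1 + c <= q)%N by lia.
exact: arith (card_kept F fI fX) hs (codim_count hF hf hconn hcycle X0 hdmin).
Qed.

Theorem theorem3p5 (R : realType) (V E : finType) (G : graph V E)
    (dmin : nat) (O : {set E}) (r : V)
    (hconn : connected_graph G)
    (hcycle : has_cycle G)
    (hdmin : forall v : V, (dmin <= #|neighbors G v|)%N)
    (hO : orientation G O) :
  let P : set 'rV[R]_(#|E| + #|V|) := point_spectrum_params G O r in
  [/\ closed P,
      semialgebraic P
    & ((maxn (dmin - 1) 1)%:R%:E <= semialg_codim P)%E].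
Proof.
move=> P; have [h1 h2] := point_spectrum_params_algebraic R hO r hconn.
split => //; rewrite /semialg_codim; set c := maxn _ _.
have : (semialg_dim P <= ((#|E| + #|V|)%N%:R - c%:R)%:E)%E.
  apply: ge_ereal_sup => _ [l [C [d [[PC _ hC] [i ->]]]]].
  rewrite lee_fin lerBrDr -natrD ler_nat.
  apply: (@cube_dimension_bound _ _ _ _ _ _ r _ _ hconn hcycle hdmin hO _ (hC i).2).
  by move=> x Cx; change (P x); rewrite PC; exists i.
(* An empty parameter set has dimension [-oo], hence codimension [+oo]. *)
case: (semialg_dim P) => [D| |] //=.
  by rewrite !lee_fin; lra.
by rewrite addey ?leey.
Qed.
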